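(* Let $\mathbf S$ be a category with finite products and let $\mathscr C$ be an $\mathbf S$-indexed symmetric monoidal category with indexed homotopy coproducts preserved by $\otimes$. Let $M\in\mathscr C^A$ be fiberwise dualizable. (i) For any $Q\in\mathscr C^{A\times A}$, $P\in\mathscr C^\star$ and $g\colon Q\odot\widehat M\to\widehat M\odot P$, with corresponding morphism $\overline g\colon(\Delta_A)^*Q\otimes M\to M\otimes\pi_A^*P$ in $\mathscr C^A$, the bicategorical trace $$\mathrm{tr}(g)\colon(\pi_A)_!(\Delta_A)^*Q=\langle\langle Q\rangle\rangle\longrightarrow\langle\langle P\rangle\rangle=P$$ and the symmetric monoidal trace $$\mathrm{tr}(\overline g)\colon(\Delta_A)^*Q\longrightarrow(\pi_A)^*P$$ are adjuncts under the adjunction $(\pi_A)_!\dashv(\pi_A)^*$. In other words, $\mathrm{tr}(g)$ is the composite $(\pi_A)_!(\Delta_A)^*Q\xrightarrow{(\pi_A)_!\mathrm{tr}(\overline g)}(\pi_A)_!(\pi_A)^*P\to P$ with the counit, and $\mathrm{tr}(\overline g)$ is the composite $(\Delta_A)^*Q\to(\pi_A)^*(\pi_A)_!(\Delta_A)^*Q\xrightarrow{(\pi_A)^*\mathrm{tr}(g)}(\pi_A)^*P$ with the unit. (ii) For any $Q,P\in\mathscr C^A$ and $f\colon Q\otimes M\to M\otimes P$, with corresponding morphism $\widetilde f\colon(\Delta_A)_!Q\odot\widehat M\to\widehat M\odot(\pi_A)_!P$, the morphism $(\pi_A)_!\mathrm{tr}(f)\colon(\pi_A)_!Q\to(\pi_A)_!P$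 is equal to the composite $$(\pi_A)_!Q\longrightarrow(\pi_A)_!(\Delta_A)^*(\Delta_A)_!Q\xrightarrow{\mathrm{tr}(\widetilde f)}(\pi_A)_!P,$$ where the first morphism is induced by the unit of $(\Delta_A)_!\dashv(\Delta_A)^*$. (iii) For any $Q\in\mathscr C^A$ and $P\in\mathscr C^\star$, there is a bijection between morphisms $f\colon Q\otimes M\to M\otimes(\pi_A)^*P$ and morphisms $\widehat f\colon(\Delta_A)_!Q\odot\widehat M\to\widehat M\odot P$, and for a corresponding pair of such morphisms the following two composites $(\pi_A)_!Q\to P$ are equal: $$(\pi_A)_!Q\longrightarrow(\pi_A)_!(\Delta_A)^*(\Delta_A)_!Q\xrightarrow{\mathrm{tr}(\widehat f)}P\qquad\text{and}\qquad(\pi_A)_!Q\xrightarrow{(\pi_A)_!\mathrm{tr}(f)}(\pi_A)_!(\pi_A)^*P\longrightarrow P,$$ where the unlabelled morphisms are induced by the unit of $(\Delta_A)_!\dashv(\Delta_A)^*$ and given by the counit of $(\pi_A)_!\dashv(\pi_A)^*$, respectively.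
   Context: **Indexed categories.** $\star$ is the terminal object of $\mathbf S$, $\pi_A\colon A\to\star$ the unique map and $\Delta_A\colon A\to A\times A$ the diagonal; canonical isomorphisms such as $A\times\star\cong A$ are suppressed. An $\mathbf S$-indexed symmetric monoidal category $\mathscr C$ is a pseudofunctor from $\mathbf S^{\mathrm{op}}$ to the 2-category of symmetric monoidal categories, strong symmetric monoidal functors and monoidal natural transformations; its value at $A$ is $(\mathscr C^A,\otimes_A,I_A)$ and its value at $f\colon A\to B$ is the reindexing functor $f^*\colon\mathscr C^B\to\mathscr C^A$. For $M\in\mathscr C^A$, $N\in\mathscr C^B$ the external product is $M\boxtimes N=(\mathrm{id}_A\times\pi_B)^*M\otimes_{A\times B}(\pi_A\times\mathrm{id}_B)^*N\in\mathscr C^{A\times B}$, and $U=I_\star$. There are canonical isomorphisms $M\otimes_AN\cong\Delta_A^*(M\boxtimes N)$, $I_A\cong\pi_A^*U$, $f^*M\boxtimes g^*N\cong(f\times g)^*(M\boxtimes N)$. In the claim, $\otimes=\otimes_A$. **Indexed homotopy coproducts preserved by $\otimes$** means: each $f^*$ has a left adjoint $f_!$; for each square in a class of commutative squares of $\mathbf S$ called homotopy pullback squares, with top $f\colon A\to B$, left $h\colon A\to C$, right $g\colon B\to D$, bottom $k\colon C\to D$, the Beck-Chevalley morphism $f_!h^*\to f_!h^*k^*k_!\cong f_!f^*g^*k_!\to g^*k_!$ is an isomorphism; and for $f\colon A\to B$, $M\in\mathscr C^B$, $N\in\mathscr C^A$ the canonical map $f_!(f^*M\otimes N)\to f_!(f^*M\otimes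 f^*f_!N)\cong f_!f^*(M\otimes f_!N)\to M\otimes f_!N$ is an isomorphism (equivalently, the canonical maps $(f\times g)_!(M\boxtimes N)\to f_!M\boxtimes g_!N$ are isomorphisms). The class of homotopy pullback squares depends on the situation; it is only assumed to contain the following squares, their transposes, and all squares obtained from these by cartesian product with a fixed object: (a) top $f\times\mathrm{id}_C\colon A\times C\to B\times C$, left $\mathrm{id}_A\times g\colon A\times C\to A\times D$, right $\mathrm{id}_B\times g$, bottom $f\times\mathrm{id}_D$; (b) top and left $\Delta_A\colon A\to A\times A$, right $\mathrm{id}_A\times\Delta_A$, bottom $\Delta_A\times\mathrm{id}_A\colon A\times A\to A\times A\times A$; (c) for $f\colon A\to B$: top $(\mathrm{id}_A,f)\colon A\to A\times B$, left $f\colon A\to B$, right $f\times\mathrm{id}_B$, bottom $\Delta_B$. The square with top and left $\mathrm{id}_A$ and right and bottom $\Delta_A$ is not assumed to belong to it. **The bicategory $\mathscr C/_{\mathbf S}$** has the objects of $\mathbf S$ as 0-cells and hom-categories $\mathscr C/_{\mathbf S}(A,B)=\mathscr C^{A\times B}$. For 1-cells $M\colon A\to B$, $N\colon B\to C$, $M\odot N=(\mathrm{id}_A\times\pi_B\times\mathrm{id}_C)_!(\mathrm{id}_A\times\Delta_B\times\mathrm{id}_C)^*(M\boxtimes N)\colon A\to C$; units are $U_A=(\Delta_A)_!\pi_A^*U\cong(\Delta_A)_!I_A$. The associator identifies both bracketings of a triple composite, via pseudofunctoriality, compatibility of $\boxtimes$ with reindexing and pushforward, and Beck-Chevalley for (a),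 with $(\mathrm{id}_A\times\pi_B\times\pi_C\times\mathrm{id}_D)_!(\mathrm{id}_A\times\Delta_B\times\Delta_C\times\mathrm{id}_D)^*(M\boxtimes N\boxtimes P)$. The right unitor is $M\odot U_B\cong(\mathrm{id}_A\times\pi_B\times\mathrm{id}_B)_!(\mathrm{id}_A\times\Delta_B)_!(\mathrm{id}_A\times\Delta_B)^*(\mathrm{id}_A\times\mathrm{id}_B\times\pi_B)^*(M\boxtimes U)\cong M$, by Beck-Chevalley for (b) and $(\pi\times\mathrm{id})\Delta=\mathrm{id}=(\mathrm{id}\times\pi)\Delta$; the left unitor is analogous. **Shadow.** $\langle\langle M\rangle\rangle=(\pi_A)_!(\Delta_A)^*M\in\mathscr C^\star$ for $M\colon A\to A$. For $M\colon A\to B$, $N\colon B\to A$ the isomorphism $\theta\colon\langle\langle M\odot N\rangle\rangle\cong\langle\langle N\odot M\rangle\rangle$ identifies the two sides (by Beck-Chevalley for (a)) with $(\pi_{A\times B})_!\delta^*(M\boxtimes N)$ and $(\pi_{A\times B})_!\delta'^*(N\boxtimes M)$, where $\delta(a,b)=(a,b,b,a)$ and $\delta'(a,b)=(b,a,a,b)$, and then uses the isomorphism $M\boxtimes N\cong\gamma^*(N\boxtimes M)$ given by the symmetry of $\otimes$ ($\gamma$ the swap). On $\mathscr C/_{\mathbf S}(\star,\star)\simeq\mathscr C^\star$, $\odot$ is $\otimes$ and the shadow is the identity, up to canonical isomorphism. **Duality and trace.** An object $M$ of a symmetric monoidal category is dualizable if there are $M^\bigstar$, $\eta\colon I\to M\otimes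 M^\bigstar$, $\epsilon\colon M^\bigstar\otimes M\to I$ satisfying the triangle identities; the trace of $f\colon Q\otimes M\to M\otimes P$ is $Q\xrightarrow{\mathrm{id}\otimes\eta}Q\otimes M\otimes M^\bigstar\xrightarrow{f\otimes\mathrm{id}}M\otimes P\otimes M^\bigstar\cong M^\bigstar\otimes M\otimes P\xrightarrow{\epsilon\otimes\mathrm{id}}P$. A 1-cell $M\colon R\to S$ of a bicategory is right dualizable if there are $M^\bigstar\colon S\to R$, $\eta\colon U_R\to M\odot M^\bigstar$, $\epsilon\colon M^\bigstar\odot M\to U_S$ satisfying the triangle identities; the trace of $f\colon Q\odot M\to M\odot P$ is $\langle\langle Q\rangle\rangle\to\langle\langle Q\odot M\odot M^\bigstar\rangle\rangle\to\langle\langle M\odot P\odot M^\bigstar\rangle\rangle\xrightarrow{\theta}\langle\langle M^\bigstar\odot M\odot P\rangle\rangle\to\langle\langle P\rangle\rangle$, using $\eta,f,\theta,\epsilon$ in turn. **Fiberwise duality.** $M\in\mathscr C^A$ is fiberwise dualizable if it is dualizable in $\mathscr C^A$. $\widehat M\colon A\to\star$ denotes $M$ regarded as a 1-cell of $\mathscr C/_{\mathbf S}$ via $A\cong A\times\star$; when $M$ is fiberwise dualizable, $\widehat M$ is right dualizable. **The corresponding morphisms.** There are canonical isomorphisms $\widehat M\odot P\cong M\boxtimes P\cong M\otimes\pi_A^*P$ for $P\in\mathscr C^\star$, and $(\Delta_A)_!Q\odot\widehat M\cong(\mathrm{id}_A\times\pi_A)_!(\mathrm{id}_A\times\Delta_A)^*(\Delta_A\times\mathrm{id}_A)_!(Q\boxtimes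 M)\cong(\mathrm{id}_A\times\pi_A)_!(\Delta_A)_!(\Delta_A)^*(Q\boxtimes M)\cong(\Delta_A)^*(Q\boxtimes M)\cong Q\otimes M$ for $Q\in\mathscr C^A$ (Beck-Chevalley for (b)). In (i), $\overline g$ is the composite $(\Delta_A)^*Q\otimes M\cong(\Delta_A)^*(\mathrm{id}_A\times\Delta_A)^*(Q\boxtimes M)\to(\Delta_A)^*(\mathrm{id}_A\times\pi_A)^*(\mathrm{id}_A\times\pi_A)_!(\mathrm{id}_A\times\Delta_A)^*(Q\boxtimes M)\cong(\mathrm{id}_A\times\pi_A)_!(\mathrm{id}_A\times\Delta_A)^*(Q\boxtimes M)=Q\odot\widehat M\xrightarrow{g}\widehat M\odot P\cong M\otimes\pi_A^*P$, where the arrow is the unit of $(\mathrm{id}_A\times\pi_A)_!\dashv(\mathrm{id}_A\times\pi_A)^*$ and the next isomorphism comes from $(\mathrm{id}_A\times\pi_A)\Delta_A=\mathrm{id}_A$. In (ii), $\widetilde f$ is the composite $(\Delta_A)_!Q\odot\widehat M\cong Q\otimes M\xrightarrow{f}M\otimes P\to M\otimes(\pi_A)^*(\pi_A)_!P\cong\widehat M\odot(\pi_A)_!P$, using the unit of $(\pi_A)_!\dashv(\pi_A)^*$. In (iii), $\widehat f$ is the composite $(\Delta_A)_!Q\odot\widehat M\cong Q\otimes M\xrightarrow{f}M\otimes(\pi_A)^*P\cong\widehat M\odot P$. *)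

(* Defs.v *)
From Corelib Require Import ssreflect.

Set Implicit Arguments.
Unset Strict Implicit.
Unset Printing Implicit Defensive.

Declare Scope cat_scope.
Delimit Scope cat_scope with cat.
Local Open Scope cat_scope.

(* Composition is written in diagrammatic order: [f ;; g] is "f, then g". *)

Record category := Category {
  ob :> Type;
  hom : ob -> ob -> Type;
  idm : forall X, hom X X;
  comp : forall X Y Z, hom X Y -> hom Y Z -> hom X Z;
  comp1m : forall X Y (f : hom X Y), comp (idm X) f = f;
  compm1 : forall X Y (f : hom X Y), comp f (idm Y) = f;
  compA : forall X Y Z W (f : hom X Y) (g : hom Y Z) (h : hom Z W),
    comp (comp f g) h = comp f (comp g h)
}.
Arguments hom {c} X Y.
Arguments idm {c} X.
Arguments comp {c X Y Z} f g.

Notation "f ;; g" := (comp f g) (at level 50, left associativity) : cat_scope.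

Record iso (C : category) (X Y : C) := Iso {
  fwd : hom X Y;
  bwd : hom Y X;
  fwdK : fwd ;; bwd = idm X;
  bwdK : bwd ;; fwd = idm Y
}.
Arguments iso {C} X Y.

Record inverse (C : category) (X Y : C) (f : hom X Y) := Inverse {
  inv : hom Y X;
  mulmV : f ;; inv = idm X;
  mulVm : inv ;; f = idm Y
}.
Arguments inverse {C X Y} f.

Record functor (C D : category) := Functor {
  fob :> C -> D;
  fmap : forall X Y : C, hom X Y -> hom (fob X) (fob Y);
  fmap1 : forall X, fmap (idm X) = idm (fob X);
  fmapM : forall X Y Z (f : hom X Y) (g : hom Y Z),
    fmap (f ;; g) = fmap f ;; fmap g
}.
Arguments fmap {C D} F {X Y} f : rename.

(* An adjunction [L -| R]. *)
Record adjunction (C D : category) (L : functor C D) (R : functor D C) :=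
  Adjunction {
  unit : forall X : C, hom X (R (L X));
  counit : forall Y : D, hom (L (R Y)) Y;
  unit_nat : forall X X' (f : hom X X'),
    f ;; unit X' = unit X ;; fmap R (fmap L f);
  counit_nat : forall Y Y' (g : hom Y Y'),
    fmap L (fmap R g) ;; counit Y' = counit Y ;; g;
  adj_triL : forall X, fmap L (unit X) ;; counit (L X) = idm (L X);
  adj_triR : forall Y, unit (R Y) ;; fmap R (counit Y) = idm (R Y)
}.

Section IsoOps.
Context {C : category}.

Definition iso_refl (X : C) : iso X X := Iso (comp1m _) (comp1m (idm X)).

Definition iso_sym (X Y : C) (i : iso X Y) : iso Y X := Iso (bwdK i) (fwdK i).

Lemma iso_trans1 (X Y Z : C) (i : iso X Y) (j : iso Y Z) :
  (fwd i ;; fwd j) ;; (bwd j ;; bwd i) = idm X.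
Proof. by rewrite compA -(compA (fwd j)) fwdK comp1m fwdK. Qed.

Definition iso_trans (X Y Z : C) (i : iso X Y) (j : iso Y Z) : iso X Z :=
  Iso (iso_trans1 i j) (iso_trans1 (iso_sym j) (iso_sym i)).

Definition iso_of_inverse (X Y : C) (f : hom X Y) (g : inverse f) : iso X Y :=
  Iso (mulmV g) (mulVm g).

Lemma iso_fmap1 (D : category) (F : functor C D) (X Y : C) (i : iso X Y) :
  fmap F (fwd i) ;; fmap F (bwd i) = idm (F X).
Proof. by rewrite -fmapM fwdK fmap1. Qed.

Definition iso_fmap (D : category) (F : functor C D) (X Y : C) (i : iso X Y) :
  iso (F X) (F Y) := Iso (iso_fmap1 F i) (iso_fmap1 F (iso_sym i)).
End IsoOps.

Notation "i >> j" := (iso_trans i j)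
  (at level 50, left associativity) : cat_scope.

Record smcat := SMCat {
  sm_cat :> category;
  tens : sm_cat -> sm_cat -> sm_cat;
  tmap : forall X X' Y Y' : sm_cat,
    hom X X' -> hom Y Y' -> hom (tens X Y) (tens X' Y');
  tone : sm_cat;
  tassoc : forall X Y Z, iso (tens (tens X Y) Z) (tens X (tens Y Z));
  tlunit : forall X, iso (tens tone X) X;
  trunit : forall X, iso (tens X tone) X;
  tsym : forall X Y, iso (tens X Y) (tens Y X);
  tmap1 : forall X Y, tmap (idm X) (idm Y) = idm (tens X Y);
  tmapM : forall X X' X'' Y Y' Y'' (f : hom X X') (f' : hom X' X'')
    (g : hom Y Y') (g' : hom Y' Y''),
    tmap (f ;; f') (g ;; g') = tmap f g ;; tmap f' g';
  tassoc_nat : forall X X' Y Y' Z Z'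
    (f : hom X X') (g : hom Y Y') (h : hom Z Z'),
    tmap (tmap f g) h ;; fwd (tassoc X' Y' Z')
    = fwd (tassoc X Y Z) ;; tmap f (tmap g h);
  tlunit_nat : forall X X' (f : hom X X'),
    tmap (idm tone) f ;; fwd (tlunit X') = fwd (tlunit X) ;; f;
  trunit_nat : forall X X' (f : hom X X'),
    tmap f (idm tone) ;; fwd (trunit X') = fwd (trunit X) ;; f;
  tsym_nat : forall X X' Y Y' (f : hom X X') (g : hom Y Y'),
    tmap f g ;; fwd (tsym X' Y') = fwd (tsym X Y) ;; tmap g f;
  pentagon : forall X Y Z W,
    tmap (fwd (tassoc X Y Z)) (idm W) ;; fwd (tassoc X (tens Y Z) W)
      ;; tmap (idm X) (fwd (tassoc Y Z W))
    = fwd (tassoc (tens X Y) Z W) ;; fwd (tassoc X Y (tens Z W));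
  triangle : forall X Y,
    fwd (tassoc X tone Y) ;; tmap (idm X) (fwd (tlunit Y))
    = tmap (fwd (trunit X)) (idm Y);
  hexagon : forall X Y Z,
    fwd (tassoc X Y Z) ;; fwd (tsym X (tens Y Z)) ;; fwd (tassoc Y Z X)
    = tmap (fwd (tsym X Y)) (idm Z) ;; fwd (tassoc Y X Z)
      ;; tmap (idm Y) (fwd (tsym X Z));
  tsymK : forall X Y, fwd (tsym X Y) ;; fwd (tsym Y X) = idm (tens X Y)
}.
Arguments tens {s} X Y.
Arguments tmap {s X X' Y Y'} f g.
Arguments tone {s}.
Arguments tassoc {s} X Y Z.
Arguments tlunit {s} X.
Arguments trunit {s} X.
Arguments tsym {s} X Y.

Notation "X ⊗ Y" := (tens X Y) (at level 40, left associativity) : cat_scope.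

Lemma iso_tens1 (C : smcat) (X X' Y Y' : C) (i : iso X X') (j : iso Y Y') :
  tmap (fwd i) (fwd j) ;; tmap (bwd i) (bwd j) = idm (tens X Y).
Proof. by rewrite -tmapM !fwdK tmap1. Qed.

Definition iso_tens (C : smcat) (X X' Y Y' : C) (i : iso X X') (j : iso Y Y') :
  iso (tens X Y) (tens X' Y') :=
  Iso (iso_tens1 i j) (iso_tens1 (iso_sym i) (iso_sym j)).

Record smfunctor (C D : smcat) := SMFunctor {
  sm_fun :> functor C D;
  smu : forall X Y : C,
    iso (tens (sm_fun X) (sm_fun Y)) (sm_fun (tens X Y));
  seps : iso (tone : D) (sm_fun tone);
  smu_nat : forall X X' Y Y' (f : hom X X') (g : hom Y Y'),
    tmap (fmap sm_fun f) (fmap sm_fun g) ;; fwd (smu X' Y')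
    = fwd (smu X Y) ;; fmap sm_fun (tmap f g);
  smu_assoc : forall X Y Z,
    tmap (fwd (smu X Y)) (idm (sm_fun Z)) ;; fwd (smu (tens X Y) Z)
      ;; fmap sm_fun (fwd (tassoc X Y Z))
    = fwd (tassoc _ _ _) ;; tmap (idm (sm_fun X)) (fwd (smu Y Z))
      ;; fwd (smu X (tens Y Z));
  smu_lunit : forall X,
    tmap (fwd seps) (idm (sm_fun X)) ;; fwd (smu tone X)
      ;; fmap sm_fun (fwd (tlunit X))
    = fwd (tlunit (sm_fun X));
  smu_runit : forall X,
    tmap (idm (sm_fun X)) (fwd seps) ;; fwd (smu X tone)
      ;; fmap sm_fun (fwd (trunit X))
    = fwd (trunit (sm_fun X));
  smu_sym : forall X Y,
    fwd (smu X Y) ;; fmap sm_fun (fwd (tsym X Y))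
    = fwd (tsym (sm_fun X) (sm_fun Y)) ;; fwd (smu Y X)
}.
Arguments smu {C D} F X Y : rename.
Arguments seps {C D} F : rename.

Record dual (C : smcat) (M : C) := Dual {
  du_ob : C;
  du_eta : hom tone (tens M du_ob);
  du_eps : hom (tens du_ob M) tone;
  du_tri : bwd (tlunit M) ;; tmap du_eta (idm M) ;; fwd (tassoc _ _ _)
    ;; tmap (idm M) du_eps ;; fwd (trunit M) = idm M;
  du_triV : bwd (trunit du_ob) ;; tmap (idm du_ob) du_eta
    ;; bwd (tassoc _ _ _) ;; tmap du_eps (idm du_ob) ;; fwd (tlunit du_ob)
    = idm du_ob
}.
Arguments dual {C} M.

Definition smtrace (C : smcat) (M : C) (D : dual M) (Q P : C)
  (f : hom (tens Q M) (tens M P)) : hom Q P :=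
  bwd (trunit Q) ;; tmap (idm Q) (du_eta D) ;; bwd (tassoc Q M (du_ob D))
  ;; tmap f (idm (du_ob D))
  ;; fwd (tsym (tens M P) (du_ob D))
  ;; bwd (tassoc (du_ob D) M P) ;; tmap (du_eps D) (idm P) ;; fwd (tlunit P).

Record cartcat := CartCat {
  cart_cat :> category;
  star : cart_cat;
  bang : forall A, hom A star;
  bang_uniq : forall A (f g : hom A star), f = g;
  prd : cart_cat -> cart_cat -> cart_cat;
  p1 : forall A B, hom (prd A B) A;
  p2 : forall A B, hom (prd A B) B;
  pair : forall X A B, hom X A -> hom X B -> hom X (prd A B);
  pair_p1 : forall X A B (f : hom X A) (g : hom X B), pair f g ;; p1 A B = f;
  pair_p2 : forall X A B (f : hom X A) (g : hom X B), pair f g ;; p2 A B = g;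
  pair_ext : forall X A B (f g : hom X (prd A B)),
    f ;; p1 A B = g ;; p1 A B -> f ;; p2 A B = g ;; p2 A B -> f = g
}.
Arguments star {c}.
Arguments bang {c} A.
Arguments prd {c} A B.
Arguments p1 {c A B}.
Arguments p2 {c A B}.
Arguments pair {c X A B} f g.

Notation "A ** B" := (prd A B) (at level 40, left associativity) : cat_scope.
Notation "<[ f , g ]>" := (pair f g) (at level 0) : cat_scope.

Section Cartesian.
Context {S : cartcat}.

Definition diag (A : S) : hom A (A ** A) := <[idm A, idm A]>.

Definition xmap (A B C D : S) (f : hom A B) (g : hom C D) :
  hom (A ** C) (B ** D) := <[p1 ;; f, p2 ;; g]>.

Definition swap (A B : S) : hom (A ** B) (B ** A) := <[p2, p1]>.

Lemma comp_pair (X Y A B : S) (h : hom X Y) (f : hom Y A) (g : hom Y B) :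
  h ;; <[f, g]> = <[h ;; f, h ;; g]>.
Proof. by apply: pair_ext; rewrite compA ?(pair_p1, pair_p2). Qed.

Lemma pair_p1A (X A B Y : S) (f : hom X A) (g : hom X B) (h : hom A Y) :
  <[f, g]> ;; (p1 ;; h) = f ;; h.
Proof. by rewrite -compA pair_p1. Qed.

Lemma pair_p2A (X A B Y : S) (f : hom X A) (g : hom X B) (h : hom B Y) :
  <[f, g]> ;; (p2 ;; h) = g ;; h.
Proof. by rewrite -compA pair_p2. Qed.

(* Commutative squares:
<<
        top
     A -----> B
     |        |
 lft |        | rgt
     v        v
     C -----> D
        bot
>> *)
Record square := Square {
  sqA : S; sqB : S; sqC : S; sqD : S;
  top : hom sqA sqB;
  lft : hom sqA sqC;
  rgt : hom sqB sqD;
  bot : hom sqC sqD;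
  sqE : top ;; rgt = lft ;; bot
}.
End Cartesian.
Arguments square S : clear implicits.

Ltac cart_norm :=
  repeat (rewrite ?compA ?pair_p1A ?pair_p2A ?pair_p1 ?pair_p2
            ?comp1m ?compm1 ?comp_pair).
Ltac cart := rewrite /xmap /diag /swap /=; cart_norm;
  repeat (first [reflexivity | apply: pair_ext | apply: bang_uniq];
          cart_norm).

Section Squares.
Context {S : cartcat}.

Lemma sq_a_comm (A B C D : S) (f : hom A B) (g : hom C D) :
  xmap f (idm C) ;; xmap (idm B) g = xmap (idm A) g ;; xmap f (idm D).
Proof. by cart. Qed.

Definition sq_a (A B C D : S) (f : hom A B) (g : hom C D) : square S :=
  Square (sq_a_comm f g).

Definition assoc (A B C : S) : hom ((A ** B) ** C) (A ** (B ** C)) :=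
  <[p1 ;; p1, <[p1 ;; p2, p2]>]>.

Definition assocV (A B C : S) : hom (A ** (B ** C)) ((A ** B) ** C) :=
  <[<[p1, p2 ;; p1]>, p2 ;; p2]>.

Lemma assocK (A B C : S) : assoc A B C ;; assocV A B C = idm _.
Proof. by rewrite /assoc /assocV; cart. Qed.

Lemma assocVK (A B C : S) : assocV A B C ;; assoc A B C = idm _.
Proof. by rewrite /assoc /assocV; cart. Qed.

Definition iassoc (A B C : S) := Iso (assocK A B C) (assocVK A B C).

(* The two paths end in different bracketings of [A x A x A], hence [assoc]. *)
Lemma sq_b_comm (A : S) :
  diag A ;; xmap (idm A) (diag A)
  = diag A ;; (xmap (diag A) (idm A) ;; assoc A A A).
Proof. by rewrite /assoc; cart. Qed.

Definition sq_b (A : S) : square S := Square (sq_b_comm A).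

Lemma sq_c_comm (A B : S) (f : hom A B) :
  <[idm A, f]> ;; xmap f (idm B) = f ;; diag B.
Proof. by cart. Qed.

Definition sq_c (A B : S) (f : hom A B) : square S := Square (sq_c_comm f).

Definition sq_transpose (s : square S) : square S :=
  Square (eq_sym (sqE s)).

Lemma sq_prodl_comm (E : S) (s : square S) :
  xmap (idm E) (top s) ;; xmap (idm E) (rgt s)
  = xmap (idm E) (lft s) ;; xmap (idm E) (bot s).
Proof. by cart; rewrite sqE. Qed.

Definition sq_prodl (E : S) (s : square S) : square S :=
  Square (sq_prodl_comm E s).

Lemma sq_prodr_comm (E : S) (s : square S) :
  xmap (top s) (idm E) ;; xmap (rgt s) (idm E)
  = xmap (lft s) (idm E) ;; xmap (bot s) (idm E).
Proof. by cart; rewrite sqE. Qed.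

Definition sq_prodr (E : S) (s : square S) : square S :=
  Square (sq_prodr_comm E s).

(* The squares which the class of homotopy pullback squares has to contain:
   [basic_square] is the three families and their transposes, and [std_square]
   adds the products of those with a fixed object. *)
Inductive basic_square : square S -> Prop :=
| basic_a A B C D (f : hom A B) (g : hom C D) : basic_square (sq_a f g)
| basic_b A : basic_square (sq_b A)
| basic_c A B (f : hom A B) : basic_square (sq_c f)
| basic_transpose s : basic_square s -> basic_square (sq_transpose s).

Inductive std_square : square S -> Prop :=
| std_basic s : basic_square s -> std_square s
| std_prodl E s : basic_square s -> std_square (sq_prodl E s)
| std_prodr E s : basic_square s -> std_square (sq_prodr E s).

Record square_iso (s s' : square S) := SquareIso {
  siA : iso (sqA s) (sqA s');
  siB : iso (sqB s) (sqB s');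
  siC : iso (sqC s) (sqC s');
  siD : iso (sqD s) (sqD s');
  si_top : top s ;; fwd siB = fwd siA ;; top s';
  si_lft : lft s ;; fwd siC = fwd siA ;; lft s';
  si_rgt : rgt s ;; fwd siD = fwd siB ;; rgt s';
  si_bot : bot s ;; fwd siD = fwd siC ;; bot s'
}.

End Squares.

(* The constraints of the pseudofunctor are indexed by commutative triangles
   [f ;; g = h] (and by [u = idm A]) instead of by composable pairs, so that
   the coherence laws need no transport along equalities in [S]. *)
Record indexed_smcat (S : cartcat) := IndexedSMCat {
  fib : S -> smcat;
  rx : forall (A B : S), hom A B -> smfunctor (fib B) (fib A);
  rx_comp : forall (A B C : S) (f : hom A B) (g : hom B C) (h : hom A C),
    f ;; g = h -> forall M : fib C, iso (rx f (rx g M)) (rx h M);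
  rx_id : forall (A : S) (u : hom A A), u = idm A ->
    forall M : fib A, iso (rx u M) M;
  rx_comp_nat : forall (A B C : S) (f : hom A B) (g : hom B C) (h : hom A C)
    (e : f ;; g = h) (M N : fib C) (x : hom M N),
    fmap (rx f) (fmap (rx g) x) ;; fwd (rx_comp e N)
    = fwd (rx_comp e M) ;; fmap (rx h) x;
  rx_id_nat : forall (A : S) (u : hom A A) (e : u = idm A) (M N : fib A)
    (x : hom M N),
    fmap (rx u) x ;; fwd (rx_id e N) = fwd (rx_id e M) ;; x;
  rx_comp_mu : forall (A B C : S) (f : hom A B) (g : hom B C) (h : hom A C)
    (e : f ;; g = h) (M N : fib C),
    fwd (smu (rx f) (rx g M) (rx g N)) ;; fmap (rx f) (fwd (smu (rx g) M N))
      ;; fwd (rx_comp e (tens M N))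
    = tmap (fwd (rx_comp e M)) (fwd (rx_comp e N)) ;; fwd (smu (rx h) M N);
  rx_comp_eps : forall (A B C : S) (f : hom A B) (g : hom B C) (h : hom A C)
    (e : f ;; g = h),
    fwd (seps (rx f)) ;; fmap (rx f) (fwd (seps (rx g)))
      ;; fwd (rx_comp e tone)
    = fwd (seps (rx h));
  rx_id_mu : forall (A : S) (u : hom A A) (e : u = idm A) (M N : fib A),
    fwd (smu (rx u) M N) ;; fwd (rx_id e (tens M N))
    = tmap (fwd (rx_id e M)) (fwd (rx_id e N));
  rx_id_eps : forall (A : S) (u : hom A A) (e : u = idm A),
    fwd (seps (rx u)) ;; fwd (rx_id e tone) = idm tone;
  rx_assoc : forall (A B C D : S) (f : hom A B) (g : hom B C) (k : hom C D)
    (u : hom A C) (v : hom B D) (w : hom A D)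
    (e1 : f ;; g = u) (e2 : g ;; k = v) (e3 : u ;; k = w) (e4 : f ;; v = w)
    (M : fib D),
    fmap (rx f) (fwd (rx_comp e2 M)) ;; fwd (rx_comp e4 M)
    = fwd (rx_comp e1 (rx k M)) ;; fwd (rx_comp e3 M);
  rx_unitl : forall (A B : S) (u : hom A A) (f : hom A B)
    (e : u = idm A) (e' : u ;; f = f) (M : fib B),
    fwd (rx_comp e' M) = fwd (rx_id e (rx f M));
  rx_unitr : forall (A B : S) (f : hom A B) (u : hom B B)
    (e : u = idm B) (e' : f ;; u = f) (M : fib B),
    fwd (rx_comp e' M) = fmap (rx f) (fwd (rx_id e M))
}.
Arguments fib {S} i A : rename.
Arguments rx {S i A B} f : rename.
Arguments rx_comp {S i A B C f g h} e M : rename.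
Arguments rx_id {S i A u} e M : rename.

Section ExternalProduct.
Context {S : cartcat} {C : indexed_smcat S}.

Definition box (A B : S) (M : fib C A) (N : fib C B) : fib C (A ** B) :=
  rx p1 M ⊗ rx p2 N.

Definition bmap (A B : S) (M M' : fib C A) (N N' : fib C B)
  (x : hom M M') (y : hom N N') : hom (box M N) (box M' N') :=
  tmap (fmap (rx p1) x) (fmap (rx p2) y).

Definition box_at (T A B : S) (u : hom T (A ** B)) (a : hom T A) (b : hom T B)
  (ea : u ;; p1 = a) (eb : u ;; p2 = b) (M : fib C A) (N : fib C B) :
  iso (rx u (box M N)) (rx a M ⊗ rx b N) :=
  iso_sym (smu (rx u) _ _) >> iso_tens (rx_comp ea M) (rx_comp eb N).

Definition box_rx (A A' B B' : S) (f : hom A' A) (g : hom B' B)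
  (M : fib C A) (N : fib C B) :
  iso (box (rx f M) (rx g N)) (rx (xmap f g) (box M N)) :=
  iso_tens (rx_comp eq_refl M) (rx_comp eq_refl N)
  >> iso_sym (box_at (pair_p1 _ _) (pair_p2 _ _) M N).

Definition box_sym (A B : S) (M : fib C A) (N : fib C B) :
  iso (box M N) (rx (swap A B) (box N M)) :=
  tsym _ _ >> iso_sym (box_at (pair_p1 _ _) (pair_p2 _ _) N M).

(* [(M ⊠ N) ⊠ P ~ M ⊠ (N ⊠ P)], restricted to [T]
   along maps with the same components. *)
Definition box_assoc_at (T A B D : S)
  (u : hom T ((A ** B) ** D)) (v : hom T (A ** (B ** D)))
  (M : fib C A) (N : fib C B) (P : fib C D)
  (e1 : v ;; p1 = (u ;; p1) ;; p1) (e2 : (v ;; p2) ;; p1 = (u ;; p1) ;; p2)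
  (e3 : (v ;; p2) ;; p2 = u ;; p2) :
  iso (rx u (box (box M N) P)) (rx v (box M (box N P))) :=
  box_at eq_refl eq_refl (box M N) P
  >> iso_tens (box_at eq_refl eq_refl M N) (iso_refl _)
  >> tassoc _ _ _
  >> iso_tens (iso_refl _) (iso_sym (box_at e2 e3 N P))
  >> iso_sym (box_at e1 eq_refl M (box N P)).

End ExternalProduct.

Record pushforwards (S : cartcat) (C : indexed_smcat S) := Pushforwards {
  push : forall (A B : S), hom A B -> functor (fib C A) (fib C B);
  push_adj : forall (A B : S) (f : hom A B), adjunction (push f) (rx f)
}.
Arguments push {S C} p {A B} f : rename.
Arguments push_adj {S C} p {A B} f : rename.

Section Canonical.
Context {S : cartcat} {C : indexed_smcat S} (H : pushforwards C).

Definition punit (A B : S) (f : hom A B) (M : fib C A) :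
  hom M (rx f (push H f M)) := unit (push_adj H f) M.

Definition pcounit (A B : S) (f : hom A B) (M : fib C B) :
  hom (push H f (rx f M)) M := counit (push_adj H f) M.

Definition bc_map (s : square S) (M : fib C (sqC s)) :
  hom (push H (top s) (rx (lft s) M)) (rx (rgt s) (push H (bot s) M)) :=
  fmap (push H (top s)) (fmap (rx (lft s)) (punit (bot s) M))
  ;; fmap (push H (top s))
       (fwd (rx_comp eq_refl (push H (bot s) M))
        ;; bwd (rx_comp (sqE s) (push H (bot s) M)))
  ;; pcounit (top s) (rx (rgt s) (push H (bot s) M)).

Definition proj_map (A B : S) (f : hom A B) (M : fib C B) (N : fib C A) :
  hom (push H f (rx f M ⊗ N)) (M ⊗ push H f N) :=
  fmap (push H f) (tmap (idm (rx f M)) (punit f N))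
  ;; fmap (push H f) (fwd (smu (rx f) M (push H f N)))
  ;; pcounit f (M ⊗ push H f N).

(* Uniqueness of left adjoints: [f_!] is functorial in [f]. *)
Definition transp (A B : S) (f : hom A B) (M : fib C A) (N : fib C B)
  (x : hom M (rx f N)) : hom (push H f M) N :=
  fmap (push H f) x ;; pcounit f N.

Lemma transpK (A B : S) (f : hom A B) (M : fib C A) (N : fib C B)
  (x : hom M (rx f N)) : punit f M ;; fmap (rx f) (transp x) = x.
Proof.
by rewrite /transp /punit /pcounit fmapM -compA -unit_nat compA adj_triR compm1.
Qed.

Lemma transp_inj (A B : S) (f : hom A B) (M : fib C A) (N : fib C B)
  (x y : hom (push H f M) N) :
  punit f M ;; fmap (rx f) x = punit f M ;; fmap (rx f) y -> x = y.
Proof.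
have E (z : hom (push H f M) N) : z = transp (punit f M ;; fmap (rx f) z).
  by rewrite /transp /punit /pcounit fmapM compA counit_nat -compA adj_triL
             comp1m.
by move=> e; rewrite (E x) (E y) e.
Qed.

Section PushComp.
Context (A B D : S) (f : hom A B) (g : hom B D) (h : hom A D).
Context (e : f ;; g = h) (M : fib C A).

Definition push_comp_fwd : hom (push H g (push H f M)) (push H h M) :=
  transp (transp (punit h M ;; bwd (rx_comp e (push H h M)))).

Definition push_comp_bwd : hom (push H h M) (push H g (push H f M)) :=
  transp (punit f M ;; fmap (rx f) (punit g _) ;; fwd (rx_comp e _)).

Lemma push_compVK : push_comp_bwd ;; push_comp_fwd = idm _.
Proof.
apply: transp_inj; rewrite fmapM -compA transpK fmap1 compm1.
rewrite compA -rx_comp_nat -compA (compA (punit f M)) -fmapM transpK transpK.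
by rewrite compA bwdK compm1.
Qed.

Lemma push_compK : push_comp_fwd ;; push_comp_bwd = idm _.
Proof.
apply: transp_inj; rewrite fmapM -compA transpK fmap1 compm1.
apply: transp_inj; rewrite fmapM -compA transpK.
have F x : bwd (rx_comp e _) ;; fmap (rx f) (fmap (rx g) x)
           = fmap (rx h) x ;; bwd (rx_comp e (push H g (push H f M)))
  :> hom (rx h (push H h M)) _.
  rewrite -[RHS]comp1m -(bwdK (rx_comp e (push H h M))) compA.
  by rewrite -(compA (fwd _)) -rx_comp_nat compA fwdK compm1.
by rewrite compA F -compA transpK compA fwdK compm1.
Qed.

Definition push_comp : iso (push H g (push H f M)) (push H h M) :=
  Iso push_compK push_compVK.
End PushComp.

Section PushId.
Context (A : S) (u : hom A A) (e : u = idm A) (M : fib C A).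

Definition push_id_fwd : hom (push H u M) M := transp (bwd (rx_id e M)).

Definition push_id_bwd : hom M (push H u M) :=
  punit u M ;; fwd (rx_id e (push H u M)).

Lemma push_idK : push_id_fwd ;; push_id_bwd = idm _.
Proof.
apply: transp_inj; rewrite fmapM -compA transpK fmap1 compm1.
rewrite -[LHS]compm1 -(fwdK (rx_id e (push H u M))) -compA.
rewrite (compA (bwd _)) rx_id_nat -(compA (bwd _)) bwdK comp1m.
by rewrite /push_id_bwd compA fwdK compm1.
Qed.

Lemma push_idVK : push_id_bwd ;; push_id_fwd = idm _.
Proof.
by rewrite /push_id_bwd compA -rx_id_nat -compA transpK bwdK.
Qed.

Definition push_id : iso (push H u M) M := Iso push_idK push_idVK.
End PushId.
(* Invertibility of Beck-Chevalley morphisms is invariant under isomorphism of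
   squares.  [u : M -> f^* X] is universal if it exhibits [X] as [f_! M]. *)
Section BCInvariance.

Definition universal (A B : S) (f : hom A B) (M : fib C A) (X : fib C B)
  (u : hom M (rx f X)) := inverse (transp u).

Lemma transp_natr (A B : S) (f : hom A B) (M : fib C A) (X Y : fib C B)
  (u : hom M (rx f X)) (x : hom X Y) : transp (u ;; fmap (rx f) x) = transp u ;; x.
Proof. by apply: transp_inj; rewrite fmapM -compA !transpK. Qed.

Lemma universal_intro (A B : S) (f : hom A B) (M : fib C A) (X : fib C B)
  (u : hom M (rx f X)) (d : forall Y, hom M (rx f Y) -> hom X Y)
  (dK : forall Y v, u ;; fmap (rx f) (d Y v) = v)
  (inj : forall Y (x y : hom X Y),
    u ;; fmap (rx f) x = u ;; fmap (rx f) y -> x = y) : universal u.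
Proof.
have K1 : transp u ;; d _ (punit f M) = idm _.
  by apply: transp_inj; rewrite fmapM -compA transpK dK fmap1 compm1.
have K2 : d _ (punit f M) ;; transp u = idm _.
  by apply: inj; rewrite fmapM -compA dK transpK fmap1 compm1.
exact: Inverse K1 K2.
Defined.

Definition desc (A B : S) (f : hom A B) (M : fib C A) (X : fib C B)
  (u : hom M (rx f X)) (U : universal u) (Y : fib C B) (v : hom M (rx f Y)) :
  hom X Y := inv U ;; transp v.

Lemma descK (A B : S) (f : hom A B) (M : fib C A) (X : fib C B)
  (u : hom M (rx f X)) (U : universal u) (Y : fib C B) (v : hom M (rx f Y)) :
  u ;; fmap (rx f) (desc U v) = v.
Proof.
rewrite -{1}(transpK u) compA -fmapM /desc -(compA (transp u)) mulmV comp1m.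
exact: transpK.
Qed.

Lemma universal_inj (A B : S) (f : hom A B) (M : fib C A) (X : fib C B)
  (u : hom M (rx f X)) (U : universal u) (Y : fib C B) (x y : hom X Y) :
  u ;; fmap (rx f) x = u ;; fmap (rx f) y -> x = y.
Proof.
move=> e; have e' : transp u ;; x = transp u ;; y by rewrite -!transp_natr e.
have F (z : hom X Y) : inv U ;; (transp u ;; z) = z.
  by rewrite -compA mulVm comp1m.
by rewrite -(F x) -(F y) e'.
Qed.

(* The base change of [u] along a commutative square. *)
Definition bchange (A B D E : S) (t : hom A B) (l : hom A D) (r : hom B E)
  (b : hom D E) (e : t ;; r = l ;; b) (M : fib C D) (X : fib C E)
  (u : hom M (rx b X)) : hom (rx l M) (rx t (rx r X)) :=
  fmap (rx l) u ;; fwd (rx_comp eq_refl X) ;; bwd (rx_comp e X).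

Lemma bc_mapE (s : square S) (M : fib C (sqC s)) :
  bc_map M = transp (bchange (sqE s) (punit (bot s) M)).
Proof. by rewrite /bc_map /transp /bchange !fmapM !compA. Qed.

Lemma bchange_comp (A B D E : S) (t : hom A B) (l : hom A D) (r : hom B E)
  (b : hom D E) (e : t ;; r = l ;; b) (M : fib C D) (X : fib C E)
  (u : hom M (rx b X)) :
  bchange e u ;; fwd (rx_comp e X) = fmap (rx l) u ;; fwd (rx_comp eq_refl X).
Proof. by rewrite /bchange compA bwdK compm1. Qed.

Lemma bchange_nat (A B D E : S) (t : hom A B) (l : hom A D) (r : hom B E)
  (b : hom D E) (e : t ;; r = l ;; b) (M : fib C D) (X Y : fib C E)
  (u : hom M (rx b X)) (x : hom X Y) :
  bchange e (u ;; fmap (rx b) x) = bchange e u ;; fmap (rx t) (fmap (rx r) x).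
Proof.
rewrite -[LHS]compm1 -[RHS]compm1 -(fwdK (rx_comp e Y)) -!compA.
congr (_ ;; _).
rewrite bchange_comp compA rx_comp_nat -compA bchange_comp fmapM !compA.
by rewrite rx_comp_nat.
Qed.

Section RxEquiv.
Context (A B : S) (i : iso A B).

Definition rx_fwdbwd (Y : fib C A) : iso (rx (fwd i) (rx (bwd i) Y)) Y :=
  rx_comp (fwdK i) Y >> rx_id eq_refl Y.

Definition rx_bwdfwd (X : fib C B) : iso (rx (bwd i) (rx (fwd i) X)) X :=
  rx_comp (bwdK i) X >> rx_id eq_refl X.

Lemma rx_bwdfwd_nat (X Y : fib C B) (x : hom X Y) :
  fmap (rx (bwd i)) (fmap (rx (fwd i)) x) ;; fwd (rx_bwdfwd Y)
  = fwd (rx_bwdfwd X) ;; x.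
Proof. by rewrite /= -compA rx_comp_nat !compA rx_id_nat. Qed.

Lemma rx_faithful (X Y : fib C B) (x y : hom X Y) :
  fmap (rx (fwd i)) x = fmap (rx (fwd i)) y -> x = y.
Proof.
move=> e; have F (z : hom X Y) :
  bwd (rx_bwdfwd X)
    ;; (fmap (rx (bwd i)) (fmap (rx (fwd i)) z) ;; fwd (rx_bwdfwd Y)) = z.
  by rewrite rx_bwdfwd_nat -compA bwdK comp1m.
by rewrite -(F x) -(F y) e.
Qed.

Definition rx_full (X Y : fib C B)
  (z : hom (rx (fwd i) X) (rx (fwd i) Y)) : hom X Y :=
  bwd (rx_bwdfwd X) ;; fmap (rx (bwd i)) z ;; fwd (rx_bwdfwd Y).
End RxEquiv.

Lemma rx_fullK (A B : S) (i : iso A B) (X Y : fib C B)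
  (z : hom (rx (fwd i) X) (rx (fwd i) Y)) : fmap (rx (fwd i)) (rx_full z) = z.
Proof.
apply: (rx_faithful (i := iso_sym i)) => /=.
rewrite -[LHS]compm1 -(fwdK (rx_bwdfwd i Y)) -compA rx_bwdfwd_nat /rx_full.
move: (rx_bwdfwd i X) (rx_bwdfwd i Y) => n m.
by rewrite !compA fwdK compm1 -compA fwdK comp1m.
Qed.

Lemma bwdKA (D : category) (X Y Z : D) (j : iso X Y) (x : hom Y Z) :
  bwd j ;; (fwd j ;; x) = x.
Proof. by rewrite -compA bwdK comp1m. Qed.

Section BChangeIso.
Context (A A' B B' : S) (f : hom A B) (f' : hom A' B')
  (a : iso A A') (b : iso B B') (e : f ;; fwd b = fwd a ;; f').
Context (M : fib C A').

Definition bchange_full (X : fib C B')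
  (v : hom (rx (fwd a) M) (rx f (rx (fwd b) X))) : hom M (rx f' X) :=
  rx_full (i := a) (v ;; fwd (rx_comp e X) ;; bwd (rx_comp eq_refl X)).

Lemma bchange_fullK (X : fib C B')
  (v : hom (rx (fwd a) M) (rx f (rx (fwd b) X))) :
  bchange e (bchange_full v) = v.
Proof.
rewrite /bchange /bchange_full rx_fullK.
by rewrite !compA bwdKA fwdK compm1.
Qed.

Lemma bchange_inj (X : fib C B') (u v : hom M (rx f' X)) :
  bchange e u = bchange e v -> u = v.
Proof.
move=> E; apply: (rx_faithful (i := a)).
rewrite -[LHS]compm1 -[RHS]compm1 -(fwdK (rx_comp eq_refl X)) -!compA.
by rewrite -!(bchange_comp e) E.
Qed.

Context (X : fib C B') (u : hom M (rx f' X)).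

Lemma universal_bchange : universal u -> universal (bchange e u).
Proof.
move=> U.
pose th Y := rx_fwdbwd b Y.
pose w Y (v : hom (rx (fwd a) M) (rx f Y)) :=
  bchange_full (v ;; fmap (rx f) (bwd (th Y))).
apply: (universal_intro
  (d := fun Y v => fmap (rx (fwd b)) (desc U (w Y v)) ;; fwd (th Y))).
- move=> Y v; rewrite fmapM -compA -bchange_nat descK /w bchange_fullK.
  by rewrite compA -fmapM bwdK fmap1 compm1.
- move=> Y x y E.
  have F (z : hom (rx (fwd b) X) Y) :
    fmap (rx (fwd b)) (rx_full (i := b) (z ;; bwd (th Y))) ;; fwd (th Y) = z.
    by rewrite rx_fullK compA bwdK compm1.
  rewrite -(F x) -(F y); congr (fmap _ _ ;; _).
  apply: (universal_inj U); apply: bchange_inj.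
  by rewrite !bchange_nat !rx_fullK !fmapM -!compA E.
Defined.

Lemma universal_bchangeV : universal (bchange e u) -> universal u.
Proof.
move=> U.
apply: (universal_intro
  (d := fun Y v => rx_full (i := b) (desc U (bchange e v)))).
- by move=> Y v; apply: bchange_inj; rewrite bchange_nat rx_fullK descK.
- move=> Y x y E; apply: (rx_faithful (i := b)); apply: (universal_inj U).
  by rewrite -!bchange_nat E.
Defined.
End BChangeIso.

Lemma universal_iso (A B : S) (f : hom A B) (M N : fib C A) (X Y : fib C B)
  (u : hom M (rx f X)) (v : hom N (rx f Y)) (p : iso M N) (q : iso X Y) :
  u ;; fmap (rx f) (fwd q) = fwd p ;; v -> universal u -> universal v.
Proof.
move=> E U.
have v_u : v = bwd p ;; u ;; fmap (rx f) (fwd q).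
  by rewrite compA E -compA bwdK comp1m.
apply: (universal_intro
  (d := fun Z z => bwd q ;; desc U (fwd p ;; z))).
- move=> Z z; rewrite v_u compA -fmapM -compA fwdK comp1m compA descK.
  by rewrite -compA bwdK comp1m.
- move=> Z x y; rewrite v_u => F.
  rewrite -[x]comp1m -[y]comp1m -(bwdK q) !compA; congr (_ ;; _).
  apply: (universal_inj U); rewrite !fmapM.
  rewrite -[LHS]comp1m -[RHS]comp1m -(fwdK p) !compA; congr (_ ;; _).
  by move: F; rewrite !compA.
Defined.

Lemma universal_bc (s : square S)
  (h : forall M : fib C (sqC s), inverse (bc_map M))
  (M : fib C (sqC s)) (X : fib C (sqD s)) (u : hom M (rx (bot s) X)) :
  universal u -> universal (bchange (sqE s) u).
Proof.
move=> U; have U1 : universal (bchange (sqE s) (punit (bot s) M)).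
  by rewrite /universal -bc_mapE; exact: h.
apply: (universal_iso (p := iso_refl _)
          (q := iso_fmap (rx (rgt s)) (iso_of_inverse U)) _ U1).
by rewrite /= comp1m -bchange_nat transpK.
Defined.

Lemma bchange_paste (s s' : square S) (i : square_iso s s')
  (M : fib C (sqC s')) (X : fib C (sqD s')) (u : hom M (rx (bot s') X)) :
  bchange (sqE s) (bchange (si_bot i) u)
    ;; fmap (rx (top s)) (fwd (rx_comp (si_rgt i) X) ;; bwd (rx_comp eq_refl X))
  = fwd (rx_comp (si_lft i) M) ;; bwd (rx_comp eq_refl M)
    ;; bchange (si_top i) (bchange (sqE s') u).
Proof.
set w := (fwd (siA i) ;; lft s') ;; bot s'.
have w1 : (fwd (siA i) ;; top s') ;; rgt s' = w by rewrite /w !compA sqE.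
have w2 : top s ;; (fwd (siB i) ;; rgt s') = w by rewrite -compA si_top w1.
have w3 : (lft s ;; bot s) ;; fwd (siD i) = w.
  by rewrite compA si_bot -compA si_lft.
have w4 : lft s ;; (fwd (siC i) ;; bot s') = w by rewrite -compA si_lft.
have w5 : fwd (siA i) ;; (lft s' ;; bot s') = w by rewrite -compA.
set c := fwd (rx_comp (si_top i) (rx (rgt s') X)) ;; fwd (rx_comp w1 X).
have mono (x y : hom (rx (lft s) (rx (fwd (siC i)) M)) _) :
  x ;; c = y ;; c -> x = y.
  move=> E; rewrite -[x]compm1 -[y]compm1.
  rewrite -(fwdK (rx_comp (si_top i) (rx (rgt s') X) >> rx_comp w1 X)) /=.
  by rewrite -(compA x) -(compA y) -/c E.
apply: mono; rewrite /c.
have H1 := rx_assoc (si_top i) eq_refl w1 w2 X.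
have H2 := rx_assoc (sqE s) (si_rgt i) w3 w2 X.
have H3 := rx_assoc eq_refl (si_bot i) w3 w4 X.
have H4 := rx_assoc (si_lft i) eq_refl (eq_refl w) w4 X.
have H5 := rx_assoc eq_refl (sqE s') w1 w5 X.
have H6 := rx_assoc eq_refl eq_refl (eq_refl w) w5 X.
have B1 := bchange_comp (sqE s) (bchange (si_bot i) u).
have B2 := bchange_comp (si_bot i) u.
have B3 := bchange_comp (si_top i) (bchange (sqE s') u).
have B4 := bchange_comp (sqE s') u.
move: (bchange (sqE s) _) (bchange (si_top i) _) B1 B3 => b1 b3.
move: (bchange (si_bot i) _) (bchange (sqE s') _) B2 B4 => b2 b4 B2 B4 B1 B3.
transitivity (fmap (rx (lft s)) (fmap (rx (fwd (siC i))) u)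
              ;; (fwd (rx_comp (si_lft i) _) ;; fwd (rx_comp (eq_refl w) X))).
  rewrite -H1 fmapM !compA -(compA (fmap _ (bwd _))) -fmapM bwdK fmap1 comp1m.
  rewrite H2 -(compA b1) B1 compA -H3 -compA -fmapM.
  by rewrite B2 fmapM compA H4.
rewrite -compA rx_comp_nat !compA -(compA b3) B3 compA -H5 -(compA (fmap _ b4)) -fmapM B4 fmapM compA H6.
by rewrite -(compA (fmap _ (fmap _ _))) rx_comp_nat compA bwdKA.
Qed.

Lemma bc_square_iso (s s' : square S) (i : square_iso s s') :
  (forall M : fib C (sqC s), inverse (bc_map M)) ->
  forall M : fib C (sqC s'), inverse (bc_map M).
Proof.
move=> h M; rewrite bc_mapE; apply: (universal_bchangeV (e := si_top i)).
apply: (universal_iso (p := rx_comp (si_lft i) M >> iso_sym (rx_comp eq_refl M))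
  (q := rx_comp (si_rgt i) _ >> iso_sym (rx_comp eq_refl _))
  (bchange_paste i _)).
apply: (universal_bc h); apply: universal_bchange.
have K x : x = idm _ -> inverse (x : hom (push H (bot s') M) _).
  by move=> ->; exact: Inverse (comp1m _) (comp1m _).
apply: K; rewrite /transp; exact: adj_triL.
Defined.
End BCInvariance.
End Canonical.

(* [hpb] is the class of homotopy pullback squares. *)
Record ihcoprod (S : cartcat) (C : indexed_smcat S) := IHCoprod {
  ih_push :> pushforwards C;
  hpb : square S -> Prop;
  hpb_std : forall s, std_square s -> hpb s;
  ih_bc : forall s, hpb s -> forall M, inverse (bc_map ih_push (s := s) M);
  ih_proj : forall (A B : S) (f : hom A B) (M : fib C B) (N : fib C A),
    inverse (proj_map ih_push f M N)
}.

Section Dedicated.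
Context {S : cartcat}.

(* [S] is not strict, so the squares arising below agree with those of
   [std_square] only up to canonical isomorphisms of products. *)
Record std_shape (s' : square S) := StdShape {
  ss_sq : square S;
  ss_std : std_square ss_sq;
  ss_iso : square_iso ss_sq s'
}.

Definition mk_shape (s s' : square S) (iA : iso (sqA s) (sqA s'))
  (iB : iso (sqB s) (sqB s')) (iC : iso (sqC s) (sqC s'))
  (iD : iso (sqD s) (sqD s')) (e : std_square s)
  (et : top s ;; fwd iB = fwd iA ;; top s')
  (el : lft s ;; fwd iC = fwd iA ;; lft s')
  (er : rgt s ;; fwd iD = fwd iB ;; rgt s')
  (eb : bot s ;; fwd iD = fwd iC ;; bot s') : std_shape s' :=
  StdShape e (SquareIso et el er eb).

(* The maps [id * diag * id] and [id * bang * id] defining composition. *)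
Definition dlt (A B D : S) : hom ((A ** B) ** D) ((A ** B) ** (B ** D)) :=
  <[p1, <[p1 ;; p2, p2]>]>.

Definition prj (A B D : S) : hom ((A ** B) ** D) (A ** D) :=
  <[p1 ;; p1, p2]>.

(* Up to [A ** star ~ A] these are [sq_a] with one map equal to [bang]. *)
Lemma sq_p1_comm (A B D : S) (f : hom A B) :
  xmap f (idm D) ;; p1 = p1 ;; f.
Proof. by cart. Qed.
Definition sq_p1 (A B D : S) (f : hom A B) : square S := Square (sq_p1_comm D f).

Lemma sq_p2_comm (A B D : S) (f : hom A B) :
  xmap (idm D) f ;; p2 = p2 ;; f.
Proof. by cart. Qed.
Definition sq_p2 (A B D : S) (f : hom A B) : square S := Square (sq_p2_comm D f).

Lemma runitK (A : S) : <[idm A, bang A]> ;; p1 = idm A.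
Proof. by cart. Qed.
Lemma runitVK (A : S) : p1 ;; <[idm A, bang A]> = idm (A ** star).
Proof. by cart. Qed.
Definition irunit (A : S) : iso (A ** star) A := Iso (runitVK A) (runitK A).

Lemma lunitK (A : S) : <[bang A, idm A]> ;; p2 = idm A.
Proof. by cart. Qed.
Lemma lunitVK (A : S) : p2 ;; <[bang A, idm A]> = idm (star ** A).
Proof. by cart. Qed.
Definition ilunit (A : S) : iso (star ** A) A := Iso (lunitVK A) (lunitK A).

Lemma swapK (A B : S) : swap A B ;; swap B A = idm _.
Proof. by cart. Qed.
Definition iswap (A B : S) : iso (A ** B) (B ** A) := Iso (swapK A B) (swapK B A).

Lemma iprod1 (A A' B B' : S) (i : iso A A') (j : iso B B') :
  xmap (fwd i) (fwd j) ;; xmap (bwd i) (bwd j) = idm _.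
Proof. by cart; rewrite fwdK compm1. Qed.
Definition iprod (A A' B B' : S) (i : iso A A') (j : iso B B') :
  iso (A ** B) (A' ** B') :=
  Iso (iprod1 i j) (iprod1 (iso_sym i) (iso_sym j)).

Lemma std_p1 (A B D : S) (f : hom A B) : std_shape (sq_p1 D f).
Proof.
refine (@mk_shape (sq_a f (bang D))
  (sq_p1 D f) (iso_refl _) (iso_refl _)
  (irunit _)
  (irunit _)
  (std_basic (basic_a _ _)) _ _ _ _);
  by cart.
Qed.

Lemma std_p2 (A B D : S) (f : hom A B) : std_shape (sq_p2 D f).
Proof.
refine (@mk_shape (sq_transpose (sq_a (bang D) f))
  (sq_p2 D f) (iso_refl _) (iso_refl _)
  (ilunit _)
  (ilunit _)
  (std_basic (basic_transpose (basic_a _ _))) _ _ _ _);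
  by cart.
Qed.

(* ((A x B) x D) x E -> (A x D) x E over
   ((A x B) x D) x (D x E) -> (A x D) x (D x E). *)
Lemma sq_assocl_comm (A B D E : S) :
  xmap (prj A B D) (idm E) ;; dlt A D E
  = <[p1, <[p1 ;; p2, p2]>]> ;; xmap (prj A B D) (idm (D ** E)).
Proof. by rewrite /dlt /prj; cart. Qed.
Definition sq_assocl (A B D E : S) : square S := Square (sq_assocl_comm A B D E).

Lemma std_assocl (A B D E : S) : std_shape (sq_assocl A B D E).
Proof.
refine (@mk_shape (sq_a (p1 : hom (A ** B) A) (<[p1, idm _]> : hom (D ** E) (D ** (D ** E))))
  (sq_assocl A B D E) (iso_sym (iassoc _ _ _)) (iso_sym (iassoc _ _ _))
  (iso_sym (iassoc _ _ _))
  (iso_sym (iassoc _ _ _))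
  (std_basic (basic_a _ _)) _ _ _ _);
  rewrite /= /prj /dlt /assocV; by cart.
Qed.

Lemma sq_assocr_comm (A B D E : S) :
  <[p1 ;; p1, p2]> ;; dlt A B E
  = (<[p1 ;; p1, <[<[(p1 ;; p1) ;; p2, p1 ;; p2]>, p2]>]>
     : hom (((A ** B) ** D) ** E) ((A ** B) ** ((B ** D) ** E)))
    ;; xmap (idm (A ** B)) (prj B D E).
Proof. by rewrite /dlt /prj; cart. Qed.
Definition sq_assocr (A B D E : S) : square S := Square (sq_assocr_comm A B D E).

Lemma std_assocr (A B D E : S) : std_shape (sq_assocr A B D E).
Proof.
refine (@mk_shape (sq_transpose (sq_a (<[idm _, p2]> : hom (A ** B) ((A ** B) ** B)) (p2 : hom (D ** E) E)))
  (sq_assocr A B D E) (iso_sym (iassoc _ _ _)) (iso_refl _)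
  (iassoc _ _ _ >> iprod (iso_refl _) (iso_sym (iassoc _ _ _)))
  (iassoc _ _ _)
  (std_basic (basic_transpose (basic_a _ _))) _ _ _ _);
  rewrite /= /prj /dlt /assocV /assoc; by cart.
Qed.

Definition diagr (A B : S) : hom (A ** B) ((A ** B) ** B) := <[idm _, p2]>.
Definition diagl (A B : S) : hom (A ** B) ((A ** A) ** B) :=
  <[<[p1, p1]>, p2]>.

Lemma sq_unitr_comm (A B : S) :
  diagr A B ;; dlt A B B
  = diagr A B ;; xmap (idm (A ** B)) (diag B).
Proof. by rewrite /dlt /diagr; cart. Qed.
Definition sq_unitr (A B : S) : square S := Square (sq_unitr_comm A B).

Lemma std_unitr (A B : S) : std_shape (sq_unitr A B).
Proof.
refine (@mk_shape (sq_prodl A (sq_transpose (sq_b B)))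
  (sq_unitr A B) (iso_refl _) (iso_sym (iassoc _ _ _))
  (iso_sym (iassoc _ _ _))
  (iso_sym (iassoc _ _ _))
  (std_prodl A (basic_transpose (basic_b B))) _ _ _ _);
  rewrite /= /dlt /diagr /assocV /assoc; by cart.
Qed.

Lemma sq_unitl_comm (A B : S) :
  diagl A B ;; dlt A A B
  = <[p1, idm _]> ;; xmap (diag A) (idm (A ** B)).
Proof. by rewrite /dlt /diagl; cart. Qed.
Definition sq_unitl (A B : S) : square S := Square (sq_unitl_comm A B).

Lemma std_unitl (A B : S) : std_shape (sq_unitl A B).
Proof.
refine (@mk_shape (sq_prodr B (sq_b A))
  (sq_unitl A B) (iso_refl _) (iso_refl _)
  (iassoc _ _ _)
  (iprod (iso_sym (iassoc A A A)) (iso_refl B) >> iassoc _ _ _)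
  (std_prodr B (basic_b A)) _ _ _ _);
  rewrite /= /dlt /diagl /assocV /assoc; by cart.
Qed.

Lemma sq_shad1_comm (A B : S) :
  p1 ;; diag A = <[idm _, p1]> ;; prj A B A.
Proof. by rewrite /prj; cart. Qed.
Definition sq_shad1 (A B : S) : square S := Square (sq_shad1_comm A B).

Lemma std_shad1 (A B : S) : std_shape (sq_shad1 A B).
Proof.
refine (@mk_shape (sq_transpose (sq_a (diag A) (bang B)))
  (sq_shad1 A B) (iso_refl _) (irunit _)
  (iassoc _ _ _ >> iprod (iso_refl _) (iswap _ _) >> iso_sym (iassoc _ _ _))
  (irunit _)
  (std_basic (basic_transpose (basic_a _ _))) _ _ _ _);
  rewrite /= /prj /assocV /assoc; by cart.
Qed.

Lemma sq_shad2_comm (A B : S) :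
  p2 ;; diag B = <[<[p2, p1]>, p2]> ;; prj B A B.
Proof. by rewrite /prj; cart. Qed.
Definition sq_shad2 (A B : S) : square S := Square (sq_shad2_comm A B).

Lemma std_shad2 (A B : S) : std_shape (sq_shad2 A B).
Proof.
refine (@mk_shape (sq_transpose (sq_a (diag B) (bang A)))
  (sq_shad2 A B) (iswap _ _) (irunit _)
  (iassoc _ _ _ >> iprod (iso_refl _) (iswap _ _) >> iso_sym (iassoc _ _ _))
  (irunit _)
  (std_basic (basic_transpose (basic_a _ _))) _ _ _ _);
  rewrite /= /prj /assocV /assoc; by cart.
Qed.

(* Composing with a 1-cell into [star] does not need the last factor. *)
Definition rstar (A : S) : hom A (A ** star) := <[idm A, bang A]>.

Lemma sq_rstar_comm (A B : S) :
  p1 ;; rstar A = rstar (A ** B) ;; prj A B star.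
Proof. by rewrite /prj /rstar; cart. Qed.
Definition sq_rstar (A B : S) : square S := Square (sq_rstar_comm A B).

Lemma std_rstar (A B : S) : std_shape (sq_rstar A B).
Proof.
refine (@mk_shape (sq_a (p1 : hom (A ** B) A) (idm star))
  (sq_rstar A B) (irunit _) (irunit _)
  (iso_refl _)
  (iso_refl _)
  (std_basic (basic_a _ _)) _ _ _ _);
  rewrite /= /prj /rstar; by cart.
Qed.

Lemma sq_hat_comm (A : S) :
  idm A ;; rstar A = <[rstar A, bang A]> ;; prj A star star.
Proof. by rewrite /prj /rstar; cart. Qed.
Definition sq_hat (A : S) : square S := Square (sq_hat_comm A).

Lemma std_hat (A : S) : std_shape (sq_hat A).
Proof.
refine (@mk_shape (sq_a (idm A) (idm star))
  (sq_hat A) (irunit _) (irunit _)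
  (iso_sym (irunit _))
  (iso_refl _)
  (std_basic (basic_a _ _)) _ _ _ _);
  rewrite /= /prj /rstar; by cart.
Qed.

(* [id * diag] in the bracketing [(A ** A) ** A]. *)
Definition iddiag (A : S) : hom (A ** A) ((A ** A) ** A) := <[idm _, p2]>.

Lemma sq_iddiag_comm (A : S) :
  diag A ;; iddiag A = diag A ;; xmap (diag A) (idm A).
Proof. by rewrite /iddiag; cart. Qed.
Definition sq_iddiag (A : S) : square S := Square (sq_iddiag_comm A).

Lemma std_iddiag (A : S) : std_shape (sq_iddiag A).
Proof.
refine (@mk_shape (sq_b A)
  (sq_iddiag A) (iso_refl _) (iso_refl _)
  (iso_refl _)
  (iso_sym (iassoc _ _ _))
  (std_basic (basic_b A)) _ _ _ _);
  rewrite /= /iddiag /assocV /assoc; by cart.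
Qed.

End Dedicated.

Section Bicategory.
Context {S : cartcat} {C : indexed_smcat S} (H : ihcoprod C).

Definition bc (s : square S) (e : std_shape s) (M : fib C (sqC s)) :
  iso (push H (top s) (rx (lft s) M)) (rx (rgt s) (push H (bot s) M)) :=
  iso_of_inverse (bc_square_iso (ss_iso e) (ih_bc (hpb_std H (ss_std e))) M).

Definition proj (A B : S) (f : hom A B) (M : fib C B) (N : fib C A) :
  iso (push H f (rx f M ⊗ N)) (M ⊗ push H f N) :=
  iso_of_inverse (ih_proj H f M N).

Definition box_pushr (A B B' : S) (g : hom B B') (M : fib C A) (N : fib C B) :
  iso (push H (xmap (idm A) g) (box M N)) (box M (push H g N)) :=
  iso_fmap (push H _)
    (iso_tens (iso_sym (rx_comp (eq_trans (pair_p1 _ _) (compm1 p1)) M))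
              (iso_refl (rx p2 N)))
  >> proj (xmap (idm A) g) (rx p1 M) (rx p2 N)
  >> iso_tens (iso_refl (rx p1 M)) (bc (std_p2 A g) N).

Definition box_pushl (A A' B : S) (f : hom A A') (M : fib C A) (N : fib C B) :
  iso (push H (xmap f (idm B)) (box M N)) (box (push H f M) N) :=
  iso_fmap (push H _)
    (tsym _ _
     >> iso_tens (iso_sym (rx_comp (eq_trans (pair_p2 _ _) (compm1 p2)) N))
                 (iso_refl (rx p1 M)))
  >> proj (xmap f (idm B)) (rx p2 N) (rx p1 M)
  >> iso_tens (iso_refl (rx p2 N)) (bc (std_p1 B f) M)
  >> tsym _ _.

Definition odot (A B D : S) (M : fib C (A ** B)) (N : fib C (B ** D)) :
  fib C (A ** D) :=
  push H (prj A B D) (rx (dlt A B D) (box M N)).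

Definition odot_map (A B D : S) (M M' : fib C (A ** B)) (N N' : fib C (B ** D))
  (x : hom M M') (y : hom N N') : hom (odot M N) (odot M' N') :=
  fmap (push H (prj A B D)) (fmap (rx (dlt A B D)) (bmap x y)).

Definition ounit (A : S) : fib C (A ** A) :=
  push H (diag A) (rx (bang A) tone).

Section Associator.
Context (A B D E : S).

Definition prj3 : hom (((A ** B) ** D) ** E) (A ** E) :=
  <[p1 ;; (p1 ;; p1), p2]>.

Definition dlt3 :
  hom (((A ** B) ** D) ** E) (((A ** B) ** (B ** D)) ** (D ** E)) :=
  <[<[p1 ;; p1, <[p1 ;; (p1 ;; p2), p1 ;; p2]>]>, <[p1 ;; p2, p2]>]>.

Definition dlt3' :
  hom (((A ** B) ** D) ** E) ((A ** B) ** ((B ** D) ** (D ** E))) :=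
  <[p1 ;; p1, <[<[p1 ;; (p1 ;; p2), p1 ;; p2]>, <[p1 ;; p2, p2]>]>]>.

Context (M : fib C (A ** B)) (N : fib C (B ** D)) (P : fib C (D ** E)).

Definition odot3 : fib C (A ** E) :=
  push H prj3 (rx dlt3 (box (box M N) P)).

Lemma prj3l : top (sq_assocl A B D E) ;; prj A D E = prj3.
Proof. by rewrite /prj /prj3; cart. Qed.
Lemma dlt3l :
  lft (sq_assocl A B D E) ;; xmap (dlt A B D) (idm (D ** E)) = dlt3.
Proof. by rewrite /dlt /dlt3; cart. Qed.
Lemma prj3r : top (sq_assocr A B D E) ;; prj A B E = prj3.
Proof. by rewrite /prj /prj3; cart. Qed.
Lemma dlt3r :
  lft (sq_assocr A B D E) ;; xmap (idm (A ** B)) (dlt B D E) = dlt3'.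
Proof. by rewrite /dlt /dlt3'; cart. Qed.
Lemma dlt3_1 : dlt3' ;; p1 = (dlt3 ;; p1) ;; p1.
Proof. by rewrite /dlt3 /dlt3'; cart. Qed.
Lemma dlt3_2 : (dlt3' ;; p2) ;; p1 = (dlt3 ;; p1) ;; p2.
Proof. by rewrite /dlt3 /dlt3'; cart. Qed.
Lemma dlt3_3 : (dlt3' ;; p2) ;; p2 = dlt3 ;; p2.
Proof. by rewrite /dlt3 /dlt3'; cart. Qed.

Definition odot3l : iso (odot (odot M N) P) odot3 :=
  iso_fmap (push H _)
    (iso_fmap (rx (dlt A D E))
       (iso_sym (box_pushl (prj A B D) (rx (dlt A B D) (box M N)) P))
     >> iso_sym (bc (std_assocl A B D E) _))
  >> push_comp H prj3l _
  >> iso_fmap (push H prj3)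
       (iso_fmap (rx (lft (sq_assocl A B D E)))
          (iso_tens (iso_refl _) (iso_fmap (rx p2) (iso_sym (rx_id eq_refl P)))
           >> box_rx (dlt A B D) (idm (D ** E)) (box M N) P)
        >> rx_comp dlt3l _).

Definition odot3r : iso (odot M (odot N P)) odot3 :=
  iso_fmap (push H _)
    (iso_fmap (rx (dlt A B E))
       (iso_sym (box_pushr (prj B D E) M (rx (dlt B D E) (box N P))))
     >> iso_sym (bc (std_assocr A B D E) _))
  >> push_comp H prj3r _
  >> iso_fmap (push H prj3)
       (iso_fmap (rx (lft (sq_assocr A B D E)))
          (iso_tens (iso_fmap (rx p1) (iso_sym (rx_id eq_refl M))) (iso_refl _)
           >> box_rx (idm (A ** B)) (dlt B D E) M (box N P))
        >> rx_comp dlt3r _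
        >> iso_sym (box_assoc_at M N P dlt3_1 dlt3_2 dlt3_3)).

Definition oassoc : iso (odot (odot M N) P) (odot M (odot N P)) :=
  odot3l >> iso_sym odot3r.

End Associator.

Section Unitors.
Context (A B : S) (M : fib C (A ** B)).

Lemma unitr1 : diagr A B ;; prj A B B = idm _.
Proof. by rewrite /prj /diagr; cart. Qed.
Lemma unitr2 : diagr A B ;; p1 = idm _.
Proof. by rewrite /diagr; cart. Qed.
Lemma unitl1 : diagl A B ;; prj A A B = idm _.
Proof. by rewrite /prj /diagl; cart. Qed.
Lemma unitl2 : <[p1 : hom (A ** B) A, idm _]> ;; p2 = idm _.
Proof. by cart. Qed.

(* [a^* (bang_X^* U) ~ U] in the fibre over [T]. *)
Definition rx_unit (T X : S) (a : hom T X) :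
  iso (rx a (rx (bang X) (tone : fib C star))) (tone : fib C T) :=
  iso_fmap (rx a) (iso_sym (seps (rx (bang X)))) >> iso_sym (seps (rx a)).

Definition orunit : iso (odot M (ounit B)) M :=
  iso_fmap (push H _)
    (iso_fmap (rx (dlt A B B))
       (iso_sym (box_pushr (diag B) M (rx (bang B) tone)))
     >> iso_sym (bc (std_unitr A B) (box M (rx (bang B) tone))))
  >> push_comp H unitr1 _
  >> push_id H eq_refl _
  >> box_at unitr2 eq_refl M (rx (bang B) tone)
  >> iso_tens (rx_id eq_refl M) (rx_unit _)
  >> trunit M.

Definition olunit : iso (odot (ounit A) M) M :=
  iso_fmap (push H _)
    (iso_fmap (rx (dlt A A B))
       (iso_sym (box_pushl (diag A) (rx (bang A) tone) M))
     >> iso_sym (bc (std_unitl A B) (box (rx (bang A) tone) M)))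
  >> push_comp H unitl1 _
  >> push_id H eq_refl _
  >> box_at eq_refl unitl2 (rx (bang A) tone) M
  >> iso_tens (rx_unit _) (rx_id eq_refl M)
  >> tlunit M.

End Unitors.

Definition shad (A : S) (M : fib C (A ** A)) : fib C star :=
  push H (bang A) (rx (diag A) M).

Definition shad_map (A : S) (M N : fib C (A ** A)) (x : hom M N) :
  hom (shad M) (shad N) :=
  fmap (push H (bang A)) (fmap (rx (diag A)) x).

Section Theta.
Context (A B : S) (M : fib C (A ** B)) (N : fib C (B ** A)).

(* (a, b) |-> ((a, b), (b, a)) and (a, b) |-> ((b, a), (a, b)) *)
Definition del : hom (A ** B) ((A ** B) ** (B ** A)) :=
  <[idm _, swap A B]>.
Definition del' : hom (A ** B) ((B ** A) ** (A ** B)) :=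
  <[swap A B, idm _]>.

Lemma del1 : lft (sq_shad1 A B) ;; dlt A B A = del.
Proof. by rewrite /dlt /del; cart. Qed.
Lemma del2 : lft (sq_shad2 A B) ;; dlt B A B = del'.
Proof. by rewrite /dlt /del'; cart. Qed.
Lemma del_swap : del ;; swap _ _ = del'.
Proof. by rewrite /del /del'; cart. Qed.

Definition shad_odot :
  iso (shad (odot M N)) (push H (bang (A ** B)) (rx del (box M N))) :=
  iso_fmap (push H (bang A)) (iso_sym (bc (std_shad1 A B) _))
  >> push_comp H (bang_uniq _ (bang _)) _
  >> iso_fmap (push H _) (rx_comp del1 _).

Definition shad_odot' :
  iso (shad (odot N M)) (push H (bang (A ** B)) (rx del' (box N M))) :=
  iso_fmap (push H (bang B)) (iso_sym (bc (std_shad2 A B) _))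
  >> push_comp H (bang_uniq _ (bang _)) _
  >> iso_fmap (push H _) (rx_comp del2 _).

Definition theta : iso (shad (odot M N)) (shad (odot N M)) :=
  shad_odot
  >> iso_fmap (push H _)
       (iso_fmap (rx del) (box_sym M N) >> rx_comp del_swap _)
  >> iso_sym shad_odot'.

End Theta.

Record rdual (A B : S) (M : fib C (A ** B)) := RDual {
  rd_ob : fib C (B ** A);
  rd_eta : hom (ounit A) (odot M rd_ob);
  rd_eps : hom (odot rd_ob M) (ounit B);
  rd_tri : bwd (olunit M) ;; odot_map rd_eta (idm M)
    ;; fwd (oassoc M rd_ob M) ;; odot_map (idm M) rd_eps ;; fwd (orunit M)
    = idm M;
  rd_triV : bwd (orunit rd_ob) ;; odot_map (idm rd_ob) rd_eta
    ;; bwd (oassoc rd_ob M rd_ob) ;; odot_map rd_eps (idm rd_ob)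
    ;; fwd (olunit rd_ob)
    = idm rd_ob
}.

Definition btrace (A B : S) (M : fib C (A ** B)) (D : rdual M)
  (Q : fib C (A ** A)) (P : fib C (B ** B))
  (f : hom (odot Q M) (odot M P)) : hom (shad Q) (shad P) :=
  shad_map (bwd (orunit Q)) ;; shad_map (odot_map (idm Q) (rd_eta D))
  ;; shad_map (bwd (oassoc Q M (rd_ob D)))
  ;; shad_map (odot_map f (idm (rd_ob D)))
  ;; fwd (theta (odot M P) (rd_ob D))
  ;; shad_map (bwd (oassoc (rd_ob D) M P))
  ;; shad_map (odot_map (rd_eps D) (idm P))
  ;; shad_map (fwd (olunit P)).

(* [M] over [A] as a 1-cell [A -> star]; for [A = star], [P] over [star] as a
   1-cell [star -> star]. *)
Definition hat (A : S) (M : fib C A) : fib C (A ** star) := rx p1 M.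

Lemma bang_star : bang star = idm (star : S).
Proof. exact: bang_uniq. Qed.

Lemma diag_p1 (A : S) : diag A ;; p1 = idm A.
Proof. by cart. Qed.
Lemma diag_p2 (A : S) : diag A ;; p2 = idm A.
Proof. by cart. Qed.

Definition shad_star (P : fib C star) : iso (shad (hat P)) P :=
  iso_fmap (push H (bang star)) (rx_comp (diag_p1 star) P >> rx_id eq_refl P)
  >> push_id H bang_star P.

Section Corresponding.
Context (A : S) (M : fib C A).

Lemma rstar_p1 : rstar A ;; p1 = idm A.
Proof. by rewrite /rstar; cart. Qed.

Lemma p1_rstar : p1 ;; rstar A = idm (A ** star).
Proof. by rewrite /rstar; cart. Qed.

(* [rx (rstar A)] regards a 1-cell [A -> star] as an object over [A]; it is
   inverse to [hat] up to isomorphism. *)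
Definition hat_rstar (X : fib C (A ** star)) : iso (hat (rx (rstar A) X)) X :=
  rx_comp p1_rstar X >> rx_id eq_refl X.

Definition unhat (X Y : fib C (A ** star)) (x : hom X Y) :
  hom (rx (rstar A) X) (rx (rstar A) Y) := fmap (rx (rstar A)) x.

Definition rehat (X Y : fib C (A ** star))
  (x : hom (rx (rstar A) X) (rx (rstar A) Y)) : hom X Y :=
  bwd (hat_rstar X) ;; fmap (rx p1) x ;; fwd (hat_rstar Y).

Lemma rstar_dlt1 : (rstar (A ** A) ;; dlt A A star) ;; p1 = iddiag A ;; p1.
Proof. by rewrite /rstar /dlt /iddiag; cart. Qed.
Lemma rstar_dlt2 :
  ((rstar (A ** A) ;; dlt A A star) ;; p2) ;; p1 = iddiag A ;; p2.
Proof. by rewrite /rstar /dlt /iddiag; cart. Qed.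

(* [Q (.) hat M ~ (id * bang)_! (id * diag)^* (Q ⊠ M)] *)
Definition odot_hat (Q : fib C (A ** A)) :
  iso (rx (rstar A) (odot Q (hat M))) (push H p1 (rx (iddiag A) (box Q M))) :=
  iso_sym (bc (std_rstar A A) (rx (dlt A A star) (box Q (hat M))))
  >> iso_fmap (push H p1)
       (rx_comp eq_refl (box Q (hat M))
        >> box_at rstar_dlt1 eq_refl Q (hat M)
        >> iso_tens (iso_refl _) (rx_comp rstar_dlt2 M)
        >> iso_sym (box_at eq_refl eq_refl Q M)).

Lemma hat_odot1 :
  ((lft (sq_hat A) ;; dlt A star star) ;; p1) ;; p1 = idm A.
Proof. by rewrite /= /rstar /dlt; cart. Qed.
Lemma hat_odot2 :
  ((lft (sq_hat A) ;; dlt A star star) ;; p2) ;; p1 = bang A.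
Proof. exact: bang_uniq. Qed.

(* [hat M (.) P ~ M ⊠ P ~ M ⊗ bang_A^* P] *)
Definition hat_odot (P : fib C star) :
  iso (rx (rstar A) (odot (hat M) (hat P))) (M ⊗ rx (bang A) P) :=
  iso_sym (bc (std_hat A) (rx (dlt A star star) (box (hat M) (hat P))))
  >> push_id H eq_refl _
  >> rx_comp eq_refl (box (hat M) (hat P))
  >> box_at eq_refl eq_refl (hat M) (hat P)
  >> iso_tens (rx_comp hat_odot1 M >> rx_id eq_refl M) (rx_comp hat_odot2 P).

Lemma diag_iddiag1 : (diag A ;; iddiag A) ;; p1 = diag A.
Proof. by rewrite /iddiag; cart. Qed.
Lemma diag_iddiag2 : (diag A ;; iddiag A) ;; p2 = idm A.
Proof. by rewrite /iddiag; cart. Qed.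

Definition gbar (Q : fib C (A ** A)) (P : fib C star)
  (g : hom (odot Q (hat M)) (odot (hat M) (hat P))) :
  hom (rx (diag A) Q ⊗ M) (M ⊗ rx (bang A) P) :=
  fwd (iso_tens (iso_refl _) (iso_sym (rx_id eq_refl M))
       >> iso_sym (box_at diag_iddiag1 diag_iddiag2 Q M)
       >> iso_sym (rx_comp eq_refl (box Q M)))
  ;; fmap (rx (diag A)) (punit H p1 (rx (iddiag A) (box Q M)))
  ;; fwd (rx_comp (diag_p1 A) _ >> rx_id eq_refl _)
  ;; bwd (odot_hat Q) ;; unhat g ;; fwd (hat_odot P).

(* [(diag_A)_! Q (.) hat M ~ Q ⊗ M] *)
Definition diag_odot_hat (Q : fib C A) :
  iso (rx (rstar A) (odot (push H (diag A) Q) (hat M))) (Q ⊗ M) :=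
  odot_hat (push H (diag A) Q)
  >> iso_fmap (push H p1)
       (iso_fmap (rx (iddiag A)) (iso_sym (box_pushl (diag A) Q M))
        >> iso_sym (bc (std_iddiag A) (box Q M)))
  >> push_comp H (diag_p1 A) _
  >> push_id H eq_refl _
  >> box_at (diag_p1 A) (diag_p2 A) Q M
  >> iso_tens (rx_id eq_refl Q) (rx_id eq_refl M).

Definition fhat (Q : fib C A) (P : fib C star)
  (f : hom (Q ⊗ M) (M ⊗ rx (bang A) P)) :
  hom (odot (push H (diag A) Q) (hat M)) (odot (hat M) (hat P)) :=
  rehat (fwd (diag_odot_hat Q) ;; f ;; bwd (hat_odot P)).

Definition ftilde (Q P : fib C A) (f : hom (Q ⊗ M) (M ⊗ P)) :
  hom (odot (push H (diag A) Q) (hat M))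
      (odot (hat M) (hat (push H (bang A) P))) :=
  rehat (fwd (diag_odot_hat Q) ;; f
         ;; tmap (idm M) (punit H (bang A) P)
         ;; bwd (hat_odot (push H (bang A) P))).

End Corresponding.

End Bicategory.

(* Main.v *)
From Corelib Require Import ssreflect.
Require Import Defs.

Set Implicit Arguments.
Unset Strict Implicit.
Unset Printing Implicit Defensive.

Local Open Scope cat_scope.

(** The isomorphisms that make up the bicategory are built from pushforwards by
    projection formulas and Beck-Chevalley isomorphisms, but each of them is
    determined by its effect on the units of the adjunctions [f_! -| f^*].
    Restricted along [u : T -> A], such a unit is a morphism
    [unit_at : u^* X -> (u ;; f)^* f_! X] in the fibre over [T].  For maps [x],
    [y], [z] from [T] to [A x B], [B x D], [A x D] with matching components it
    gives the composition of 1-cells at the point [T],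
    [comp_at : x^* M ⊗ y^* N -> z^* (M ⊙ N)], and in the same way
    [ounit_at : I -> d^* U_A] and [shad_at : d^* Q -> bang_T^* <<Q>>] for [d] in
    the diagonal.  In these terms every constraint of the bicategory becomes the
    corresponding constraint of the symmetric monoidal fibre over [T]: the unitors
    ([orunit_at], [olunit_at]), the associator ([oassoc_at]) and the symmetry of
    the shadow ([theta_at]).  The morphisms entering the definition of [gbar] and
    [fhat] have similar descriptions ([hat_odot_at], [gbar_in_at],
    [diag_odot_hat_at]).

    Evaluate everything at [T = A].  A composition over [star] involves no
    nontrivial pushforward, so there [comp_at] is invertible, and morphisms
    [eta : U_A -> hat M ⊙ N] and [eps : N ⊙ hat M -> U_star] amount to morphisms
    [eta' : I -> M ⊗ N'] and [eps' : N' ⊗ M -> I] in the fibre over [A].  The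
    bicategorical triangle composites are the fiberwise ones ([triangle_at],
    [triangleV_at]), so [hat M] is right dualizable and any right dual of it
    yields a fiberwise dual of [M].  Read at [T = A], the trace of [g] is, factor
    by factor, the trace of [gbar g] with respect to [eta'] and [eps']
    ([trace_at]); as the trace in a symmetric monoidal category is independent of
    the dual ([trace_unique]), this is (i).

    For (iii), precomposing [gbar (fhat f)] with the unit of [diag_! -| diag^*]
    gives back [f] ([gbar_fhat]), and traces are natural in their domain.
    Finally (ii) is (iii) for [f] followed by the unit of [bang_! -| bang^*],
    because of a triangle identity of that adjunction. *)

(** * Composites of isomorphisms *)

(** Associativity rewriting by syntactic matching: the general rewrite rule would
    also unfold named isomorphisms that are themselves composites. *)
Ltac right_assoc :=
  repeat match goal with
  | |- context [comp (comp ?f ?g) ?h] => rewrite (compA f g h)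
  end.

Ltac flatten :=
  repeat match goal with
  | |- context [comp (comp ?f ?g) ?h] => rewrite (compA f g h)
  | |- context [fmap ?F (comp ?f ?g)] => rewrite (fmapM F f g)
  end.

Ltac unfold_isos :=
  repeat match goal with
  | |- context [fwd (iso_trans ?i ?j)] =>
      change (fwd (iso_trans i j)) with (fwd i ;; fwd j)
  | |- context [bwd (iso_trans ?i ?j)] =>
      change (bwd (iso_trans i j)) with (bwd j ;; bwd i)
  | |- context [fwd (iso_sym ?i)] => change (fwd (iso_sym i)) with (bwd i)
  | |- context [bwd (iso_sym ?i)] => change (bwd (iso_sym i)) with (fwd i)
  | |- context [fwd (@iso_refl ?c ?X)] =>
      change (fwd (@iso_refl c X)) with (@idm c X)
  | |- context [bwd (@iso_refl ?c ?X)] =>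
      change (bwd (@iso_refl c X)) with (@idm c X)
  | |- context [fwd (iso_fmap ?F ?i)] =>
      change (fwd (iso_fmap F i)) with (fmap F (fwd i))
  | |- context [bwd (iso_fmap ?F ?i)] =>
      change (bwd (iso_fmap F i)) with (fmap F (bwd i))
  | |- context [fwd (iso_tens ?i ?j)] =>
      change (fwd (iso_tens i j)) with (tmap (fwd i) (fwd j))
  | |- context [bwd (iso_tens ?i ?j)] =>
      change (bwd (iso_tens i j)) with (tmap (bwd i) (bwd j))
  end.

Section CategoryBasics.
Context {C : category}.

Lemma reassoc (X Y Z : C) (f : hom X Y) (g : hom Y Z) (h : hom X Z) :
  f ;; g = h -> forall W (k : hom Z W), f ;; (g ;; k) = h ;; k.
Proof. by move=> <- W k; rewrite compA. Qed.

Lemma reassoc3 (X Y Z V : C) (f : hom X Y) (g : hom Y Z) (l : hom Z V)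
  (h : hom X V) :
  f ;; g ;; l = h -> forall W (k : hom V W), f ;; (g ;; (l ;; k)) = h ;; k.
Proof. by move=> <- W k; rewrite !compA. Qed.

(** Rewrites a prefix [l] of a composite; in [rewrite_head] below the remaining
    factors [k] are found by unification after normalizing associativity. *)
Lemma rewrite_headP (X Y Z : C) (l r : hom X Y) (k : hom Y Z) (f g : hom X Z) :
  l = r -> f = l ;; k -> r ;; k = g -> f = g.
Proof. by move=> -> ->. Qed.

Lemma fwdKA (X Y Z : C) (i : iso X Y) (k : hom X Z) : fwd i ;; (bwd i ;; k) = k.
Proof. by rewrite -compA fwdK comp1m. Qed.

Lemma iso_epi (X Y Z : C) (i : iso X Y) (f g : hom Y Z) :
  fwd i ;; f = fwd i ;; g -> f = g.
Proof. by move=> e; rewrite -[f](bwdKA i) e bwdKA. Qed.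

Lemma iso_mono (X Y Z : C) (i : iso Y Z) (f g : hom X Y) :
  f ;; fwd i = g ;; fwd i -> f = g.
Proof.
by move=> e; rewrite -[f]compm1 -[g]compm1 -(fwdK i) -!compA e.
Qed.

Lemma move_bwdl (X Y Z : C) (i : iso X Y) (f : hom X Z) (g : hom Y Z) :
  f = fwd i ;; g -> bwd i ;; f = g.
Proof. by move=> ->; rewrite bwdKA. Qed.

Lemma move_bwdr (X Y Z : C) (i : iso X Y) (f : hom Z Y) (g : hom Z X) :
  f = g ;; fwd i -> f ;; bwd i = g.
Proof. by move=> ->; rewrite compA fwdK compm1. Qed.

Lemma nat_bwd (X X' Y Y' : C) (i : iso X X') (j : iso Y Y')
  (f : hom X Y) (f' : hom X' Y') :
  f ;; fwd j = fwd i ;; f' -> f' ;; bwd j = bwd i ;; f.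
Proof. by move=> e; apply: move_bwdr; rewrite compA e bwdKA. Qed.

End CategoryBasics.

Lemma fmap_bwdKA (C D : category) (F : functor C D) (X Y : C) (Z : D) (i : iso X Y)
  (f : hom (F Y) Z) : fmap F (bwd i) ;; (fmap F (fwd i) ;; f) = f.
Proof. exact: (bwdKA (iso_fmap F i)). Qed.

Lemma fmap_fwdKA (C D : category) (F : functor C D) (X Y : C) (Z : D) (i : iso X Y)
  (f : hom (F X) Z) : fmap F (fwd i) ;; (fmap F (bwd i) ;; f) = f.
Proof. exact: (fwdKA (iso_fmap F i)). Qed.

Ltac rewrite_head E := eapply (rewrite_headP E); [unfold_isos; flatten; reflexivity |].

(** * Traces in symmetric monoidal categories *)

Section Monoidal.
Context {C : smcat}.
Implicit Types X Y Z W : C.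

Lemma tmapMl X X' X'' Y Y' (f : hom X X') (f' : hom X' X'') (g : hom Y Y') :
  tmap (f ;; f') g = tmap f (idm Y) ;; tmap f' g.
Proof. by rewrite -tmapM comp1m. Qed.

Lemma tmapMr X X' Y Y' Y'' (f : hom X X') (g : hom Y Y') (g' : hom Y' Y'') :
  tmap f (g ;; g') = tmap f g ;; tmap (idm X') g'.
Proof. by rewrite -tmapM compm1. Qed.

Lemma tmapMrV X X' Y Y' Y'' (f : hom X X') (g : hom Y Y') (g' : hom Y' Y'') :
  tmap f (g ;; g') = tmap (idm X) g ;; tmap f g'.
Proof. by rewrite -tmapM comp1m. Qed.

Lemma tmap_split X X' Y Y' (f : hom X X') (g : hom Y Y') :
  tmap f g = tmap f (idm Y) ;; tmap (idm X') g.
Proof. by rewrite -tmapM comp1m compm1. Qed.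

Lemma tmap_splitV X X' Y Y' (f : hom X X') (g : hom Y Y') :
  tmap f g = tmap (idm X) g ;; tmap f (idm Y').
Proof. by rewrite -tmapM comp1m compm1. Qed.

Lemma tmap_fwdKA X Y Y' W (i : iso Y Y') (k : hom (X ⊗ Y) W) :
  tmap (idm X) (fwd i) ;; (tmap (idm X) (bwd i) ;; k) = k.
Proof. by rewrite (reassoc (eq_sym (tmapMr _ _ _))) fwdK tmap1 comp1m. Qed.

Lemma tassoc_natV X X' Y Y' Z Z' (f : hom X X') (g : hom Y Y') (h : hom Z Z') :
  tmap f (tmap g h) ;; bwd (tassoc X' Y' Z')
  = bwd (tassoc X Y Z) ;; tmap (tmap f g) h.
Proof. exact/nat_bwd/tassoc_nat. Qed.

Lemma tlunit_natV X X' (f : hom X X') :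
  f ;; bwd (tlunit X') = bwd (tlunit X) ;; tmap (idm tone) f.
Proof. exact/nat_bwd/tlunit_nat. Qed.

Lemma trunit_natV X X' (f : hom X X') :
  f ;; bwd (trunit X') = bwd (trunit X) ;; tmap f (idm tone).
Proof. exact/nat_bwd/trunit_nat. Qed.

Lemma tone_faithful X Y (f g : hom X Y) :
  tmap (idm tone) f = tmap (idm tone) g -> f = g.
Proof.
move=> e; apply: (iso_epi (i := tlunit X)).
by rewrite -!tlunit_nat e.
Qed.

Lemma tone_faithfulr X Y (f g : hom X Y) :
  tmap f (idm tone) = tmap g (idm tone) -> f = g.
Proof.
move=> e; apply: (iso_epi (i := trunit X)).
by rewrite -!trunit_nat e.
Qed.

(** Kelly's argument: after tensoring with the unit object, which is faithful, the
    two sides are compared through the pentagon. *)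
Lemma tlunit_tens X Y :
  fwd (tassoc tone X Y) ;; fwd (tlunit (X ⊗ Y)) = tmap (fwd (tlunit X)) (idm Y).
Proof.
apply: tone_faithful.
apply: (iso_epi (i := iso_tens (tassoc tone tone X) (iso_refl Y)
                      >> tassoc tone (tone ⊗ X) Y)) => /=.
transitivity (fwd (tassoc (tone ⊗ tone) X Y) ;; tmap (fwd (trunit tone)) (idm _)).
  by rewrite tmapMr -compA pentagon compA triangle.
by rewrite compA -tassoc_nat -compA -tmapMl triangle -(tmap1 X Y) -tassoc_nat.
Qed.

Lemma trunit_tens X Y :
  fwd (tassoc X Y tone) ;; tmap (idm X) (fwd (trunit Y)) = fwd (trunit (X ⊗ Y)).
Proof.
apply: tone_faithfulr.
have P := pentagon X Y tone tone.
apply: (iso_mono (i := tassoc X Y tone)).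
transitivity (fwd (tassoc (X ⊗ Y) tone tone) ;; fwd (tassoc X Y (tone ⊗ tone))
              ;; tmap (idm X) (tmap (idm Y) (fwd (tlunit tone)))).
  rewrite tmapMl compA tassoc_nat -triangle.
  by rewrite tmapMr -!compA pentagon.
by rewrite compA -tassoc_nat tmap1 -compA triangle.
Qed.

Lemma tlunit_trunit_one : fwd (tlunit (tone : C)) = fwd (trunit tone).
Proof.
apply: tone_faithfulr.
rewrite -triangle -tlunit_tens; congr (_ ;; _).
apply: (iso_mono (i := tlunit tone)).
by rewrite tlunit_nat.
Qed.
End Monoidal.

Section TraceOfData.
Context {C : smcat}.
Implicit Types M N P Q : C.

(** Triangle composites and traces are formed for arbitrary data, so that the
    correspondence with the data of the bicategory precedes the triangle
    identities and transports them in both directions. *)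
Definition triangle_of M N (eta : hom tone (M ⊗ N)) (eps : hom (N ⊗ M) tone) :
  hom M M :=
  bwd (tlunit M) ;; tmap eta (idm M) ;; fwd (tassoc M N M)
    ;; tmap (idm M) eps ;; fwd (trunit M).

Definition triangleV_of M N (eta : hom tone (M ⊗ N))
  (eps : hom (N ⊗ M) tone) : hom N N :=
  bwd (trunit N) ;; tmap (idm N) eta ;; bwd (tassoc N M N)
    ;; tmap eps (idm N) ;; fwd (tlunit N).

Definition trace_of M N (eta : hom tone (M ⊗ N)) (eps : hom (N ⊗ M) tone)
  (Q P : C) (f : hom (Q ⊗ M) (M ⊗ P)) : hom Q P :=
  bwd (trunit Q) ;; tmap (idm Q) eta ;; bwd (tassoc Q M N)
    ;; tmap f (idm N) ;; fwd (tsym (M ⊗ P) N)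
    ;; bwd (tassoc N M P) ;; tmap eps (idm P) ;; fwd (tlunit P).

(** Dinaturality of the trace: it depends on the duality data only up to a pair of
    morphisms compatible with units and counits. *)
Lemma trace_slide M M' N N' P P' Q
  (eta : hom tone (M ⊗ N)) (eps : hom (N ⊗ M) tone)
  (eta' : hom tone (M' ⊗ N')) (eps' : hom (N' ⊗ M') tone)
  (i : hom M' M) (p : hom N' N) (j : hom P' P)
  (f : hom (Q ⊗ M) (M ⊗ P)) (f' : hom (Q ⊗ M') (M' ⊗ P')) :
  eta = eta' ;; tmap i p -> eps' = tmap p i ;; eps ->
  tmap (idm Q) i ;; f = f' ;; tmap i j ->
  trace_of eta' eps' f' ;; j = trace_of eta eps f.
Proof.
move=> -> -> e; rewrite /trace_of tmapMr ?compA (reassoc (tassoc_natV _ _ _)) compA.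
rewrite (reassoc (eq_sym (tmapM _ _ _ _))) compm1 e ?compA.
rewrite -{2}[p]comp1m tmapM compA (reassoc (tsym_nat (tmap i j) p)).
rewrite compA (reassoc (tassoc_natV p i j)) compA.
by rewrite (reassoc (eq_sym (tmapM _ _ _ _))) compm1 (tmap_split _ j) compA tlunit_nat.
Qed.

Lemma trace_nat_dom M N (eta : hom tone (M ⊗ N)) (eps : hom (N ⊗ M) tone)
  Q Q' P (x : hom Q' Q) (f : hom (Q ⊗ M) (M ⊗ P)) :
  x ;; trace_of eta eps f = trace_of eta eps (tmap x (idm M) ;; f).
Proof.
rewrite /trace_of ?compA (reassoc (trunit_natV _)) ?compA.
rewrite (reassoc (eq_sym (tmapM _ _ _ _))) compm1 comp1m tmap_splitV compA.
rewrite -(tmap1 M N) (reassoc (tassoc_natV _ _ _)) compA.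
by rewrite (reassoc (eq_sym (tmapM _ _ _ _))) comp1m.
Qed.

Lemma trace_nat_cod M N (eta : hom tone (M ⊗ N)) (eps : hom (N ⊗ M) tone)
  Q P P' (f : hom (Q ⊗ M) (M ⊗ P)) (y : hom P P') :
  trace_of eta eps f ;; y = trace_of eta eps (f ;; tmap (idm M) y).
Proof.
by apply: (trace_slide (i := idm M) (p := idm N));
  rewrite ?tmap1 ?comp1m ?compm1.
Qed.

(** The mate of the inverse of [i], that is the canonical map between the two
    duals. *)
Definition comparison M M' N N' (eta : hom tone (M ⊗ N))
  (eps' : hom (N' ⊗ M') tone) (i : iso M' M) : hom N' N :=
  bwd (trunit N') ;; tmap (idm N') eta ;; bwd (tassoc N' M N)
    ;; tmap (tmap (idm N') (bwd i) ;; eps') (idm N) ;; fwd (tlunit N).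

(** Slide the unit [eta] past [eta']: the morphisms [eta'] and [eps'] that remain
    form a triangle composite, which cancels. *)
Lemma comparison_eta M M' N N' (eta : hom tone (M ⊗ N))
  (eta' : hom tone (M' ⊗ N')) (eps' : hom (N' ⊗ M') tone) (i : iso M' M) :
  triangle_of eta' eps' = idm M' ->
  eta = eta' ;; tmap (fwd i) (comparison eta eps' i).
Proof.
move=> T.
(* [A] and [B] bring [eta] next to [eta']; [E] is the triangle composite that
   appears. *)
have A : tmap (idm M') (bwd (trunit N'))
         = bwd (trunit (M' ⊗ N')) ;; fwd (tassoc M' N' tone).
  apply: (iso_mono (i := iso_tens (iso_refl M') (trunit N'))) => /=.
  by rewrite compA trunit_tens bwdK -tmapM bwdK comp1m tmap1.
have B : fwd (tassoc M' N' (M ⊗ N)) ;; tmap (idm M') (bwd (tassoc N' M N))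
  = bwd (tassoc (M' ⊗ N') M N)
    ;; (tmap (fwd (tassoc M' N' M)) (idm N) ;; fwd (tassoc M' (N' ⊗ M) N)).
  apply: (iso_mono (i := iso_tens (iso_refl M') (tassoc N' M N))) => /=.
  by rewrite ?compA -(compA (tmap _ _)) pentagon bwdKA -tmapM bwdK comp1m tmap1
     compm1.
have E : tmap eta' (idm M) ;; fwd (tassoc M' N' M)
    ;; tmap (idm M') (tmap (idm N') (bwd i) ;; eps') ;; fwd (trunit M') ;; fwd i
  = fwd (tlunit M).
  rewrite tmapMr ?compA (reassoc (eq_sym (tassoc_nat _ _ _))) tmap1 ?compA.
  rewrite (reassoc (eq_sym (tmapM _ _ _ _))) comp1m compm1 tmap_splitV ?compA.
  have -> : tmap eta' (idm M') ;; (fwd (tassoc M' N' M')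
    ;; (tmap (idm M') eps' ;; (fwd (trunit M') ;; fwd i)))
    = fwd (tlunit M') ;; fwd i.
    apply: (iso_epi (i := iso_sym (tlunit M'))) => /=.
    rewrite -?compA bwdK comp1m.
    by move: T; rewrite /triangle_of -?compA => ->; rewrite comp1m.
  by rewrite -(compA (tmap _ _)) tlunit_nat compA bwdK compm1.
rewrite tmap_splitV /comparison !tmapMr ?compA A ?compA.
rewrite (reassoc (trunit_natV _)) compA -?compA.
rewrite ?compA.
rewrite (reassoc (eq_sym (tassoc_nat _ _ _))) tmap1 ?compA.
rewrite (reassoc B) ?compA (reassoc (eq_sym (tassoc_nat _ _ _))) ?compA.
rewrite (reassoc (triangle _ _)) -!tmapMl.
rewrite (reassoc (eq_sym (tmapM eta' _ _ eta))) comp1m compm1 tmap_splitV ?compA.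
rewrite -(tmap1 M N) (reassoc (tassoc_natV _ _ _)) ?compA -tmapMl.
rewrite ?compA in E; rewrite ?compA E.
have -> : tmap (fwd (tlunit M)) (idm N)
  = fwd (tassoc tone M N) ;; fwd (tlunit (M ⊗ N)) by rewrite tlunit_tens.
by rewrite bwdKA tlunit_nat tlunit_trunit_one bwdKA.
Qed.

(** Sliding [eps] past [eps'] leaves the triangle composite of [eta] and [eps]. *)
Lemma comparison_eps M M' N N' (eta : hom tone (M ⊗ N)) (eps : hom (N ⊗ M) tone)
  (eps' : hom (N' ⊗ M') tone) (i : iso M' M) :
  triangle_of eta eps = idm M ->
  eps' = tmap (comparison eta eps' i) (fwd i) ;; eps.
Proof.
move=> T.
have A : tmap (bwd (trunit N')) (idm M)
    = tmap (idm N') (bwd (tlunit M)) ;; bwd (tassoc N' tone M).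
  apply: (iso_mono (i := tassoc N' tone M
                         >> iso_tens (iso_refl N') (tlunit M))) => /=.
  by rewrite ?compA bwdKA triangle -!tmapM !bwdK !comp1m.
have B : tmap (bwd (tassoc N' M N)) (idm M) ;; fwd (tassoc (N' ⊗ M) N M)
  = fwd (tassoc N' (M ⊗ N) M) ;; (tmap (idm N') (fwd (tassoc M N M))
    ;; bwd (tassoc N' M (N ⊗ M))).
  apply: (iso_mono (i := tassoc N' M (N ⊗ M))).
  apply: (iso_epi (i := iso_tens (tassoc N' M N) (iso_refl M))) => /=.
  rewrite ?compA bwdK compm1 -pentagon (reassoc (eq_sym (tmapM _ _ _ _))).
  by rewrite fwdK comp1m tmap1 comp1m compA.
rewrite tmap_splitV /comparison.
have [e Ee] : exists e, e = tmap (idm N') (bwd i) ;; eps' by eexists.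
rewrite -Ee.
rewrite !tmapMl ?compA -tlunit_tens compA -tlunit_nat tlunit_trunit_one.
rewrite (reassoc (tassoc_nat e _ _)) tmap1 ?compA.
rewrite (reassoc (eq_sym (tmap_split e eps))) (tmap_splitV e eps) ?compA trunit_nat.
rewrite (reassoc B) ?compA (reassoc (tassoc_nat _ _ _)) ?compA.
rewrite A -trunit_tens ?compA bwdKA -(tmap1 N' M).
rewrite (reassoc (tassoc_nat _ _ _)) ?compA bwdKA.
do 5 rewrite (reassoc (eq_sym (tmapM _ _ _ _))) comp1m.
rewrite ?compA; rewrite /triangle_of ?compA in T.
by rewrite T compm1 Ee -compA -tmapM fwdK comp1m tmap1 comp1m.
Qed.


Lemma trace_unique M M' N N' P P' Q
  (eta : hom tone (M ⊗ N)) (eps : hom (N ⊗ M) tone)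
  (eta' : hom tone (M' ⊗ N')) (eps' : hom (N' ⊗ M') tone)
  (i : iso M' M) (j : hom P' P)
  (f : hom (Q ⊗ M) (M ⊗ P)) (f' : hom (Q ⊗ M') (M' ⊗ P')) :
  triangle_of eta eps = idm M -> triangle_of eta' eps' = idm M' ->
  tmap (idm Q) (fwd i) ;; f = f' ;; tmap (fwd i) j ->
  trace_of eta' eps' f' ;; j = trace_of eta eps f.
Proof.
move=> T T' e; apply: (trace_slide (comparison_eta eta i T') _ e).
exact: comparison_eps.
Qed.

Lemma triangle_slide M M' N N'
  (eta : hom tone (M ⊗ N)) (eps : hom (N ⊗ M) tone)
  (eta' : hom tone (M' ⊗ N')) (eps' : hom (N' ⊗ M') tone)
  (i : hom M' M) (p : hom N' N) :
  eta = eta' ;; tmap i p -> eps' = tmap p i ;; eps ->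
  triangle_of eta' eps' ;; i = i ;; triangle_of eta eps.
Proof.
move=> -> ->; rewrite /triangle_of ?compA -trunit_nat.
rewrite (reassoc (tlunit_natV _)) ?compA !(reassoc (eq_sym (tmapM _ _ _ _))).
rewrite !comp1m !compm1 (tmapMl eta') ?compA.
rewrite (reassoc (tassoc_nat _ _ _)) ?compA.
rewrite !(reassoc (eq_sym (tmapM _ _ _ _))).
by rewrite compm1.
Qed.

Lemma triangleV_slide M M' N N'
  (eta : hom tone (M ⊗ N)) (eps : hom (N ⊗ M) tone)
  (eta' : hom tone (M' ⊗ N')) (eps' : hom (N' ⊗ M') tone)
  (i : hom M' M) (p : hom N' N) :
  eta = eta' ;; tmap i p -> eps' = tmap p i ;; eps ->
  triangleV_of eta' eps' ;; p = p ;; triangleV_of eta eps.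
Proof.
move=> -> ->; rewrite /triangleV_of ?compA -tlunit_nat.
rewrite (reassoc (trunit_natV _)) ?compA !(reassoc (eq_sym (tmapM _ _ _ _))).
rewrite !comp1m !compm1 (tmapMrV p eta') ?compA.
rewrite (reassoc (tassoc_natV _ _ _)) ?compA.
rewrite !(reassoc (eq_sym (tmapM _ _ _ _))).
by rewrite compm1.
Qed.
End TraceOfData.

(** * Coherence of reindexing *)

Section Reindexing.
Context {S : cartcat} {C : indexed_smcat S}.

Lemma fwd_box_at (T A B : S) (u : hom T (A ** B)) (a : hom T A) (b : hom T B)
  (ea : u ;; p1 = a) (eb : u ;; p2 = b) (M : fib C A) (N : fib C B) :
  fwd (box_at ea eb M N)
  = bwd (smu (rx u) _ _) ;; tmap (fwd (rx_comp ea M)) (fwd (rx_comp eb N)).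
Proof. by []. Qed.

Lemma fwd_box_rx (A A' B B' : S) (f : hom A' A) (g : hom B' B)
  (M : fib C A) (N : fib C B) :
  fwd (box_rx f g M N) = tmap (fwd (rx_comp eq_refl M)) (fwd (rx_comp eq_refl N))
    ;; bwd (box_at (pair_p1 _ _) (pair_p2 _ _) M N).
Proof. by []. Qed.

(** The pseudofunctor constraint is independent of the proof that the triangle
    commutes, because the associativity law, applied with an identity map in first
    position, expresses it through constraints for other triangles. *)
Lemma rx_comp_irr (A B D : S) (f : hom A B) (g : hom B D) (h : hom A D)
  (e e' : f ;; g = h) (M : fib C D) : fwd (rx_comp e M) = fwd (rx_comp e' M).
Proof.
apply: (iso_epi (i := rx_comp (comp1m f) (rx g M))).
by rewrite -!(rx_assoc (comp1m f) e _ (comp1m h)).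
Qed.

Lemma rx_comp_natV (A B D : S) (f : hom A B) (g : hom B D) (h : hom A D)
  (e : f ;; g = h) (M N : fib C D) (x : hom M N) :
  fmap (rx h) x ;; bwd (rx_comp e N)
  = bwd (rx_comp e M) ;; fmap (rx f) (fmap (rx g) x).
Proof. exact/nat_bwd/rx_comp_nat. Qed.

Lemma smu_natV (A B : S) (f : hom A B) (X X' Y Y' : fib C B)
  (x : hom X X') (y : hom Y Y') :
  fmap (rx f) (tmap x y) ;; bwd (smu (rx f) X' Y')
  = bwd (smu (rx f) X Y) ;; tmap (fmap (rx f) x) (fmap (rx f) y).
Proof. exact/nat_bwd/smu_nat. Qed.

Lemma smu_symV (A B : S) (f : hom A B) (X Y : fib C B) :
  fmap (rx f) (fwd (tsym X Y)) ;; bwd (smu (rx f) Y X)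
  = bwd (smu (rx f) X Y) ;; fwd (tsym _ _).
Proof. exact/nat_bwd/eq_sym/smu_sym. Qed.

Lemma rx_comp_muV (A B D : S) (f : hom A B) (g : hom B D) (h : hom A D)
  (e : f ;; g = h) (M N : fib C D) :
  fwd (rx_comp e (M ⊗ N)) ;; bwd (smu (rx h) M N)
  = fmap (rx f) (bwd (smu (rx g) M N)) ;; bwd (smu (rx f) _ _)
    ;; tmap (fwd (rx_comp e M)) (fwd (rx_comp e N)).
Proof.
apply: move_bwdr.
apply: (iso_epi (i := smu (rx f) _ _ >> iso_fmap (rx f) (smu (rx g) M N))) => /=.
rewrite rx_comp_mu ?compA (reassoc (eq_sym (fmapM (rx f) _ _))) fwdK.
by rewrite fmap1 comp1m (reassoc (fwdK _)) comp1m.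
Qed.

Lemma rx_comp_id (A B : S) (f : hom A B) (e : f ;; idm B = f) (M : fib C B) :
  fwd (rx_comp e M) = fmap (rx f) (fwd (rx_id eq_refl M)).
Proof. exact: rx_unitr. Qed.

Lemma box_at_irr (T A B : S) (u : hom T (A ** B)) (a : hom T A) (b : hom T B)
  (ea ea' : u ;; p1 = a) (eb eb' : u ;; p2 = b) (M : fib C A) (N : fib C B) :
  fwd (box_at ea eb M N) = fwd (box_at ea' eb' M N).
Proof. by rewrite !fwd_box_at (rx_comp_irr ea ea') (rx_comp_irr eb eb'). Qed.

Lemma box_at_nat (T A B : S) (u : hom T (A ** B)) (a : hom T A) (b : hom T B)
  (ea : u ;; p1 = a) (eb : u ;; p2 = b) (M M' : fib C A) (N N' : fib C B)
  (x : hom M M') (y : hom N N') :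
  fmap (rx u) (bmap x y) ;; fwd (box_at ea eb M' N')
  = fwd (box_at ea eb M N) ;; tmap (fmap (rx a) x) (fmap (rx b) y).
Proof.
by rewrite !fwd_box_at ?compA (reassoc (smu_natV _ _ _)) ?compA -!tmapM !rx_comp_nat.
Qed.

Lemma box_at_natr (T A B : S) (u : hom T (A ** B)) (a : hom T A) (b : hom T B)
  (ea : u ;; p1 = a) (eb : u ;; p2 = b) (M : fib C A) (N N' : fib C B)
  (y : hom N N') :
  fmap (rx u) (tmap (idm (rx p1 M)) (fmap (rx p2) y)) ;; fwd (box_at ea eb M N')
  = fwd (box_at ea eb M N) ;; tmap (idm _) (fmap (rx b) y).
Proof.
by have := box_at_nat ea eb (idm M) y; rewrite /bmap !fmap1.
Qed.

Lemma box_at_natl (T A B : S) (u : hom T (A ** B)) (a : hom T A) (b : hom T B)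
  (ea : u ;; p1 = a) (eb : u ;; p2 = b) (M M' : fib C A) (N : fib C B)
  (x : hom M M') :
  fmap (rx u) (tmap (fmap (rx p1) x) (idm (rx p2 N))) ;; fwd (box_at ea eb M' N)
  = fwd (box_at ea eb M N) ;; tmap (fmap (rx a) x) (idm _).
Proof.
by have := box_at_nat ea eb x (idm N); rewrite /bmap !fmap1.
Qed.

Lemma box_at_comp (T T' A B : S) (s : hom T' T) (u : hom T (A ** B))
  (v : hom T' (A ** B)) (a : hom T A) (b : hom T B) (a' : hom T' A) (b' : hom T' B)
  (ea : u ;; p1 = a) (eb : u ;; p2 = b) (e : s ;; u = v)
  (ea' : s ;; a = a') (eb' : s ;; b = b') (va : v ;; p1 = a') (vb : v ;; p2 = b')
  (M : fib C A) (N : fib C B) :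
  fmap (rx s) (fwd (box_at ea eb M N)) ;; bwd (smu (rx s) _ _)
    ;; tmap (fwd (rx_comp ea' M)) (fwd (rx_comp eb' N))
  = fwd (rx_comp e (box M N)) ;; fwd (box_at va vb M N).
Proof.
rewrite !fwd_box_at (reassoc (rx_comp_muV e _ _)) fmapM; right_assoc.
rewrite (reassoc (smu_natV _ _ _)); right_assoc; rewrite -!tmapM.
by rewrite (rx_assoc e ea va ea') (rx_assoc e eb vb eb').
Qed.

Lemma box_rx_at (T A A' B B' : S) (u : hom T (A' ** B')) (v : hom T (A ** B))
  (f : hom A' A) (g : hom B' B)
  (a : hom T A') (b : hom T B') (a' : hom T A) (b' : hom T B)
  (ea : u ;; p1 = a) (eb : u ;; p2 = b) (e : u ;; xmap f g = v)
  (ea' : a ;; f = a') (eb' : b ;; g = b') (va : v ;; p1 = a') (vb : v ;; p2 = b')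
  (M : fib C A) (N : fib C B) :
  fmap (rx u) (fwd (box_rx f g M N)) ;; fwd (rx_comp e _) ;; fwd (box_at va vb M N)
  = fwd (box_at ea eb _ _) ;; tmap (fwd (rx_comp ea' M)) (fwd (rx_comp eb' N)).
Proof.
have ka : u ;; (p1 ;; f) = a' by rewrite -compA ea.
have kb : u ;; (p2 ;; g) = b' by rewrite -compA eb.
rewrite compA -(box_at_comp (pair_p1 _ _) (pair_p2 _ _) e ka kb va vb).
right_assoc; rewrite (reassoc (eq_sym (fmapM (rx u) _ _))).
have -> : fwd (box_rx f g M N) ;; fwd (box_at (pair_p1 _ _) (pair_p2 _ _) M N)
  = tmap (fwd (rx_comp eq_refl M)) (fwd (rx_comp eq_refl N)).
  by rewrite fwd_box_rx compA bwdK compm1.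
rewrite fwd_box_at (reassoc (smu_natV _ _ _)); right_assoc; rewrite -!tmapM.
by rewrite (rx_assoc ea eq_refl ea' ka) (rx_assoc eb eq_refl eb' kb).
Qed.

Lemma smu_assocV (A B : S) (f : hom A B) (X Y Z : fib C B) :
  fmap (rx f) (fwd (tassoc X Y Z)) ;; bwd (smu (rx f) X (Y ⊗ Z))
    ;; tmap (idm _) (bwd (smu (rx f) Y Z))
  = bwd (smu (rx f) (X ⊗ Y) Z) ;; tmap (bwd (smu (rx f) X Y)) (idm _)
    ;; fwd (tassoc _ _ _).
Proof.
apply: (iso_mono (i := iso_tens (iso_refl _) (smu (rx f) Y Z)
                       >> smu (rx f) X (Y ⊗ Z))).
apply: (iso_epi (i := iso_tens (smu (rx f) X Y) (iso_refl (rx f Z))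
                      >> smu (rx f) (X ⊗ Y) Z)) => /=.
right_assoc; rewrite (reassoc3 (smu_assoc (rx f) X Y Z)); right_assoc.
rewrite !fwdKA !(reassoc (eq_sym (tmapM _ _ _ _))) !fwdK.
by rewrite !comp1m !tmap1 !comp1m.
Qed.

Lemma smu_runitV (A B : S) (f : hom A B) (X : fib C B) :
  fmap (rx f) (fwd (trunit X))
  = bwd (smu (rx f) X tone) ;; tmap (idm _) (bwd (seps (rx f))) ;; fwd (trunit _).
Proof.
rewrite -(smu_runit (rx f) X); right_assoc.
by rewrite (reassoc (eq_sym (tmapM _ _ _ _))) bwdK comp1m tmap1 comp1m bwdKA.
Qed.

Lemma smu_lunitV (A B : S) (f : hom A B) (X : fib C B) :
  fmap (rx f) (fwd (tlunit X))
  = bwd (smu (rx f) tone X) ;; tmap (bwd (seps (rx f))) (idm _) ;; fwd (tlunit _).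
Proof.
rewrite -(smu_lunit (rx f) X); right_assoc.
by rewrite (reassoc (eq_sym (tmapM _ _ _ _))) bwdK comp1m tmap1 comp1m bwdKA.
Qed.

Section TripleBox.
Context (A B D : S) (M : fib C A) (N : fib C B) (P : fib C D).

(** Both bracketings of a triple external product, restricted to [T], become the
    corresponding triple tensor product over [T]; [box_assoc_at] is the associator
    of the fibre under these identifications. *)
Definition box3l (T : S) (u : hom T ((A ** B) ** D)) (q : hom T (A ** B))
  (x : hom T A) (y : hom T B) (z : hom T D) (eq : u ;; p1 = q)
  (ex : q ;; p1 = x) (ey : q ;; p2 = y) (ez : u ;; p2 = z) :
  iso (rx u (box (box M N) P)) (rx x M ⊗ rx y N ⊗ rx z P) :=
  box_at eq ez (box M N) P >> iso_tens (box_at ex ey M N) (iso_refl _).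

Definition box3r (T : S) (u : hom T (A ** (B ** D))) (q : hom T (B ** D))
  (x : hom T A) (y : hom T B) (z : hom T D) (ex : u ;; p1 = x)
  (eq : u ;; p2 = q) (ey : q ;; p1 = y) (ez : q ;; p2 = z) :
  iso (rx u (box M (box N P))) (rx x M ⊗ (rx y N ⊗ rx z P)) :=
  box_at ex eq M (box N P) >> iso_tens (iso_refl _) (box_at ey ez N P).

Lemma fwd_box3l (T : S) (u : hom T ((A ** B) ** D)) q x y z (eq : u ;; p1 = q)
  (ex : q ;; p1 = x) (ey : q ;; p2 = y) (ez : u ;; p2 = z) :
  fwd (box3l eq ex ey ez)
  = fwd (box_at eq ez (box M N) P) ;; tmap (fwd (box_at ex ey M N)) (idm _).
Proof. by []. Qed.

Lemma fwd_box3r (T : S) (u : hom T (A ** (B ** D))) q x y z (ex : u ;; p1 = x)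
  (eq : u ;; p2 = q) (ey : q ;; p1 = y) (ez : q ;; p2 = z) :
  fwd (box3r ex eq ey ez)
  = fwd (box_at ex eq M (box N P)) ;; tmap (idm _) (fwd (box_at ey ez N P)).
Proof. by []. Qed.

Lemma box3l_comp (T T' : S) (s : hom T' T) (u : hom T ((A ** B) ** D)) q x y z
  (eq : u ;; p1 = q) (ex : q ;; p1 = x) (ey : q ;; p2 = y) (ez : u ;; p2 = z)
  (u' : hom T' ((A ** B) ** D)) q' x' y' z'
  (eq' : u' ;; p1 = q') (ex' : q' ;; p1 = x') (ey' : q' ;; p2 = y')
  (ez' : u' ;; p2 = z') (su : s ;; u = u') (sx : s ;; x = x') (sy : s ;; y = y')
  (sz : s ;; z = z') :
  fwd (rx_comp su _) ;; fwd (box3l eq' ex' ey' ez')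
  = fmap (rx s) (fwd (box3l eq ex ey ez)) ;; bwd (smu (rx s) _ _)
    ;; tmap (bwd (smu (rx s) _ _)) (idm _)
    ;; tmap (tmap (fwd (rx_comp sx M)) (fwd (rx_comp sy N))) (fwd (rx_comp sz P)).
Proof.
have sq : s ;; q = q' by rewrite -eq -eq' -compA su.
rewrite !fwd_box3l -compA -(box_at_comp eq ez su sq sz).
flatten; rewrite (reassoc (smu_natV _ _ _)); right_assoc.
rewrite -!tmapM; congr (_ ;; (_ ;; tmap _ _)); last first.
  by rewrite fmap1 !comp1m compm1.
by rewrite -(box_at_comp ex ey sq sx sy); right_assoc.
Qed.

Lemma box3r_comp (T T' : S) (s : hom T' T) (u : hom T (A ** (B ** D))) q x y z
  (ex : u ;; p1 = x) (eq : u ;; p2 = q) (ey : q ;; p1 = y) (ez : q ;; p2 = z)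
  (u' : hom T' (A ** (B ** D))) q' x' y' z'
  (ex' : u' ;; p1 = x') (eq' : u' ;; p2 = q') (ey' : q' ;; p1 = y')
  (ez' : q' ;; p2 = z') (su : s ;; u = u') (sx : s ;; x = x') (sy : s ;; y = y')
  (sz : s ;; z = z') :
  fwd (rx_comp su _) ;; fwd (box3r ex' eq' ey' ez')
  = fmap (rx s) (fwd (box3r ex eq ey ez)) ;; bwd (smu (rx s) _ _)
    ;; tmap (idm _) (bwd (smu (rx s) _ _))
    ;; tmap (fwd (rx_comp sx M)) (tmap (fwd (rx_comp sy N)) (fwd (rx_comp sz P))).
Proof.
have sq : s ;; q = q' by rewrite -eq -eq' -compA su.
rewrite !fwd_box3r -compA -(box_at_comp ex eq su sx sq).
flatten; rewrite (reassoc (smu_natV _ _ _)); right_assoc.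
rewrite -!tmapM; congr (_ ;; (_ ;; tmap _ _)).
  by rewrite fmap1 !comp1m compm1.
by rewrite -(box_at_comp ey ez sq sy sz); right_assoc.
Qed.

Lemma fwd_box_assoc_at (T : S)
  (u : hom T ((A ** B) ** D)) (v : hom T (A ** (B ** D)))
  (e1 : v ;; p1 = (u ;; p1) ;; p1) (e2 : (v ;; p2) ;; p1 = (u ;; p1) ;; p2)
  (e3 : (v ;; p2) ;; p2 = u ;; p2) :
  fwd (box_assoc_at M N P e1 e2 e3)
  = fwd (box3l eq_refl eq_refl eq_refl eq_refl) ;; fwd (tassoc _ _ _)
    ;; bwd (box3r e1 eq_refl e2 e3).
Proof. by rewrite /= !compA. Qed.

Lemma box_assoc_at_comp (T T' : S) (s : hom T' T)
  (u : hom T ((A ** B) ** D)) (v : hom T (A ** (B ** D)))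
  (e1 : v ;; p1 = (u ;; p1) ;; p1) (e2 : (v ;; p2) ;; p1 = (u ;; p1) ;; p2)
  (e3 : (v ;; p2) ;; p2 = u ;; p2)
  (u' : hom T' ((A ** B) ** D)) (v' : hom T' (A ** (B ** D))) q q' x y z
  (eq : u' ;; p1 = q) (ex : q ;; p1 = x) (ey : q ;; p2 = y) (ez : u' ;; p2 = z)
  (ex' : v' ;; p1 = x) (eq' : v' ;; p2 = q') (ey' : q' ;; p1 = y)
  (ez' : q' ;; p2 = z) (su : s ;; u = u') (sv : s ;; v = v') :
  fmap (rx s) (fwd (box_assoc_at M N P e1 e2 e3)) ;; fwd (rx_comp sv _)
    ;; fwd (box3r ex' eq' ey' ez')
  = fwd (rx_comp su _) ;; fwd (box3l eq ex ey ez) ;; fwd (tassoc _ _ _).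
Proof.
have sx : s ;; ((u ;; p1) ;; p1) = x by rewrite -ex -eq -su !compA.
have sy : s ;; ((u ;; p1) ;; p2) = y by rewrite -ey -eq -su !compA.
have sz : s ;; (u ;; p2) = z by rewrite -ez -su !compA.
rewrite fwd_box_assoc_at compA (box3r_comp e1 eq_refl e2 e3 _ _ _ _ sv sx sy sz).
rewrite (box3l_comp eq_refl eq_refl eq_refl eq_refl _ _ _ _ su sx sy sz).
flatten; rewrite fmap_bwdKA tassoc_nat; congr (_ ;; _).
by rewrite (reassoc3 (smu_assocV _ _ _ _)); right_assoc.
Qed.

End TripleBox.
End Reindexing.

(** * Units of pushforwards at a point *)

Section UnitAtPoint.
Context {S : cartcat} {C : indexed_smcat S} (H : pushforwards C).

Lemma punit_nat (A B : S) (f : hom A B) (X Y : fib C A) (x : hom X Y) :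
  x ;; punit H f Y = punit H f X ;; fmap (rx f) (fmap (push H f) x).
Proof. exact: unit_nat. Qed.

(** The target is indexed by [v] with [u ;; f = v], not by [u ;; f], so that points
    of products can be given by their components. *)
Definition unit_at (T A B : S) (f : hom A B) (X : fib C A) (u : hom T A)
  (v : hom T B) (e : u ;; f = v) : hom (rx u X) (rx v (push H f X)) :=
  fmap (rx u) (punit H f X) ;; fwd (rx_comp e _).

Section UnitAt.
Context (T A B : S) (f : hom A B) (u : hom T A) (v : hom T B) (e : u ;; f = v).

Lemma unit_at_nat (X Y : fib C A) (x : hom X Y) :
  unit_at X e ;; fmap (rx v) (fmap (push H f) x) = fmap (rx u) x ;; unit_at Y e.
Proof.
by rewrite /unit_at compA -rx_comp_nat -!compA -!fmapM punit_nat.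
Qed.

Lemma unit_at_transp (X : fib C A) (Y : fib C B) (x : hom X (rx f Y)) :
  unit_at X e ;; fmap (rx v) (transp H x) = fmap (rx u) x ;; fwd (rx_comp e Y).
Proof. by rewrite /unit_at compA -rx_comp_nat -compA -fmapM transpK. Qed.

Lemma unit_at_irr (e' : u ;; f = v) (X : fib C A) : unit_at X e = unit_at X e'.
Proof. by rewrite /unit_at (rx_comp_irr e e'). Qed.

(** The projection morphism is the adjunct of the unit tensored with [f^* M]. *)
Lemma unit_at_proj (M : fib C B) (N : fib C A) :
  unit_at (rx f M ⊗ N) e ;; fmap (rx v) (proj_map H f M N) ;; bwd (smu (rx v) _ _)
  = bwd (smu (rx u) _ _) ;; tmap (fwd (rx_comp e M)) (unit_at N e).
Proof.
rewrite /proj_map -fmapM.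
rewrite -[fmap (push H f) _ ;; _]/(transp H _) unit_at_transp compA rx_comp_muV.
right_assoc; rewrite (reassoc (eq_sym (fmapM (rx u) _ _))).
rewrite compA fwdK compm1 (reassoc (smu_natV _ _ _)) compA -tmapM.
by rewrite fmap1 comp1m.
Qed.
End UnitAt.

Lemma unit_at_push_comp (T A B D : S) (f : hom A B) (g : hom B D) (h : hom A D)
  (u : hom T A) (v : hom T B) (w : hom T D) (eh : f ;; g = h) (e : u ;; f = v)
  (ev : v ;; g = w) (eu : u ;; h = w) (X : fib C A) :
  unit_at X e ;; unit_at (push H f X) ev ;; fmap (rx w) (fwd (push_comp H eh X))
  = unit_at X eu.
Proof.
rewrite /= /push_comp_fwd compA unit_at_transp -compA unit_at_transp.
by rewrite compA -(rx_assoc e eh ev eu) -compA -fmapM compA bwdK compm1.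
Qed.

Lemma unit_at_push_id (T A : S) (k : hom A A) (u : hom T A) (ek : k = idm A)
  (e : u ;; k = u) (X : fib C A) :
  unit_at X e ;; fmap (rx u) (fwd (push_id H ek X)) = idm _.
Proof.
rewrite /= /push_id_fwd unit_at_transp (rx_unitr ek e) -fmapM bwdK.
exact: fmap1.
Qed.

(** The Beck-Chevalley morphism is by definition the adjunct of a reindexed unit, so
    it carries the unit for [top s] to the unit for [bot s]. *)
Lemma unit_at_bc (T : S) (s : square S) (M : fib C (sqC s)) (u : hom T (sqA s))
  (v : hom T (sqB s)) (m : hom T (sqC s)) (w : hom T (sqD s))
  (ev : u ;; top s = v) (em : u ;; lft s = m) (ew : m ;; bot s = w)
  (ew' : v ;; rgt s = w) :
  unit_at (rx (lft s) M) ev ;; fmap (rx v) (bc_map H M) ;; fwd (rx_comp ew' _)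
  = fwd (rx_comp em M) ;; unit_at M ew.
Proof.
have k : u ;; (lft s ;; bot s) = w by rewrite -compA em.
rewrite bc_mapE unit_at_transp compA -(rx_assoc ev (sqE s) ew' k).
rewrite -compA -fmapM bchange_comp fmapM compA (rx_assoc em eq_refl ew k).
by rewrite -compA rx_comp_nat compA.
Qed.

(** If [f] is an isomorphism then [f^*] is fully faithful, so that a one-sided
    inverse of the unit, given by the universal property, is two-sided. *)
Lemma punit_iso (A B : S) (i : iso A B) (X : fib C A) :
  inverse (punit H (fwd i) X).
Proof.
pose c := iso_sym (rx_fwdbwd i X).
have K : punit H (fwd i) X ;; (fmap (rx (fwd i)) (transp H (fwd c)) ;; bwd c)
         = idm X by rewrite -compA transpK fwdK.
refine (Inverse K _).
set r := (_ ;; bwd c); set q := r ;; _.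
have E : transp H (punit H (fwd i) X ;; q) = rx_full (i := i) q.
  by apply: transp_inj; rewrite transpK rx_fullK.
rewrite -(rx_fullK (i := i) q) -E /q -compA K comp1m.
have -> : transp H (punit H (fwd i) X) = idm _.
  by apply: transp_inj; rewrite transpK fmap1 compm1.
exact: fmap1.
Defined.
End UnitAtPoint.

(** * Projection and Beck-Chevalley isomorphisms at a point *)

Section BoxPush.
Context {S : cartcat} {C : indexed_smcat S} (H : ihcoprod C).

Lemma fwd_box_pushr (A B B' : S) (g : hom B B') (M : fib C A) (N : fib C B) :
  fwd (box_pushr H g M N)
  = fmap (push H (xmap (idm A) g))
      (tmap (bwd (rx_comp (eq_trans (pair_p1 _ _) (compm1 p1)) M)) (idm (rx p2 N)))
    ;; proj_map H (xmap (idm A) g) (rx p1 M) (rx p2 N)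
    ;; tmap (idm (rx p1 M)) (bc_map H (s := sq_p2 A g) N).
Proof. by []. Qed.

Lemma fwd_box_pushl (A A' B : S) (f : hom A A') (M : fib C A) (N : fib C B) :
  fwd (box_pushl H f M N)
  = fmap (push H (xmap f (idm B)))
      (fwd (tsym _ _)
       ;; tmap (bwd (rx_comp (eq_trans (pair_p2 _ _) (compm1 p2)) N)) (idm (rx p1 M)))
    ;; proj_map H (xmap f (idm B)) (rx p2 N) (rx p1 M)
    ;; tmap (idm (rx p2 N)) (bc_map H (s := sq_p1 B f) M)
    ;; fwd (tsym _ _).
Proof. by []. Qed.

Lemma box_pushr_at (T A B B' : S) (g : hom B B') (u : hom T (A ** B))
  (v : hom T (A ** B')) (a : hom T A) (b : hom T B) (b' : hom T B')
  (e : u ;; xmap (idm A) g = v) (ea : u ;; p1 = a) (eb : u ;; p2 = b)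
  (va : v ;; p1 = a) (vb : v ;; p2 = b') (eg : b ;; g = b')
  (M : fib C A) (N : fib C B) :
  unit_at H (box M N) e ;; fmap (rx v) (fwd (box_pushr H g M N))
    ;; fwd (box_at va vb M (push H g N))
  = fwd (box_at ea eb M N) ;; tmap (idm _) (unit_at H N eg).
Proof.
rewrite fwd_box_pushr !fwd_box_at; flatten.
rewrite (reassoc (unit_at_nat _ _ _)); right_assoc.
rewrite (reassoc (smu_natV _ _ _)); right_assoc.
rewrite (reassoc3 (unit_at_proj _ _ _ _)); right_assoc.
rewrite (reassoc (smu_natV _ _ _)); right_assoc.
rewrite -!tmapM !fmap1 !comp1m (compm1 (fwd (rx_comp ea M))).
congr (_ ;; tmap _ _).
  by rewrite -(rx_assoc e (eq_trans (pair_p1 _ _) (compm1 p1)) va ea) fmap_bwdKA.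
have := unit_at_bc H (s := sq_p2 A g) N e eb eg vb.
by rewrite compA.
Qed.

Lemma box_pushl_at (T A A' B : S) (f : hom A A') (u : hom T (A ** B))
  (v : hom T (A' ** B)) (a : hom T A) (a' : hom T A') (b : hom T B)
  (e : u ;; xmap f (idm B) = v) (ea : u ;; p1 = a) (eb : u ;; p2 = b)
  (va : v ;; p1 = a') (vb : v ;; p2 = b) (ef : a ;; f = a')
  (M : fib C A) (N : fib C B) :
  unit_at H (box M N) e ;; fmap (rx v) (fwd (box_pushl H f M N))
    ;; fwd (box_at va vb (push H f M) N)
  = fwd (box_at ea eb M N) ;; tmap (unit_at H M ef) (idm _).
Proof.
rewrite fwd_box_pushl !fwd_box_at; flatten.
rewrite (reassoc (unit_at_nat _ _ _)); right_assoc.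
rewrite (reassoc (unit_at_nat _ _ _)); right_assoc.
rewrite (reassoc (smu_symV _ _ _)); right_assoc.
rewrite (reassoc (smu_natV _ _ _)); right_assoc.
rewrite (reassoc3 (unit_at_proj _ _ _ _)); right_assoc.
rewrite (reassoc (smu_natV _ _ _)); right_assoc.
rewrite (reassoc (smu_symV _ _ _)); right_assoc.
rewrite -(tsym_nat (fwd (rx_comp vb N))).
do 3 rewrite (reassoc (eq_sym (tmapM _ _ _ _))).
rewrite tsym_nat (reassoc (tsymK _ _)) comp1m -tmapM !fmap1 !comp1m.
rewrite (compm1 (fwd (rx_comp eb N))); right_assoc; congr (_ ;; tmap _ _).
  have := unit_at_bc H (s := sq_p1 B f) M e ea ef va.
  by rewrite compA.
by rewrite -(rx_assoc e (eq_trans (pair_p2 _ _) (compm1 p2)) vb eb) fmap_bwdKA.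
Qed.
End BoxPush.

(** * Composition and unit 1-cells at a point *)

(** [T]-points of the boundary of a composite: [x = (a,b)], [y = (b,d)] and
    [z = (a,d)]. *)
Record composable (S : cartcat) (T A B D : S) (x : hom T (A ** B))
  (y : hom T (B ** D)) (z : hom T (A ** D)) : Prop := Composable {
  cps_l : x ;; p1 = z ;; p1;
  cps_m : x ;; p2 = y ;; p1;
  cps_r : y ;; p2 = z ;; p2
}.

Section Elements.
Context {S : cartcat} {C : indexed_smcat S} (H : ihcoprod C).

Section CompAt.
Context (T A B D : S) (x : hom T (A ** B)) (y : hom T (B ** D))
  (z : hom T (A ** D)) (h : composable x y z).

Definition point2 : hom T ((A ** B) ** D) := <[x, y ;; p2]>.

Lemma point2_l : (point2 ;; dlt A B D) ;; p1 = x.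
Proof. by rewrite /point2 /dlt; cart. Qed.
Lemma point2_r : (point2 ;; dlt A B D) ;; p2 = y.
Proof. by case: h => _ e _; rewrite /point2 /dlt; cart. Qed.
Lemma point2_prj : point2 ;; prj A B D = z.
Proof. by case: h => e _ e'; rewrite /point2 /prj; cart. Qed.

Lemma point2_uniq (u : hom T ((A ** B) ** D)) (t : hom T ((A ** B) ** (B ** D))) :
  u ;; dlt A B D = t -> t ;; p1 = x -> t ;; p2 = y -> u = point2.
Proof.
by move=> et e1 e2; rewrite /point2 -e1 -e2 -et /dlt; cart.
Qed.

(** The universal pairing of a value of [M] at [(a,b)] and a value of [N] at
    [(b,d)]; over [T = A x B x D] it is the unit of the pushforward defining the
    composite. *)
Definition comp_at (M : fib C (A ** B)) (N : fib C (B ** D)) :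
  hom (rx x M ⊗ rx y N) (rx z (odot H M N)) :=
  bwd (rx_comp eq_refl (box M N) >> box_at point2_l point2_r M N)
  ;; unit_at H (rx (dlt A B D) (box M N)) point2_prj.

(** The middle point [u] is determined by [x] and [y], so any presentation of it
    computes the same morphism. *)
Lemma comp_atE (u : hom T ((A ** B) ** D)) (t : hom T ((A ** B) ** (B ** D)))
  (et : u ;; dlt A B D = t) (e1 : t ;; p1 = x) (e2 : t ;; p2 = y)
  (e3 : u ;; prj A B D = z) (M : fib C (A ** B)) (N : fib C (B ** D)) :
  fwd (rx_comp et (box M N)) ;; fwd (box_at e1 e2 M N) ;; comp_at M N
  = unit_at H _ e3.
Proof.
have eu := point2_uniq et e1 e2; subst u; subst t.
rewrite /comp_at -[bwd (_ >> _)]/(bwd _ ;; bwd _) (unit_at_irr _ point2_prj e3).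
rewrite (box_at_irr e1 point2_l e2 point2_r); right_assoc.
by rewrite fwdKA fwdKA.
Qed.

Lemma comp_at_nat (M M' : fib C (A ** B)) (N N' : fib C (B ** D))
  (f : hom M M') (g : hom N N') :
  comp_at M N ;; fmap (rx z) (odot_map H f g)
  = tmap (fmap (rx x) f) (fmap (rx y) g) ;; comp_at M' N'.
Proof.
apply: (iso_epi (i := rx_comp eq_refl (box M N) >> box_at point2_l point2_r M N)).
rewrite -compA (comp_atE _ _ _ point2_prj) /odot_map unit_at_nat.
rewrite -[fwd (_ >> _)]/(fwd _ ;; fwd _).
rewrite -(compA _ (tmap _ _)) (compA _ _ (tmap _ _)) -box_at_nat -compA -rx_comp_nat.
by right_assoc; rewrite -(comp_atE eq_refl point2_l point2_r point2_prj); right_assoc.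
Qed.
End CompAt.

Section CompAtPush.
Context (T A B D X B0 : S).

(** Composing with a 1-cell [g_! N]: the constraints begin by pulling the
    pushforward out of the external product and then across the composition.  On
    units the projection formula and the Beck-Chevalley isomorphism both disappear,
    and two successive units remain. *)
Lemma comp_at_pushr (g : hom B0 (B ** D)) (top : hom X ((A ** B) ** D))
  (lft : hom X ((A ** B) ** B0)) (e : top ;; dlt A B D = lft ;; xmap (idm _) g)
  (M : fib C (A ** B)) (N : fib C B0)
  (i : iso (push H top (rx lft (box M N)))
           (rx (dlt A B D) (push H (xmap (idm _) g) (box M N))))
  (ei : fwd i = bc_map H (s := Square e) (box M N))
  (w : hom T X) (u : hom T ((A ** B) ** D)) (m : hom T ((A ** B) ** B0))
  (x : hom T (A ** B)) (n : hom T B0) (y : hom T (B ** D)) (z : hom T (A ** D))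
  (h : composable x y z) (eu : w ;; top = u) (em : w ;; lft = m)
  (ex : m ;; p1 = x) (en : m ;; p2 = n) (ey : n ;; g = y)
  (ez : u ;; prj A B D = z) :
  fwd (rx_comp em _) ;; fwd (box_at ex en M N) ;; tmap (idm _) (unit_at H N ey)
    ;; comp_at h M (push H g N)
    ;; fmap (rx z) (fmap (push H (prj A B D))
         (fmap (rx (dlt A B D)) (bwd (box_pushr H g M N)) ;; bwd i))
  = unit_at H (rx lft (box M N)) eu ;; unit_at H _ ez.
Proof.
pose t := m ;; xmap (idm (A ** B)) g.
have et : u ;; dlt A B D = t by rewrite -eu /t -em !compA e.
have e1 : t ;; p1 = x by rewrite -ex /t; cart.
have e2 : t ;; p2 = y by rewrite -ey -en /t; cart.
have K : fwd (box_at e1 e2 M (push H g N)) ;; comp_at h M (push H g N)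
  = bwd (rx_comp et _) ;; unit_at H _ ez.
  by apply/eq_sym/move_bwdl; rewrite -(comp_atE h et e1 e2) compA.
have E := box_pushr_at H (eq_refl : m ;; xmap (idm _) g = t) ex en e1 e2 ey M N.
right_assoc; rewrite (reassoc (eq_sym E)); right_assoc.
rewrite (reassoc K); right_assoc; rewrite unit_at_nat; flatten.
rewrite (reassoc (rx_comp_natV et (fwd (box_pushr H g M N)))); flatten.
rewrite (reassoc (eq_sym (fmapM (rx u) _ _))) -fmapM fwdK !fmap1 comp1m.
have F := unit_at_bc H (s := Square e) (box M N) eu em (eq_refl : m ;; _ = t) et.
rewrite -(compA (fwd _)) -F; right_assoc; rewrite fwdKA.
by rewrite -ei fmap_fwdKA.
Qed.

(** The mirror image of [comp_at_pushr]. *)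
Lemma comp_at_pushl (f : hom B0 (A ** B)) (top : hom X ((A ** B) ** D))
  (lft : hom X (B0 ** (B ** D))) (e : top ;; dlt A B D = lft ;; xmap f (idm _))
  (M : fib C B0) (N : fib C (B ** D))
  (i : iso (push H top (rx lft (box M N)))
           (rx (dlt A B D) (push H (xmap f (idm _)) (box M N))))
  (ei : fwd i = bc_map H (s := Square e) (box M N))
  (w : hom T X) (u : hom T ((A ** B) ** D)) (m : hom T (B0 ** (B ** D)))
  (n : hom T B0) (x : hom T (A ** B)) (y : hom T (B ** D)) (z : hom T (A ** D))
  (h : composable x y z) (eu : w ;; top = u) (em : w ;; lft = m)
  (en : m ;; p1 = n) (ey : m ;; p2 = y) (ex : n ;; f = x)
  (ez : u ;; prj A B D = z) :
  fwd (rx_comp em _) ;; fwd (box_at en ey M N) ;; tmap (unit_at H M ex) (idm _)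
    ;; comp_at h (push H f M) N
    ;; fmap (rx z) (fmap (push H (prj A B D))
         (fmap (rx (dlt A B D)) (bwd (box_pushl H f M N)) ;; bwd i))
  = unit_at H (rx lft (box M N)) eu ;; unit_at H _ ez.
Proof.
pose t := m ;; xmap f (idm (B ** D)).
have et : u ;; dlt A B D = t by rewrite -eu /t -em !compA e.
have e1 : t ;; p1 = x by rewrite -ex /t -en; cart.
have e2 : t ;; p2 = y by rewrite /t -ey; cart.
have K : fwd (box_at e1 e2 (push H f M) N) ;; comp_at h (push H f M) N
  = bwd (rx_comp et _) ;; unit_at H _ ez.
  by apply/eq_sym/move_bwdl; rewrite -(comp_atE h et e1 e2) compA.
have E := box_pushl_at H (eq_refl : m ;; xmap f (idm _) = t) en ey e1 e2 ex M N.
right_assoc; rewrite (reassoc (eq_sym E)); right_assoc.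
rewrite (reassoc K); right_assoc; rewrite unit_at_nat; flatten.
rewrite (reassoc (rx_comp_natV et (fwd (box_pushl H f M N)))); flatten.
rewrite (reassoc (eq_sym (fmapM (rx u) _ _))) -fmapM fwdK !fmap1 comp1m.
have F := unit_at_bc H (s := Square e) (box M N) eu em (eq_refl : m ;; _ = t) et.
rewrite -(compA (fwd _)) -F; right_assoc; rewrite fwdKA.
by rewrite -ei fmap_fwdKA.
Qed.
End CompAtPush.

Section Units.
Context (T : S).

Lemma rx_unitE (X : S) (a : hom T X) (e : a ;; bang X = bang T) :
  fwd (rx_unit (C := C) a) = fwd (rx_comp e tone) ;; bwd (seps (rx (bang T))).
Proof.
apply/eq_sym/move_bwdr; rewrite -(rx_comp_eps C e) /=.
by right_assoc; rewrite bwdKA fmap_bwdKA.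
Qed.

(** The generic element of the unit 1-cell: every morphism out of the pushforward
    [ounit H A] is determined by its value on it. *)
Definition ounit_at (A : S) (a : hom T A) (d : hom T (A ** A)) (e : a ;; diag A = d) :
  hom tone (rx d (ounit H A)) := bwd (rx_unit a) ;; unit_at H (rx (bang A) tone) e.

End Units.

Lemma rx_unit_comp (T T' X : S) (s : hom T' T) (a : hom T X) (b : hom T' X)
  (e : s ;; a = b) :
  fmap (rx s) (fwd (rx_unit a)) ;; bwd (seps (rx s))
  = fwd (rx_comp e _) ;; fwd (rx_unit (C := C) b).
Proof.
have ea : a ;; bang X = bang T := bang_uniq _ _.
have eb : b ;; bang X = bang T' := bang_uniq _ _.
have es : s ;; bang T = bang T' := bang_uniq _ _.
rewrite (rx_unitE ea) (rx_unitE eb); right_assoc.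
rewrite (reassoc (eq_sym (rx_assoc e ea eb es tone))) fmapM; right_assoc.
congr (_ ;; _); rewrite -(rx_unitE es).
by [].
Qed.

Section OrUnit.
Context (T A B : S) (M : fib C (A ** B)).

(** After [comp_at_pushr], the two remaining units belong to a pushforward along
    a composite equal to the identity, so they cancel against [push_id]. *)
Lemma orunit_at (x : hom T (A ** B)) (b : hom T B) (d : hom T (B ** B))
  (eb : x ;; p2 = b) (ed : b ;; diag B = d) (h : composable x d x) :
  tmap (idm _) (ounit_at ed) ;; comp_at h M (ounit H B) ;; fmap (rx x) (fwd (orunit H M))
  = fwd (trunit _).
Proof.
pose m := x ;; diagr A B.
have m1 : m ;; p1 = x by rewrite /m /diagr; cart.
have m2 : m ;; p2 = b by rewrite -eb /m /diagr; cart.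
have mz : m ;; prj A B B = x by rewrite /m /prj /diagr; cart.
have K := comp_at_pushr (i := bc H (std_unitr A B) (box M (rx (bang B) tone)))
  eq_refl h (eq_refl : x ;; diagr A B = m) eq_refl m1 m2 ed mz.
apply: (iso_epi (i := rx_comp (eq_refl : x ;; diagr A B = m) _
  >> box_at m1 m2 _ _ >> iso_tens (iso_refl _) (rx_unit b))).
have -> : fwd (orunit H M)
  = fmap (push H (prj A B B))
      (fmap (rx (dlt A B B)) (bwd (box_pushr H (diag B) M (rx (bang B) tone)))
       ;; bwd (bc H (std_unitr A B) (box M (rx (bang B) tone))))
    ;; (fwd (push_comp H (unitr1 A B) _) ;; (fwd (push_id H eq_refl _)
    ;; (fwd (box_at (unitr2 A B) eq_refl M _)
    ;; (tmap (fwd (rx_id eq_refl M)) (fwd (rx_unit (diagr A B ;; p2)))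
    ;; fwd (trunit M))))) by rewrite /= !compA.
have U : tmap (idm (rx x M)) (fwd (rx_unit b)) ;; tmap (idm _) (ounit_at ed)
    = tmap (idm _) (unit_at H _ ed) by rewrite -tmapMr /ounit_at fwdKA.
unfold_isos; right_assoc; rewrite (reassoc U).
rewrite_head K.
rewrite_head (unit_at_push_comp H (unitr1 A B) (eq_refl : x ;; _ = m) mz (compm1 x)
         (rx (diagr A B) (box M (rx (bang B) tone)))).
rewrite_head (unit_at_push_id H eq_refl (compm1 x)
         (rx (diagr A B) (box M (rx (bang B) tone)))).
have eb' : x ;; (diagr A B ;; p2) = b by rewrite -compA.
rewrite comp1m -[in RHS]compA.
rewrite -(box_at_comp (unitr2 A B) eq_refl _ (compm1 x) eb'); right_assoc.
rewrite smu_runitV; right_assoc; rewrite (reassoc (smu_natV _ _ _)); right_assoc.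
congr (_ ;; (_ ;; _)); rewrite -!compA -!tmapM compm1; congr (tmap _ _ ;; _).
  by rewrite compm1 rx_comp_id.
exact: rx_unit_comp.
Qed.

Lemma olunit_at (x : hom T (A ** B)) (a : hom T A) (d : hom T (A ** A))
  (ea : x ;; p1 = a) (ed : a ;; diag A = d) (h : composable d x x) :
  tmap (ounit_at ed) (idm _) ;; comp_at h (ounit H A) M ;; fmap (rx x) (fwd (olunit H M))
  = fwd (tlunit _).
Proof.
pose m := x ;; <[p1, idm (A ** B)]>.
pose t := x ;; diagl A B.
have m1 : m ;; p1 = a by rewrite -ea /m; cart.
have m2 : m ;; p2 = x by rewrite /m; cart.
have mz : t ;; prj A A B = x by rewrite /t /prj /diagl; cart.
have K := comp_at_pushl (i := bc H (std_unitl A B) (box (rx (bang A) tone) M))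
  eq_refl h (eq_refl : x ;; diagl A B = t) (eq_refl : x ;; _ = m) m1 m2 ed mz.
apply: (iso_epi (i := rx_comp (eq_refl : x ;; _ = m) _
  >> box_at m1 m2 _ _ >> iso_tens (rx_unit a) (iso_refl _))).
have -> : fwd (olunit H M)
  = fmap (push H (prj A A B))
      (fmap (rx (dlt A A B)) (bwd (box_pushl H (diag A) (rx (bang A) tone) M))
       ;; bwd (bc H (std_unitl A B) (box (rx (bang A) tone) M)))
    ;; (fwd (push_comp H (unitl1 A B) _) ;; (fwd (push_id H eq_refl _)
    ;; (fwd (box_at eq_refl (unitl2 A B) _ M)
    ;; (tmap (fwd (rx_unit (<[p1, idm _]> ;; p1))) (fwd (rx_id eq_refl M))
    ;; fwd (tlunit M))))) by rewrite /= !compA.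
have U : tmap (fwd (rx_unit a)) (idm (rx x M)) ;; tmap (ounit_at ed) (idm _)
    = tmap (unit_at H _ ed) (idm _) by rewrite -tmapMl /ounit_at fwdKA.
unfold_isos; right_assoc; rewrite (reassoc U).
rewrite_head K.
rewrite_head (unit_at_push_comp H (unitl1 A B) (eq_refl : x ;; _ = t) mz (compm1 x)
         (rx <[p1, idm (A ** B)]> (box (rx (bang A) tone) M))).
rewrite_head (unit_at_push_id H eq_refl (compm1 x)
         (rx <[p1, idm (A ** B)]> (box (rx (bang A) tone) M))).
have ea' : x ;; (<[p1, idm (A ** B)]> ;; p1) = a by rewrite -compA.
rewrite comp1m -[in RHS]compA.
rewrite -(box_at_comp eq_refl (unitl2 A B) _ ea' (compm1 x)); right_assoc.
rewrite smu_lunitV; right_assoc; rewrite (reassoc (smu_natV _ _ _)); right_assoc.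
congr (_ ;; (_ ;; _)); rewrite -!compA -!tmapM compm1; congr (tmap _ _ ;; _).
  exact: rx_unit_comp.
by rewrite compm1 rx_comp_id.
Qed.

Lemma orunit_atV (x : hom T (A ** B)) (b : hom T B) (d : hom T (B ** B))
  (eb : x ;; p2 = b) (ed : b ;; diag B = d) (h : composable x d x) :
  fmap (rx x) (bwd (orunit H M))
  = bwd (trunit _) ;; (tmap (idm _) (ounit_at ed) ;; comp_at h M (ounit H B)).
Proof.
apply/eq_sym/move_bwdl; rewrite -(orunit_at eb ed h).
by right_assoc; rewrite -fmapM fwdK fmap1 compm1.
Qed.

Lemma olunit_atV (x : hom T (A ** B)) (a : hom T A) (d : hom T (A ** A))
  (ea : x ;; p1 = a) (ed : a ;; diag A = d) (h : composable d x x) :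
  fmap (rx x) (bwd (olunit H M))
  = bwd (tlunit _) ;; (tmap (ounit_at ed) (idm _) ;; comp_at h (ounit H A) M).
Proof.
apply/eq_sym/move_bwdl; rewrite -(olunit_at ea ed h).
by right_assoc; rewrite -fmapM fwdK fmap1 compm1.
Qed.
End OrUnit.
End Elements.

(** * The associator at a point *)

Section Associator.
Context {S : cartcat} {C : indexed_smcat S} (H : ihcoprod C).
Context (T A B D E : S).
Context (x : hom T (A ** B)) (y : hom T (B ** D)) (z : hom T (D ** E)).
Context (xy : hom T (A ** D)) (yz : hom T (B ** E)) (w : hom T (A ** E)).
Context (hxy : composable x y xy) (hxyz : composable xy z w).
Context (hyz : composable y z yz) (hxyz' : composable x yz w).
Context (M : fib C (A ** B)) (N : fib C (B ** D)) (P : fib C (D ** E)).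

Definition point3 : hom T (((A ** B) ** D) ** E) := <[point2 x y, z ;; p2]>.

Lemma point3_prj : point3 ;; prj3 A B D E = w.
Proof.
case: hxyz hxy => e _ e' [e'' _ _].
by rewrite /point3 /point2 /prj3; cart; rewrite ?e'' ?e ?e'.
Qed.

Lemma point3_l : (point3 ;; dlt3 A B D E) ;; p1 = point2 x y ;; dlt A B D.
Proof. by rewrite /point3 /point2 /dlt3 /dlt; cart. Qed.

Lemma point3_r : (point3 ;; dlt3 A B D E) ;; p2 = z.
Proof.
case: hxyz hxy => _ e _ [_ _ e'].
by rewrite /point3 /point2 /dlt3; cart; rewrite ?e' ?e.
Qed.

Lemma point3_l' : (point3 ;; dlt3' A B D E) ;; p1 = x.
Proof. by rewrite /point3 /point2 /dlt3'; cart. Qed.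

Lemma point3_r' : (point3 ;; dlt3' A B D E) ;; p2 = point2 y z ;; dlt B D E.
Proof.
case: hxy => _ e _.
by rewrite /point3 /point2 /dlt3' /dlt; cart; rewrite ?e.
Qed.

Definition norm3 : iso (rx point3 (rx (dlt3 A B D E) (box (box M N) P)))
                       (rx x M ⊗ rx y N ⊗ rx z P) :=
  rx_comp eq_refl _ >> box3l M N P point3_l (point2_l x y) (point2_r hxy) point3_r.

(** Both bracketings of a triple composite are compared with the single
    pushforward [odot3] by checking that the iterated units become the unit of that
    pushforward. *)
Lemma odot3l_at :
  fwd norm3 ;; tmap (comp_at H hxy M N) (idm _) ;; comp_at H hxyz (odot H M N) P
    ;; fmap (rx w) (fwd (odot3l H M N P))
  = unit_at H (rx (dlt3 A B D E) (box (box M N) P)) point3_prj.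
Proof.
pose l := Defs.lft (sq_assocl A B D E).
have m1 : (point3 ;; l) ;; p1 = point2 x y by rewrite /l /point3 /point2 /=; cart.
have m2 : (point3 ;; l) ;; p2 = z.
  by rewrite -point3_r /l /= /point3 /dlt3; cart.
have ez : (point3 ;; top (sq_assocl A B D E)) ;; prj A D E = w.
  by rewrite -point3_prj /= /point3 /prj3 /prj; cart.
have K := comp_at_pushl (i := bc H (std_assocl A B D E) (box (rx (dlt A B D) (box M N)) P))
  eq_refl hxyz (eq_refl : point3 ;; _ = _) (eq_refl : point3 ;; l = _) m1 m2 (point2_prj hxy) ez.
pose cc := iso_fmap (rx l)
    (iso_tens (iso_refl _) (iso_fmap (rx p2) (iso_sym (rx_id eq_refl P)))
     >> box_rx (dlt A B D) (idm (D ** E)) (box M N) P)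
  >> rx_comp (dlt3l A B D E) (box (box M N) P).
have can : fmap (rx point3) (fwd cc) ;; fwd norm3
  = fwd (rx_comp (eq_refl : point3 ;; l = _) _) ;; fwd (box_at m1 m2 _ P)
    ;; tmap (fwd (rx_comp eq_refl _) ;; fwd (box_at (point2_l x y) (point2_r hxy) M N))
            (idm _).
  have e3 : (point3 ;; l) ;; xmap (dlt A B D) (idm _) = point3 ;; dlt3 A B D E.
    by rewrite compA dlt3l.
  rewrite /cc /norm3; unfold_isos; rewrite fwd_box3l; flatten.
  rewrite (reassoc (rx_assoc eq_refl (dlt3l A B D E) e3 eq_refl _)); right_assoc.
  rewrite (reassoc (rx_comp_nat eq_refl (fwd (box_rx _ _ _ _)))); right_assoc.
  rewrite (reassoc3 (box_rx_at m1 m2 e3 eq_refl (compm1 z) point3_l point3_r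
    (box M N) P)); right_assoc.
  rewrite (reassoc (rx_comp_nat eq_refl (tmap _ _))); right_assoc.
  rewrite (reassoc (box_at_natr m1 m2 _ _)); right_assoc.
  rewrite -!tmapM; congr (_ ;; (_ ;; tmap _ _)); first by rewrite comp1m.
  by rewrite compm1 rx_comp_id -fmapM bwdK fmap1.
apply: (iso_epi (i := iso_fmap (rx point3) cc)).
have -> : fwd (odot3l H M N P)
  = fmap (push H (prj A D E))
      (fmap (rx (dlt A D E)) (bwd (box_pushl H (prj A B D) (rx (dlt A B D) (box M N)) P))
       ;; bwd (bc H (std_assocl A B D E) _))
    ;; fwd (push_comp H (prj3l A B D E) _) ;; fmap (push H (prj3 A B D E)) (fwd cc).
  by [].
unfold_isos; right_assoc; rewrite (reassoc can); right_assoc.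
rewrite (reassoc (eq_sym (tmapMl _ _ _))) (comp_atE H hxy _ _ _ (point2_prj hxy)).
rewrite_head K.
rewrite_head (unit_at_push_comp H (prj3l A B D E) (eq_refl : point3 ;; _ = _) ez point3_prj
         (rx l (box (rx (dlt A B D) (box M N)) P))).
exact: unit_at_nat.
Qed.

Lemma odot3r_at :
  fwd norm3 ;; fwd (tassoc _ _ _) ;; tmap (idm _) (comp_at H hyz N P)
    ;; comp_at H hxyz' M (odot H N P) ;; fmap (rx w) (fwd (odot3r H M N P))
  = unit_at H (rx (dlt3 A B D E) (box (box M N) P)) point3_prj.
Proof.
pose l := Defs.lft (sq_assocr A B D E).
have m1 : (point3 ;; l) ;; p1 = x by rewrite -point3_l' /l /point3 /dlt3' /=; cart.
have m2 : (point3 ;; l) ;; p2 = point2 y z.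
  by case: hxy => _ e _; rewrite /l /point3 /point2 /=; cart; rewrite ?e.
have ez : (point3 ;; top (sq_assocr A B D E)) ;; prj A B E = w.
  by rewrite -point3_prj /= /point3 /prj3 /prj; cart.
have K := comp_at_pushr (i := bc H (std_assocr A B D E) (box M (rx (dlt B D E) (box N P))))
  eq_refl hxyz' (eq_refl : point3 ;; _ = _) (eq_refl : point3 ;; l = _) m1 m2 (point2_prj hyz) ez.
pose c1 := iso_fmap (rx l)
    (iso_tens (iso_fmap (rx p1) (iso_sym (rx_id eq_refl M))) (iso_refl _)
     >> box_rx (idm (A ** B)) (dlt B D E) M (box N P))
  >> rx_comp (dlt3r A B D E) (box M (box N P)).
pose c2 := box_assoc_at M N P (dlt3_1 A B D E) (dlt3_2 A B D E) (dlt3_3 A B D E).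
pose norm3r := rx_comp (eq_refl : point3 ;; dlt3' A B D E = _) _
  >> box3r M N P point3_l' point3_r' (point2_l y z) (point2_r hyz).
have can : fmap (rx point3) (fwd c1) ;; fwd norm3r
  = fwd (rx_comp (eq_refl : point3 ;; l = _) _) ;; fwd (box_at m1 m2 M _)
    ;; tmap (idm _)
         (fwd (rx_comp eq_refl _) ;; fwd (box_at (point2_l y z) (point2_r hyz) N P)).
  have e3 : (point3 ;; l) ;; xmap (idm _) (dlt B D E) = point3 ;; dlt3' A B D E.
    by rewrite compA dlt3r.
  rewrite /c1 /norm3r; unfold_isos; rewrite fwd_box3r; flatten.
  rewrite (reassoc (rx_assoc eq_refl (dlt3r A B D E) e3 eq_refl _)); right_assoc.
  rewrite (reassoc (rx_comp_nat eq_refl (fwd (box_rx _ _ _ _)))); right_assoc.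
  rewrite (reassoc3 (box_rx_at m1 m2 e3 (compm1 x) eq_refl point3_l' point3_r'
    M (box N P))); right_assoc.
  rewrite (reassoc (rx_comp_nat eq_refl (tmap _ _))); right_assoc.
  rewrite (reassoc (box_at_natl m1 m2 _ _)); right_assoc.
  rewrite -!tmapM; congr (_ ;; (_ ;; tmap _ _)); last by rewrite comp1m.
  by rewrite compm1 rx_comp_id -fmapM bwdK fmap1.
have norm3_r : fmap (rx point3) (bwd c2) ;; fwd norm3 ;; fwd (tassoc _ _ _)
    = fwd norm3r.
  apply: (iso_epi (i := iso_fmap (rx point3) c2)).
  have := box_assoc_at_comp M N P (dlt3_1 A B D E) (dlt3_2 A B D E) (dlt3_3 A B D E)
    point3_l (point2_l x y) (point2_r hxy) point3_r point3_l' point3_r'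
    (point2_l y z) (point2_r hyz)
    (eq_refl : point3 ;; _ = _) (eq_refl : point3 ;; _ = _).
  rewrite /norm3 /norm3r; unfold_isos; right_assoc; rewrite fmap_fwdKA => <-.
  done.
apply: (iso_epi (i := iso_fmap (rx point3) (c1 >> iso_sym c2))).
have -> : fwd (odot3r H M N P)
  = fmap (push H (prj A B E))
      (fmap (rx (dlt A B E)) (bwd (box_pushr H (prj B D E) M (rx (dlt B D E) (box N P))))
       ;; bwd (bc H (std_assocr A B D E) _))
    ;; fwd (push_comp H (prj3r A B D E) _)
    ;; fmap (push H (prj3 A B D E)) (fwd (c1 >> iso_sym c2)).
  by [].
unfold_isos; flatten; rewrite (reassoc3 norm3_r) (reassoc can); right_assoc.
rewrite (reassoc (eq_sym (tmapMr _ _ _))) (comp_atE H hyz _ _ _ (point2_prj hyz)).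
rewrite_head K.
rewrite_head (unit_at_push_comp H (prj3r A B D E) (eq_refl : point3 ;; _ = _) ez point3_prj
         (rx l (box M (rx (dlt B D E) (box N P))))).
by rewrite (reassoc (unit_at_nat H point3_prj (fwd c1))) compA unit_at_nat.
Qed.

Lemma oassoc_at :
  tmap (comp_at H hxy M N) (idm _) ;; comp_at H hxyz (odot H M N) P
    ;; fmap (rx w) (fwd (oassoc H M N P))
  = fwd (tassoc _ _ _) ;; tmap (idm _) (comp_at H hyz N P)
    ;; comp_at H hxyz' M (odot H N P).
Proof.
apply: (iso_epi (i := norm3)).
apply: (iso_mono (i := iso_fmap (rx w) (odot3r H M N P))).
rewrite /oassoc; unfold_isos; flatten; rewrite -fmapM bwdK fmap1 compm1.
have := odot3l_at; have := odot3r_at; right_assoc => -> ->.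
done.
Qed.

Lemma oassoc_atV :
  tmap (idm _) (comp_at H hyz N P) ;; comp_at H hxyz' M (odot H N P)
    ;; fmap (rx w) (bwd (oassoc H M N P))
  = bwd (tassoc _ _ _) ;; (tmap (comp_at H hxy M N) (idm _)
    ;; comp_at H hxyz (odot H M N) P).
Proof.
apply: (iso_mono (i := iso_fmap (rx w) (oassoc H M N P))).
unfold_isos; right_assoc; rewrite -fmapM bwdK fmap1 compm1; apply/eq_sym/move_bwdl.
by have := oassoc_at; right_assoc.
Qed.
End Associator.

(** * Shadows at a point *)

Section Shadow.
Context {S : cartcat} {C : indexed_smcat S} (H : ihcoprod C).

Lemma bang_comp (T X : S) (a : hom T X) : a ;; bang X = bang T.
Proof. exact: bang_uniq. Qed.

Definition shad_at (T A : S) (a : hom T A) (d : hom T (A ** A)) (e : a ;; diag A = d)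
  (Q : fib C (A ** A)) : hom (rx d Q) (rx (bang T) (shad H Q)) :=
  bwd (rx_comp e Q) ;; unit_at H (rx (diag A) Q) (bang_comp a).

Lemma shad_at_nat (T A : S) (a : hom T A) (d : hom T (A ** A)) (e : a ;; diag A = d)
  (Q Q' : fib C (A ** A)) (f : hom Q Q') :
  shad_at e Q ;; fmap (rx (bang T)) (shad_map H f) = fmap (rx d) f ;; shad_at e Q'.
Proof.
rewrite /shad_at /shad_map compA unit_at_nat.
by right_assoc; rewrite (reassoc (rx_comp_natV e f)); right_assoc.
Qed.

Lemma shad_at_id (A : S) (e : idm A ;; diag A = diag A) (Q : fib C (A ** A)) :
  shad_at e Q = punit H (bang A) (rx (diag A) Q).
Proof.
apply: move_bwdl; rewrite /unit_at !(rx_unitl eq_refl).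
by rewrite rx_id_nat.
Qed.

Lemma box_sym_at (T A B : S) (t : hom T (A ** B)) (t' : hom T (B ** A))
  (x : hom T A) (y : hom T B) (e : t ;; swap A B = t')
  (e1 : t ;; p1 = x) (e2 : t ;; p2 = y) (e1' : t' ;; p1 = y) (e2' : t' ;; p2 = x)
  (M : fib C A) (N : fib C B) :
  fmap (rx t) (fwd (box_sym M N)) ;; fwd (rx_comp e _) ;; fwd (box_at e1' e2' N M)
  = fwd (box_at e1 e2 M N) ;; fwd (tsym _ _).
Proof.
have -> : fwd (box_sym M N)
  = fwd (tsym _ _) ;; bwd (box_at (pair_p1 _ _) (pair_p2 _ _) N M) by [].
rewrite compA -(box_at_comp (pair_p1 _ _) (pair_p2 _ _) e e2 e1 e1' e2').
flatten; rewrite fmap_bwdKA (reassoc (smu_symV _ _ _)) fwd_box_at; right_assoc.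
by rewrite tsym_nat.
Qed.

Section ShadPush.
Context (T A B X : S) (M : fib C (A ** B)) (N : fib C (B ** A)).

(** The shadow of a composite: the units of the two pushforwards combine, through
    the Beck-Chevalley isomorphism, to a single one over [X]. *)
Lemma comp_at_shad (top : hom X A) (lft : hom X ((A ** B) ** A))
  (e : top ;; diag A = lft ;; prj A B A)
  (i : iso (push H top (rx lft (rx (dlt A B A) (box M N))))
           (rx (diag A) (push H (prj A B A) (rx (dlt A B A) (box M N)))))
  (ei : fwd i = bc_map H (s := Square e) (rx (dlt A B A) (box M N)))
  (w : hom T X) (a : hom T A) (t : hom T ((A ** B) ** (B ** A)))
  (x : hom T (A ** B)) (y : hom T (B ** A)) (d : hom T (A ** A))
  (h : composable x y d) (ea : w ;; top = a) (ed : a ;; diag A = d)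
  (et : (w ;; lft) ;; dlt A B A = t) (e1 : t ;; p1 = x) (e2 : t ;; p2 = y)
  (eb : top ;; bang A = bang X) :
  fwd (rx_comp (eq_refl : w ;; lft = _) _) ;; fwd (rx_comp et _)
    ;; fwd (box_at e1 e2 M N) ;; comp_at H h M N ;; shad_at ed (odot H M N)
    ;; fmap (rx (bang T)) (fmap (push H (bang A)) (bwd i)
         ;; fwd (push_comp H eb _))
  = unit_at H _ (bang_comp w).
Proof.
have ep : (w ;; lft) ;; prj A B A = d by rewrite compA -e -ed -ea compA.
have K := comp_atE H h et e1 e2 ep M N.
have F := unit_at_bc H (s := Square e) (rx (dlt A B A) (box M N)) ea
  (eq_refl : w ;; lft = _) ep ed.
rewrite /shad_at; right_assoc; rewrite (reassoc3 K) (reassoc (eq_sym F)).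
flatten; rewrite fwdKA -ei (reassoc (unit_at_nat _ _ _)); right_assoc.
rewrite fmap_fwdKA -compA; exact: unit_at_push_comp.
Qed.
End ShadPush.

Section Theta.
Context (T A B : S) (M : fib C (A ** B)) (N : fib C (B ** A)).
Context (x : hom T (A ** B)) (y : hom T (B ** A)).

Lemma shad_odot_at (a : hom T A) (d : hom T (A ** A)) (e : a ;; diag A = d)
  (h : composable x y d) (t : hom T ((A ** B) ** (B ** A)))
  (et : x ;; del A B = t) (e1 : t ;; p1 = x) (e2 : t ;; p2 = y) :
  fwd (rx_comp et _) ;; fwd (box_at e1 e2 M N) ;; comp_at H h M N ;; shad_at e _
    ;; fmap (rx (bang T)) (fwd (shad_odot H M N))
  = unit_at H (rx (del A B) (box M N)) (bang_comp x).
Proof.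
have ea : x ;; p1 = a by case: h => -> _ _; rewrite -e /diag; cart.
have el : (x ;; lft (sq_shad1 A B)) ;; dlt A B A = t by rewrite compA del1.
have K := comp_at_shad (i := bc H (std_shad1 A B) (rx (dlt A B A) (box M N)))
  eq_refl h ea e el e1 e2 (bang_uniq _ (bang _)).
have -> : fwd (shad_odot H M N)
  = fmap (push H (bang A)) (bwd (bc H (std_shad1 A B) _))
    ;; fwd (push_comp H (bang_uniq _ (bang _)) _)
    ;; fmap (push H (bang (A ** B))) (fwd (rx_comp (del1 A B) _)) by [].
apply: (iso_epi (i := iso_fmap (rx x) (rx_comp (del1 A B) (box M N)))).
unfold_isos; right_assoc; rewrite (reassoc (rx_assoc eq_refl (del1 A B) el et _)).
by rewrite_head K; exact: unit_at_nat.
Qed.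

Lemma shad_odot_at' (b : hom T B) (d : hom T (B ** B)) (e : b ;; diag B = d)
  (h : composable y x d) (t : hom T ((B ** A) ** (A ** B)))
  (et : x ;; del' A B = t) (e1 : t ;; p1 = y) (e2 : t ;; p2 = x) :
  fwd (rx_comp et _) ;; fwd (box_at e1 e2 N M) ;; comp_at H h N M ;; shad_at e _
    ;; fmap (rx (bang T)) (fwd (shad_odot' H M N))
  = unit_at H (rx (del' A B) (box N M)) (bang_comp x).
Proof.
have eb : x ;; p2 = b by case: h => _ _ ->; rewrite -e /diag; cart.
have el : (x ;; lft (sq_shad2 A B)) ;; dlt B A B = t by rewrite compA del2.
have K := comp_at_shad (i := bc H (std_shad2 A B) (rx (dlt B A B) (box N M)))
  eq_refl h eb e el e1 e2 (bang_uniq _ (bang _)).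
have -> : fwd (shad_odot' H M N)
  = fmap (push H (bang B)) (bwd (bc H (std_shad2 A B) _))
    ;; fwd (push_comp H (bang_uniq _ (bang _)) _)
    ;; fmap (push H (bang (A ** B))) (fwd (rx_comp (del2 A B) _)) by [].
apply: (iso_epi (i := iso_fmap (rx x) (rx_comp (del2 A B) (box N M)))).
unfold_isos; right_assoc; rewrite (reassoc (rx_assoc eq_refl (del2 A B) el et _)).
by rewrite_head K; exact: unit_at_nat.
Qed.

(** Both sides of [theta] are identified with pushforwards along the same map, so
    on units only the symmetry of the tensor product is left. *)
Lemma theta_at (a : hom T A) (d : hom T (A ** A)) (e : a ;; diag A = d)
  (b : hom T B) (d' : hom T (B ** B)) (e' : b ;; diag B = d')
  (h : composable x y d) (h' : composable y x d') :
  comp_at H h M N ;; shad_at e _ ;; fmap (rx (bang T)) (fwd (theta H M N))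
  = fwd (tsym _ _) ;; comp_at H h' N M ;; shad_at e' _.
Proof.
have ey : y = x ;; swap A B.
  have ea : a = x ;; p1 by case: h => -> _ _; rewrite -e /diag; cart.
  by case: h => h1 h2 h3; apply: pair_ext; rewrite /swap; cart;
     rewrite -?h2 ?h3 -?e ?ea /diag; cart.
pose t := x ;; del A B; pose t' := x ;; del' A B.
have e1 : t ;; p1 = x by rewrite /t /del; cart.
have e2 : t ;; p2 = y by rewrite ey /t /del; cart.
have e1' : t' ;; p1 = y by rewrite ey /t' /del'; cart.
have e2' : t' ;; p2 = x by rewrite /t' /del'; cart.
have es : t ;; swap _ _ = t' by rewrite /t compA del_swap.
have L := shad_odot_at e h (eq_refl : _ = t) e1 e2.
have R := shad_odot_at' e' h' (eq_refl : _ = t') e1' e2'.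
have X := box_sym_at es e1 e2 e1' e2' M N.
apply: (iso_epi (i := rx_comp (eq_refl : _ = t) _ >> box_at e1 e2 M N)).
apply: (iso_mono (i := iso_fmap (rx (bang T)) (shad_odot' H M N))).
rewrite /theta; unfold_isos; flatten; rewrite -[in LHS]fmapM bwdK fmap1 compm1.
rewrite_head L; rewrite (reassoc (unit_at_nat _ _ _)); right_assoc.
rewrite unit_at_nat -R; right_assoc.
rewrite (reassoc (rx_assoc eq_refl (del_swap A B) es eq_refl _)); right_assoc.
rewrite (reassoc (rx_comp_nat eq_refl (fwd (box_sym M N)))); right_assoc.
by rewrite (reassoc3 X); right_assoc.
Qed.
End Theta.

Lemma shad_star_at (T : S) (a : hom T star) (s : hom T (star ** star))
  (e : a ;; diag star = s) (es : s ;; p1 = bang T) (P : fib C star) :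
  shad_at e (hat P) ;; fmap (rx (bang T)) (fwd (shad_star H P))
  = fwd (rx_comp es P).
Proof.
have ea : a = bang T by exact: bang_uniq.
subst a; rewrite /shad_at.
have -> : fwd (shad_star H P)
  = fmap (push H (bang star)) (fwd (rx_comp (diag_p1 star) P) ;; fwd (rx_id eq_refl P))
    ;; fwd (push_id H bang_star P) by [].
rewrite (fmapM (rx (bang T))); right_assoc; rewrite (reassoc (unit_at_nat _ _ _)); right_assoc.
rewrite unit_at_push_id compm1; apply: move_bwdl.
rewrite fmapM -(rx_comp_id (compm1 (bang T))).
exact: rx_assoc.
Qed.
End Shadow.

(** * The corresponding morphisms at a point *)

Section Hats.
Context {S : cartcat} {C : indexed_smcat S} (H : ihcoprod C).
Context (A : S) (M : fib C A).

(** Reindexing [hat M] along [rstar A] gives back [M] only up to isomorphism; this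
    isomorphism relates the duality data over [A] obtained below to [M]. *)
Definition hat_at : iso (rx (rstar A) (hat M)) M :=
  rx_comp (rstar_p1 A) M >> rx_id eq_refl M.

Lemma hat_odot_at (P : fib C star) (s : hom A (star ** star)) (es : s ;; p1 = bang A)
  (h : composable (rstar A) s (rstar A)) :
  comp_at H h (hat M) (hat P) ;; fwd (hat_odot H M P)
  = tmap (fwd hat_at) (fwd (rx_comp es P)).
Proof.
pose l := lft (sq_hat A).
have e1 : (l ;; dlt A star star) ;; p1 = rstar A.
  by rewrite /l /dlt /rstar /=; cart.
have e2 : (l ;; dlt A star star) ;; p2 = s by apply: pair_ext; exact: bang_uniq.
have ez : l ;; prj A star star = rstar A by rewrite -sqE comp1m.
have K := comp_atE H h eq_refl e1 e2 ez (hat M) (hat P).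
pose X := rx (dlt A star star) (box (hat M) (hat P)).
have F := unit_at_bc H (s := sq_hat A) X (comp1m (idm A)) (comp1m l) ez (comp1m (rstar A)).
have PP := unit_at_push_id H eq_refl (comp1m (idm A)) (rx l X).
have B : unit_at H X ez ;; bwd (bc H (std_hat A) X) ;; fwd (push_id H eq_refl (rx l X))
   = idm _.
  apply: (iso_epi (i := rx_comp (comp1m l) X)).
  rewrite_head (eq_sym F); right_assoc; rewrite (rx_unitl eq_refl (comp1m (rstar A))).
  rewrite (reassoc (rx_id_nat _ _)); right_assoc.
  rewrite (fwdKA (bc H (std_hat A) X)) -rx_id_nat.
  by rewrite_head PP; rewrite comp1m compm1 (rx_unitl eq_refl).
apply: (iso_epi (i := rx_comp eq_refl _ >> box_at e1 e2 _ _)).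
have -> : fwd (hat_odot H M P)
  = bwd (bc H (std_hat A) X) ;; fwd (push_id H eq_refl (rx l X))
    ;; fwd (rx_comp eq_refl (box (hat M) (hat P)))
    ;; fwd (box_at eq_refl eq_refl (hat M) (hat P))
    ;; tmap (fwd (rx_comp (hat_odot1 A) M) ;; fwd (rx_id eq_refl M))
            (fwd (rx_comp (hat_odot2 A) P)) by [].
unfold_isos; rewrite_head K; rewrite_head B; rewrite comp1m; right_assoc; rewrite !fwd_box_at.
right_assoc; rewrite -!tmapM; congr (_ ;; (_ ;; tmap _ _)).
  have e4 : (l ;; dlt A star star) ;; (p1 ;; p1) = idm A.
    by rewrite -compA e1 rstar_p1.
  rewrite /hat_at; unfold_isos; rewrite -!compA.
  by rewrite -(rx_assoc e1 eq_refl (rstar_p1 A) e4) -(rx_assoc eq_refl eq_refl _ e4).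
have e4 : (l ;; dlt A star star) ;; (p2 ;; p1) = bang A.
  exact: bang_uniq.
by rewrite -(rx_assoc e2 eq_refl es e4) -(rx_assoc eq_refl eq_refl _ e4).
Qed.

(** The part of [gbar g] that precedes [g]. *)
Definition gbar_in (Q : fib C (A ** A)) :
  hom (rx (diag A) Q ⊗ M) (rx (rstar A) (odot H Q (hat M))) :=
  fwd (iso_tens (iso_refl _) (iso_sym (rx_id eq_refl M))
       >> iso_sym (box_at (diag_iddiag1 A) (diag_iddiag2 A) Q M)
       >> iso_sym (rx_comp eq_refl (box Q M)))
  ;; fmap (rx (diag A)) (punit H p1 (rx (iddiag A) (box Q M)))
  ;; fwd (rx_comp (diag_p1 A) _ >> rx_id eq_refl _)
  ;; bwd (odot_hat H M Q).

(** The definition of [gbar] takes a unit and then the inverse of a Beck-Chevalley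
    isomorphism, which is composition at the point of the diagonal. *)
Lemma gbar_in_at (Q : fib C (A ** A)) (h : composable (diag A) (rstar A) (rstar A)) :
  gbar_in Q = tmap (idm _) (bwd hat_at) ;; comp_at H h Q (hat M).
Proof.
pose l := lft (sq_rstar A A); pose m := diag A ;; l.
have e1 : (m ;; dlt A A star) ;; p1 = diag A.
  by rewrite /m /l /rstar /dlt /diag /=; cart.
have e2 : (m ;; dlt A A star) ;; p2 = rstar A.
  by rewrite /m /l /rstar /dlt /diag /=; cart.
have ez : m ;; prj A A star = rstar A.
  by rewrite /m /l /rstar /prj /diag /=; cart.
have K := comp_atE H h eq_refl e1 e2 ez Q (hat M).
pose X' := rx (dlt A A star) (box Q (hat M)).
pose X := rx (iddiag A) (box Q M).
have F := unit_at_bc H (s := sq_rstar A A) X' (diag_p1 A) (eq_refl : _ = m) ez (comp1m (rstar A)).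
pose cc : iso (rx l X') X := rx_comp eq_refl (box Q (hat M))
        >> box_at (rstar_dlt1 A) eq_refl Q (hat M)
        >> iso_tens (iso_refl _) (rx_comp (rstar_dlt2 A) M)
        >> iso_sym (box_at eq_refl eq_refl Q M).
have can : fmap (rx (diag A)) (fwd cc) ;; fwd (rx_comp eq_refl (box Q M))
    ;; fwd (box_at (diag_iddiag1 A) (diag_iddiag2 A) Q M)
    ;; tmap (idm _) (fwd (rx_id eq_refl M))
  = fwd (rx_comp (eq_refl : _ = m) X') ;; fwd (rx_comp eq_refl (box Q (hat M)))
    ;; fwd (box_at e1 e2 Q (hat M)) ;; tmap (idm _) (fwd hat_at).
  have k1 : diag A ;; (iddiag A ;; p1) = diag A by rewrite -compA diag_iddiag1.
  have k2 : diag A ;; (iddiag A ;; p2) = idm A by rewrite -compA diag_iddiag2.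
  have k3 : diag A ;; (l ;; dlt A A star) = m ;; dlt A A star by rewrite compA.
  have k4 : diag A ;; ((l ;; dlt A A star) ;; p2) = rstar A.
    by rewrite -!compA -/m e2.
  rewrite (compA (fmap _ _)).
  rewrite -(box_at_comp eq_refl eq_refl eq_refl k1 k2).
  rewrite (compA _ _ (tmap _ _)) -(rx_assoc eq_refl eq_refl eq_refl k3).
  rewrite /cc; unfold_isos; flatten; rewrite fmap_bwdKA.
  rewrite (reassoc (eq_sym (box_at_comp (rstar_dlt1 A) eq_refl k3 k1 k4 e1 e2 _ _))).
  rewrite (reassoc (smu_natV _ _ _)); right_assoc.
  rewrite -!tmapM fmap1 !comp1m; congr (_ ;; (_ ;; (_ ;; tmap _ _))).
  rewrite /hat_at; unfold_isos; rewrite -!compA.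
  by rewrite (rx_assoc k4 (rstar_dlt2 A) (rstar_p1 A) k2).
pose n := rx_comp (eq_refl : _ = m) X' >> rx_comp eq_refl (box Q (hat M))
  >> box_at e1 e2 Q (hat M) >> iso_tens (iso_refl _) hat_at.
apply: (iso_epi (i := n)).
rewrite -{1}[fwd n]can /n /gbar_in.
have -> : bwd (odot_hat H M Q)
  = fmap (push H p1) (bwd cc) ;; bc_map H (s := sq_rstar A A) X' by [].
unfold_isos; flatten.
rewrite !tmap_fwdKA fwdKA fwdKA -[in RHS](compA _ _ (comp_at _ _ _ _)) K -F.
rewrite (rx_unitl eq_refl (comp1m (rstar A))); right_assoc.
rewrite rx_id_nat (reassoc (eq_sym (rx_id_nat eq_refl (fmap (push H p1) (bwd cc))))).
right_assoc; rewrite (reassoc (_ : fmap (rx (diag A)) (punit H p1 X)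
  ;; fwd (rx_comp (diag_p1 A) _) = unit_at H X (diag_p1 A))) //.
by rewrite (reassoc (unit_at_nat _ _ _)); right_assoc; rewrite fmap_fwdKA.
Qed.

Lemma gbarE (Q : fib C (A ** A)) (P : fib C star)
  (g : hom (odot H Q (hat M)) (odot H (hat M) (hat P))) :
  gbar g = gbar_in Q ;; unhat g ;; fwd (hat_odot H M P).
Proof. by []. Qed.

(** The identification of [diag_! Q ⊙ hat M] with [Q ⊗ M] is inverse to the
    generic element coming from the unit of [diag_! -| diag^*]. *)
Lemma diag_odot_hat_at (Q : fib C A) :
  tmap (punit H (diag A) Q) (idm M) ;; gbar_in (push H (diag A) Q)
    ;; fwd (diag_odot_hat H M Q) = idm (Q ⊗ M).
Proof.
pose v := diag A ;; iddiag A.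
pose X := rx (iddiag A) (box (push H (diag A) Q) M).
have ev : diag A ;; xmap (diag A) (idm A) = v by rewrite /v sq_iddiag_comm.
have E := box_pushl_at H ev (diag_p1 A) (diag_p2 A) (diag_iddiag1 A) (diag_iddiag2 A)
  (comp1m (diag A)) Q M.
have F := unit_at_bc H (s := sq_iddiag A) (box Q M) (comp1m (diag A)) (comp1m (diag A)) ev
  (eq_refl : _ = v).
have L := unit_at_push_comp H (diag_p1 A) (comp1m (diag A)) (diag_p1 A) (comp1m (idm A))
  (rx (diag A) (box Q M)).
have I := unit_at_push_id H eq_refl (comp1m (idm A)) (rx (diag A) (box Q M)).
have U : unit_at H Q (comp1m (diag A)) = fwd (rx_id eq_refl Q) ;; punit H (diag A) Q.
  by rewrite /unit_at (rx_unitl eq_refl) rx_id_nat.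
have -> : fwd (diag_odot_hat H M Q)
  = fwd (odot_hat H M (push H (diag A) Q))
    ;; fmap (push H p1) (fmap (rx (iddiag A)) (bwd (box_pushl H (diag A) Q M))
        ;; bwd (bc H (std_iddiag A) (box Q M)))
    ;; fwd (push_comp H (diag_p1 A) _) ;; fwd (push_id H eq_refl _)
    ;; fwd (box_at (diag_p1 A) (diag_p2 A) Q M)
    ;; tmap (fwd (rx_id eq_refl Q)) (fwd (rx_id eq_refl M)) by [].
rewrite /gbar_in; unfold_isos; flatten; rewrite bwdKA.
do 4 (rewrite (reassoc (eq_sym (rx_id_nat eq_refl _))); right_assoc).
rewrite (reassoc (_ : fmap (rx (diag A)) (punit H p1 X)
  ;; fwd (rx_comp (diag_p1 A) _) = unit_at H X (diag_p1 A))) //.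
do 2 (rewrite (reassoc (unit_at_nat _ _ _)); right_assoc).
apply: (iso_epi (i := box_at (diag_p1 A) (diag_p2 A) Q M
                      >> iso_tens (rx_id eq_refl Q) (rx_id eq_refl M))).
unfold_isos; right_assoc.
rewrite (reassoc (eq_sym (tmapM (fwd (rx_id eq_refl Q)) _ _ _))) compm1 -U.
rewrite (reassoc (eq_sym (tmapM (unit_at H Q _) _ _ _))) compm1 fwdK.
rewrite (reassoc (eq_sym E)); right_assoc; rewrite fwdKA.
rewrite (reassoc (rx_comp_natV _ _)); right_assoc.
rewrite (fwdKA (iso_fmap (rx (diag A)) (iso_fmap (rx (iddiag A)) (box_pushl _ _ _ _)))).
rewrite -(move_bwdl F); right_assoc; rewrite fwdKA.
rewrite (fmap_fwdKA (bc H (std_iddiag A) (box Q M))).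
rewrite (reassoc3 L) (reassoc I) comp1m -(rx_unitl eq_refl (comp1m (diag A))).
by rewrite bwdKA compm1.
Qed.
End Hats.

(** * Duality data and the trace *)

Section Correspondence.
Context {S : cartcat} {C : indexed_smcat S} (H : ihcoprod C).
Context (A : S).

(** The points of [star x A] and of [star x star] over [A]; together with [rstar A]
    and [diag A] they are the only points at which the duality is evaluated.  The
    lemmas [cps_rl] to [cps_dd] list their composable pairs, with [l], [r], [s] and
    [d] for [lstar], [rstar], [sstar] and [diag]. *)
Definition lstar : hom A (star ** A) := <[bang A, idm A]>.
Definition sstar : hom A (star ** star) := <[bang A, bang A]>.

Ltac composable_points :=
  split; rewrite /rstar /lstar /sstar /diag; cart.

Lemma cps_rl : composable (rstar A) lstar (diag A).
Proof. by composable_points. Qed.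
Lemma cps_lr : composable lstar (rstar A) sstar.
Proof. by composable_points. Qed.
Lemma cps_dr : composable (diag A) (rstar A) (rstar A).
Proof. by composable_points. Qed.
Lemma cps_rs : composable (rstar A) sstar (rstar A).
Proof. by composable_points. Qed.
Lemma cps_ld : composable lstar (diag A) lstar.
Proof. by composable_points. Qed.
Lemma cps_sl : composable sstar lstar lstar.
Proof. by composable_points. Qed.
Lemma cps_ss : composable sstar sstar sstar.
Proof. by composable_points. Qed.
Lemma cps_dd : composable (diag A) (diag A) (diag A).
Proof. by composable_points. Qed.

Lemma rstar_p2 : rstar A ;; p2 = bang A. Proof. exact: bang_uniq. Qed.
Lemma lstar_p1 : lstar ;; p1 = bang A. Proof. exact: bang_uniq. Qed.
Lemma lstar_p2 : lstar ;; p2 = idm A. Proof. by rewrite /lstar; cart. Qed.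
Lemma sstar_p1 : sstar ;; p1 = bang A. Proof. exact: bang_uniq. Qed.
Lemma sstar_diag : bang A ;; diag star = sstar.
Proof. by rewrite /sstar; cart. Qed.

Section Data.
Context (M : fib C (A ** star)) (N : fib C (star ** A)).
Context (eta : hom (ounit H A) (odot H M N)) (eps : hom (odot H N M) (ounit H star)).
Context (eta' : hom tone (rx (rstar A) M ⊗ rx lstar N)).
Context (eps' : hom (rx lstar N ⊗ rx (rstar A) M) tone).

(** Bicategorical data [eta], [eps] correspond to fiberwise data [eta'], [eps'] if
    they agree on the generic elements. *)
Definition eta_corresponds :=
  ounit_at H (comp1m (diag A)) ;; fmap (rx (diag A)) eta = eta' ;; comp_at H cps_rl M N.
Definition eps_corresponds :=
  comp_at H cps_lr N M ;; fmap (rx sstar) eps = eps' ;; ounit_at H sstar_diag.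

Hypothesis Eta : eta_corresponds.
Hypothesis Eps : eps_corresponds.

(** Each factor of the bicategorical composite is replaced by its value on
    elements; what is left is the fiberwise composite. *)
Lemma triangle_at :
  fmap (rx (rstar A))
    (bwd (olunit H M) ;; odot_map H eta (idm M) ;; fwd (oassoc H M N M)
     ;; odot_map H (idm M) eps ;; fwd (orunit H M))
  = triangle_of eta' eps'.
Proof.
have L := olunit_atV H M (rstar_p1 A) (comp1m (diag A)) cps_dr.
flatten; rewrite L; right_assoc.
rewrite (reassoc (comp_at_nat H cps_dr _ _)); right_assoc.
rewrite fmap1 (reassoc (eq_sym (tmapMl _ _ _))) Eta tmapMl; right_assoc.
rewrite (reassoc3 (oassoc_at H cps_rl cps_dr cps_lr cps_rs M N M)); right_assoc.
rewrite (reassoc (comp_at_nat H cps_rs _ _)); right_assoc.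
rewrite fmap1 (reassoc (eq_sym (tmapMr _ _ _))) Eps tmapMr; right_assoc.
have := orunit_at H M rstar_p2 sstar_diag cps_rs; right_assoc => ->.
by rewrite /triangle_of; right_assoc.
Qed.

Lemma triangleV_at :
  fmap (rx lstar)
    (bwd (orunit H N) ;; odot_map H (idm N) eta ;; bwd (oassoc H N M N)
     ;; odot_map H eps (idm N) ;; fwd (olunit H N))
  = triangleV_of eta' eps'.
Proof.
have L := orunit_atV H N lstar_p2 (comp1m (diag A)) cps_ld.
flatten; rewrite L; right_assoc.
rewrite (reassoc (comp_at_nat H cps_ld _ _)); right_assoc.
rewrite fmap1 (reassoc (eq_sym (tmapMr _ _ _))) Eta tmapMr; right_assoc.
rewrite (reassoc3 (oassoc_atV H cps_lr cps_sl cps_rl cps_ld N M N)); right_assoc.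
rewrite (reassoc (comp_at_nat H cps_sl _ _)); right_assoc.
rewrite fmap1 (reassoc (eq_sym (tmapMl _ _ _))) Eps tmapMl; right_assoc.
have := olunit_at H N lstar_p1 sstar_diag cps_sl; right_assoc => ->.
by rewrite /triangleV_of; right_assoc.
Qed.

(** The hypothesis says that [g] has the fiberwise form [g'].  Starting from the
    generic element of the shadow of [Q], the factors of the two traces match one by
    one. *)
Lemma trace_at (Q : fib C (A ** A)) (P : fib C (star ** star))
  (g : hom (odot H Q M) (odot H M P))
  (g' : hom (rx (diag A) Q ⊗ rx (rstar A) M) (rx (rstar A) M ⊗ rx sstar P)) :
  comp_at H cps_dr Q M ;; fmap (rx (rstar A)) g = g' ;; comp_at H cps_rs M P ->
  shad_at H (comp1m (diag A)) Q ;; fmap (rx (bang A))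
    (shad_map H (bwd (orunit H Q)) ;; shad_map H (odot_map H (idm Q) eta)
     ;; shad_map H (bwd (oassoc H Q M N))
     ;; shad_map H (odot_map H g (idm N))
     ;; fwd (theta H (odot H M P) N)
     ;; shad_map H (bwd (oassoc H N M P))
     ;; shad_map H (odot_map H eps (idm P))
     ;; shad_map H (fwd (olunit H P)))
  = trace_of eta' eps' g' ;; shad_at H sstar_diag P.
Proof.
move=> eg; flatten.
do 4 (rewrite (reassoc (shad_at_nat _ _ _)); right_assoc).
rewrite (orunit_atV H Q (diag_p2 A) (comp1m (diag A)) cps_dd); right_assoc.
rewrite (reassoc (comp_at_nat H cps_dd _ _)); right_assoc.
rewrite fmap1 (reassoc (eq_sym (tmapMr _ _ _))) Eta tmapMr; right_assoc.
rewrite (reassoc3 (oassoc_atV H cps_dr cps_rl cps_rl cps_dd Q M N)); right_assoc.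
rewrite (reassoc (comp_at_nat H cps_rl _ _)); right_assoc.
rewrite fmap1 (reassoc (eq_sym (tmapMl _ _ _))) eg tmapMl; right_assoc.
rewrite (reassoc3 (theta_at H _ _ (comp1m (diag A)) sstar_diag cps_rl cps_lr)).
right_assoc.
rewrite (reassoc (tsym_nat (comp_at H cps_rs M P) _)); right_assoc.
do 2 (rewrite (reassoc (shad_at_nat _ _ _)); right_assoc).
rewrite shad_at_nat.
rewrite (reassoc3 (oassoc_atV H cps_lr cps_ss cps_rs cps_lr N M P)); right_assoc.
rewrite (reassoc (comp_at_nat H cps_ss _ _)); right_assoc.
rewrite fmap1 (reassoc (eq_sym (tmapMl _ _ _))) Eps tmapMl; right_assoc.
rewrite (reassoc3 (olunit_at H P sstar_p1 sstar_diag cps_ss)).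
by rewrite /trace_of; right_assoc.
Qed.
End Data.

Lemma unit_at_iso (T B D : S) (i : iso B D) (X : fib C B) (u : hom T B) (v : hom T D)
  (e : u ;; fwd i = v) : inverse (unit_at H X e).
Proof.
pose p := iso_fmap (rx u) (iso_of_inverse (punit_iso H i X)) >> rx_comp e _.
exact: Inverse (fwdK p) (bwdK p).
Defined.

Lemma prj_starK (B D : S) :
  prj B star D ;; <[<[p1, bang (B ** D)]>, p2]> = idm _.
Proof. by rewrite /prj; cart. Qed.
Lemma prj_starVK (B D : S) :
  <[<[p1, bang (B ** D)]>, p2]> ;; prj B star D = idm _.
Proof. by rewrite /prj; cart. Qed.

(** Over the terminal object the projection used in the composition is an
    isomorphism, so no information is lost by the pushforward. *)
Lemma comp_at_iso (T B D : S) (x : hom T (B ** star)) (y : hom T (star ** D))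
  (z : hom T (B ** D)) (h : composable x y z) (M : fib C (B ** star))
  (N : fib C (star ** D)) : inverse (comp_at H h M N).
Proof.
pose p := iso_sym (rx_comp eq_refl (box M N) >> box_at (point2_l x y) (point2_r h) M N)
  >> iso_of_inverse (unit_at_iso (i := Iso (prj_starK B D) (prj_starVK B D))
       (rx (dlt B star D) (box M N)) (point2_prj h)).
exact: Inverse (fwdK p) (bwdK p).
Defined.

Lemma diag_starVK : p1 ;; diag star = idm (star ** star : S).
Proof. by cart. Qed.

Lemma ounit_at_iso (T : S) (a : hom T star) (d : hom T (star ** star))
  (e : a ;; diag star = d) : inverse (ounit_at H e).
Proof.
pose p := iso_sym (rx_unit a)
  >> iso_of_inverse (unit_at_iso (i := Iso (diag_p1 star) diag_starVK)
       (rx (bang star) tone) e).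
exact: Inverse (fwdK p) (bwdK p).
Defined.

(** A morphism out of [ounit H A], a pushforward, is given by its value on the
    generic element. *)
Lemma eta_exists M N (eta' : hom tone (rx (rstar A) M ⊗ rx lstar N)) :
  exists eta : hom (ounit H A) (odot H M N), eta_corresponds eta eta'.
Proof.
(* The first two factors undo the identification of [I] with the reindexed unit
   object that is part of [ounit_at]. *)
exists (transp H (bwd (rx_id eq_refl _) ;; fwd (rx_unit (idm A)) ;; eta'
                  ;; comp_at H cps_rl M N)).
rewrite /eta_corresponds /ounit_at; right_assoc.
rewrite unit_at_transp (rx_unitl eq_refl) rx_id_nat.
by right_assoc; rewrite fwdKA bwdKA.
Qed.

Lemma point2_lrK : point2 lstar (rstar A) ;; (p1 ;; p2) = idm A.
Proof. by rewrite /point2 /lstar; cart. Qed.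
Lemma point2_lrVK : (p1 ;; p2) ;; point2 lstar (rstar A) = idm _.
Proof. by rewrite /point2 /lstar /rstar; cart. Qed.

(** For a composite over [star] evaluated at this point, the middle map is an
    isomorphism, so the required morphism over the triple product can be transported
    back from [A]. *)
Lemma eps_exists M N (eps' : hom (rx lstar N ⊗ rx (rstar A) M) tone) :
  exists eps : hom (odot H N M) (ounit H star), eps_corresponds eps eps'.
Proof.
pose i := Iso point2_lrK point2_lrVK.
pose n := rx_comp eq_refl (box N M) >> box_at (point2_l lstar (rstar A)) (point2_r cps_lr) N M.
pose z := fwd n ;; eps' ;; ounit_at H sstar_diag ;; bwd (rx_comp (point2_prj cps_lr) _).
exists (transp H (rx_full (i := i) z)).
rewrite /eps_corresponds /comp_at; right_assoc; rewrite unit_at_transp (rx_fullK (i := i)) /z.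
by right_assoc; rewrite bwdKA bwdK compm1.
Qed.
End Correspondence.

(** * Comparison of the two traces *)

Lemma factor_inverse (C : category) (X Y Z : C) (f : hom X Z) (k : hom Y Z) :
  inverse k -> exists f', f = f' ;; k.
Proof. by case=> k' _ K; exists (f ;; k'); rewrite compA K compm1. Qed.

Section Main.
Context {S : cartcat} {C : indexed_smcat S} (H : ihcoprod C).
Context (A : S) (M : fib C A).

Lemma adjunct_counit (X : fib C A) (Y : fib C star) (f : hom (push H (bang A) X) Y) :
  f = fmap (push H (bang A)) (punit H (bang A) X ;; fmap (rx (bang A)) f)
      ;; pcounit H (bang A) Y.
Proof. by apply: transp_inj; rewrite -[_ ;; pcounit _ _ _]/(transp H _) transpK. Qed.

Definition irstar : iso A (A ** star) := Iso (rstar_p1 A) (p1_rstar A).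

Lemma lstar_p2K : p2 ;; lstar A = idm (star ** A).
Proof. by rewrite /lstar; cart. Qed.
Definition ilstar : iso A (star ** A) := Iso (lstar_p2 A) lstar_p2K.

(** Transport the fiberwise dual to an object over [star x A], lift unit and counit,
    and check the triangle identities after reindexing along isomorphisms. *)
Lemma rdual_hat (D : dual M) : inhabited (rdual H (hat M)).
Proof.
pose N : fib C (star ** A) := rx p2 (du_ob D).
pose j : iso (rx (lstar A) N) (du_ob D)
  := rx_comp (lstar_p2 A) (du_ob D) >> rx_id eq_refl _.
pose i := hat_at M.
pose eta' := du_eta D ;; tmap (bwd i) (bwd j).
pose eps' := tmap (fwd j) (fwd i) ;; du_eps D.
have [eta Eta] := eta_exists H eta'.
have [eps Eps] := eps_exists H eps'.
have e1 : du_eta D = eta' ;; tmap (fwd i) (fwd j).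
  by rewrite /eta' compA -tmapM !bwdK tmap1 compm1.
have T1 : triangle_of eta' eps' = idm _.
  apply: (iso_mono (i := i)).
  by rewrite (triangle_slide e1 eq_refl) [triangle_of _ _]du_tri comp1m compm1.
have T2 : triangleV_of eta' eps' = idm _.
  apply: (iso_mono (i := j)).
  by rewrite (triangleV_slide e1 eq_refl) [triangleV_of _ _]du_triV comp1m compm1.
constructor; apply: (@RDual _ _ _ _ _ _ N eta eps).
  apply: (rx_faithful (i := irstar)) => /=.
  by rewrite (triangle_at Eta Eps) fmap1.
apply: (rx_faithful (i := ilstar)) => /=.
by rewrite (triangleV_at Eta Eps) fmap1.
Qed.

Section Trace.
Context (D : dual M) (Dh : rdual H (hat M)).

(** The given right dual of [hat M] and [D] yield two duals in the fibre over [A];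
    the trace does not distinguish them. *)
Lemma btrace_adjunct (Q : fib C (A ** A)) (P : fib C star)
  (g : hom (odot H Q (hat M)) (odot H (hat M) (hat P))) :
  smtrace D (gbar g)
  = punit H (bang A) (rx (diag A) Q)
    ;; fmap (rx (bang A)) (btrace Dh g ;; fwd (shad_star H P)).
Proof.
case: Dh => N eta eps tri triV.
have [eta' Eta] := factor_inverse (ounit_at H (comp1m (diag A)) ;; fmap (rx (diag A)) eta)
  (comp_at_iso H (cps_rl A) (hat M) N).
have [eps' Eps] := factor_inverse (comp_at H (cps_lr A) N (hat M) ;; fmap (rx (sstar A)) eps)
  (ounit_at_iso H (sstar_diag A)).
have T : triangle_of eta' eps' = idm _ by rewrite -(triangle_at Eta Eps) tri fmap1.
have [g' Eg] := factor_inverse (comp_at H (cps_dr A) Q (hat M) ;; fmap (rx (rstar A)) g)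
  (comp_at_iso H (cps_rs A) (hat M) (hat P)).
rewrite -(shad_at_id H (comp1m (diag A))) fmapM -compA (trace_at Eta Eps Eg) compA.
rewrite (shad_star_at H (sstar_diag A) (sstar_p1 A)); apply: eq_sym.
apply: (trace_unique (i := hat_at M)) => //; first exact: du_tri.
rewrite gbarE (gbar_in_at H M Q (cps_dr A)); right_assoc; rewrite tmap_fwdKA.
rewrite /unhat (reassoc Eg); right_assoc.
by rewrite (hat_odot_at H M P (sstar_p1 A) (cps_rs A)).
Qed.

Lemma btrace_counit (Q : fib C (A ** A)) (P : fib C star)
  (g : hom (odot H Q (hat M)) (odot H (hat M) (hat P))) :
  btrace Dh g ;; fwd (shad_star H P)
  = fmap (push H (bang A)) (smtrace D (gbar g)) ;; pcounit H (bang A) P.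
Proof. by rewrite btrace_adjunct; exact: adjunct_counit. Qed.

Lemma unhat_rehat (X Y : fib C (A ** star))
  (x : hom (rx (rstar A) X) (rx (rstar A) Y)) : unhat (rehat x) = x.
Proof.
have E Z : fwd (hat_rstar Z) = fwd (rx_bwdfwd irstar Z) by [].
have E' Z : bwd (hat_rstar Z) = bwd (rx_bwdfwd irstar Z) by [].
by rewrite /unhat /rehat E E'; exact: (rx_fullK (i := irstar)).
Qed.

Lemma rehat_unhat (X Y : fib C (A ** star)) (x : hom X Y) : rehat (unhat x) = x.
Proof.
by apply: (rx_faithful (i := irstar)); exact: (unhat_rehat (unhat x)).
Qed.

(** The identifications of the targets in [gbar] and in [fhat] are the same, and
    those of the sources cancel by [diag_odot_hat_at]. *)
Lemma gbar_fhat (Q : fib C A) (P : fib C star) (f : hom (Q ⊗ M) (M ⊗ rx (bang A) P)) :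
  tmap (punit H (diag A) Q) (idm M) ;; gbar (fhat H f) = f.
Proof.
rewrite gbarE /fhat unhat_rehat; right_assoc; rewrite bwdK compm1.
by rewrite (reassoc3 (diag_odot_hat_at H M Q)) comp1m.
Qed.

Lemma btrace_fhat (Q : fib C A) (P : fib C star)
  (f : hom (Q ⊗ M) (M ⊗ rx (bang A) P)) :
  fmap (push H (bang A)) (punit H (diag A) Q)
    ;; (btrace Dh (fhat H f) ;; fwd (shad_star H P))
  = fmap (push H (bang A)) (smtrace D f) ;; pcounit H (bang A) P.
Proof.
rewrite btrace_counit -compA -fmapM; congr (fmap _ _ ;; _).
by rewrite [LHS]trace_nat_dom gbar_fhat.
Qed.

Lemma btrace_ftilde (Q P : fib C A) (f : hom (Q ⊗ M) (M ⊗ P)) :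
  fmap (push H (bang A)) (smtrace D f)
  = fmap (push H (bang A)) (punit H (diag A) Q)
    ;; (btrace Dh (ftilde H f) ;; fwd (shad_star H (push H (bang A) P))).
Proof.
have -> : ftilde H f = fhat H (f ;; tmap (idm M) (punit H (bang A) P)).
  by rewrite /ftilde /fhat !compA.
rewrite btrace_fhat -[smtrace D (_ ;; _)]trace_nat_cod fmapM compA.
by rewrite [_ ;; pcounit _ _ _]adj_triL compm1.
Qed.

Lemma fhat_bij (Q : fib C A) (P : fib C star) :
  exists unfhat : hom (odot H (push H (diag A) Q) (hat M))
                      (odot H (hat M) (hat P)) ->
                  hom (Q ⊗ M) (M ⊗ rx (bang A) P),
    (forall f, unfhat (fhat H f) = f) /\ (forall h, fhat H (unfhat h) = h).
Proof.
exists (fun h => bwd (diag_odot_hat H M Q) ;; unhat h ;; fwd (hat_odot H M P)).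
split=> [f|h]; rewrite /fhat.
  by rewrite unhat_rehat; right_assoc; rewrite bwdK compm1 bwdKA.
rewrite -[RHS]rehat_unhat; congr (rehat _).
by right_assoc; rewrite fwdK compm1 fwdKA.
Qed.
End Trace.
End Main.

Theorem theorem6p9 (S : cartcat) (C : indexed_smcat S) (H : ihcoprod C)
    (A : S) (M : fib C A) (D : dual M) :
  inhabited (rdual H (hat M)) /\
  forall Dh : rdual H (hat M),
  (* (i) *)
  (forall (Q : fib C (A ** A)) (P : fib C star)
      (g : hom (odot H Q (hat M)) (odot H (hat M) (hat P))),
    btrace Dh g ;; fwd (shad_star H P)
    = fmap (push H (bang A)) (smtrace D (gbar g)) ;; pcounit H (bang A) P
    /\
    smtrace D (gbar g)
    = punit H (bang A) (rx (diag A) Q)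
      ;; fmap (rx (bang A)) (btrace Dh g ;; fwd (shad_star H P))) /\
  (* (ii) *)
  (forall (Q P : fib C A) (f : hom (Q ⊗ M) (M ⊗ P)),
    fmap (push H (bang A)) (smtrace D f)
    = fmap (push H (bang A)) (punit H (diag A) Q)
      ;; (btrace Dh (ftilde H f) ;; fwd (shad_star H (push H (bang A) P)))) /\
  (* (iii) *)
  (forall (Q : fib C A) (P : fib C star),
    (exists unfhat : hom (odot H (push H (diag A) Q) (hat M))
                         (odot H (hat M) (hat P)) ->
                     hom (Q ⊗ M) (M ⊗ rx (bang A) P),
      (forall f, unfhat (fhat H f) = f) /\ (forall h, fhat H (unfhat h) = h)) /\
    forall f : hom (Q ⊗ M) (M ⊗ rx (bang A) P),
      fmap (push H (bang A)) (punit H (diag A) Q)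
        ;; (btrace Dh (fhat H f) ;; fwd (shad_star H P))
      = fmap (push H (bang A)) (smtrace D f) ;; pcounit H (bang A) P).
Proof.
split; first exact: rdual_hat D.
move=> Dh; split=> [Q P g|].
  by split; [exact: btrace_counit | exact: btrace_adjunct].
split=> [Q P f|Q P]; first exact: btrace_ftilde.
by split=> [|f]; [exact: fhat_bij | exact: btrace_fhat].
Qed.
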